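(* The following are equivalent over $\mathsf{RCA}_0$: (i) The strong cohesive principle $\mathsf{StCOH}$ holds. (ii) Any continuous function $f\colon[0,1]\to\mathbb R$ is uniformly continuous. (iii) Any continuous function $f\colon[0,1]\to\mathbb R$ has a maximum and a minimum. (iv) Any continuous function $f\colon[0,1]\to\mathbb R$ is bounded.
   Context: $\mathsf{RCA}_0$ is the usual base system of second-order arithmetic (basic arithmetic axioms, $\Sigma^0_1$-induction, $\Delta^0_1$-comprehension). ''Equivalent over $\mathsf{RCA}_0$'' means that the equivalences, formalized in second-order arithmetic, are provable in $\mathsf{RCA}_0$. Reals. A real is a Cauchy sequence $x=(x_n)_{n\in\mathbb N}$ of rationals with no rate of convergence given: for each rational $\varepsilon>0$ there is an $N\in\mathbb N$ with $|x_m-x_n|<\varepsilon$ for all $m,n\geq N$. For reals $x,y$: $x\leq y$ means that for each rational $\varepsilon>0$ there is an $N$ with $x_n\leq y_n+\varepsilon$ for all $n\geq N$; $x=y$ means $x\leq y$ and $y\leq x$; $x<y$ means $x\leq y$ but not $x=y$. Addition, multiplication and absolute value are defined pointwise; rationals are identified with constant sequences. Put $B_\delta(y)=\{z\in\mathbb R:|y-z|<\delta\}$ and $[0,1]=\{x\in\mathbb R:0\leq x\leq 1\}$. Continuous functions. A partial continuous function on $\mathbb R$ is (represented by) an arbitrary function $f\colon\mathbb Q\to\mathbb Q^{\mathbb N}$, $f(q)=(f(q)_i)_{i\in\mathbb N}$. A real $x$ lies in $\operatorname{dom}(f)$ if each $\varepsilon>0$ admits a (positive) $N\in\mathbb N$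 such that $|f(q)_i-f(r)_j|<\varepsilon$ for all rationals $q,r\in B_{1/N}(x)$ and all $i,j\geq N$. For $x=(x_i)\in\operatorname{dom}(f)$ the value is the real $f(x)=(f(x_i)_i)_{i\in\mathbb N}$. A continuous function $f\colon D\to\mathbb R$ is such an $f$ with $D\subseteq\operatorname{dom}(f)$. Uniform continuity of $f\colon[0,1]\to\mathbb R$ means: each $\varepsilon>0$ admits a $\delta>0$ such that $|f(x)-f(y)|<\varepsilon$ for all $x,y\in[0,1]$ with $|x-y|<\delta$. Having a maximum means that there is an $x\in[0,1]$ with $f(y)\leq f(x)$ for all $y\in[0,1]$; similarly for a minimum. Principles. $\mathsf{IPP}$ (infinite pigeonhole principle): for any $N\in\mathbb N$ and any $c\colon\mathbb N\to\{0,\ldots,N\}$ there is an $n\leq N$ such that $\{i\in\mathbb N:c(i)=n\}$ is infinite. $\mathsf{COH}$ (cohesive principle): for any family of sets $(R_i)_{i\in\mathbb N}$, $R_i\subseteq\mathbb N$, there is an infinite set $C\subseteq\mathbb N$ such that for each $i$, $C\setminus R_i$ is finite or $C\setminus(\mathbb N\setminus R_i)$ is finite. $\mathsf{StCOH}$ is the conjunction of $\mathsf{COH}$ and $\mathsf{IPP}$. *)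

(* Defs.v *)
From Stdlib Require Import List.
Import ListNotations.

(** * The language of second-order arithmetic

    De Bruijn indices, with separate index spaces for number variables and set
    variables.  The primitive connectives are falsum, implication and the two
    universal quantifiers; the others are their classical definitions.  As
    usual in second-order arithmetic, equality is only between numbers. *)

Inductive term : Type :=
| tvar (n : nat)
| tzero
| tone
| tadd (s t : term)
| tmul (s t : term).

Inductive form : Type :=
| fEq (s t : term)
| fLt (s t : term)
| fIn (t : term) (X : nat)
| fBot
| fImp (p q : form)
| fAll (p : form)   (* binds number variable 0 *)
| fAllS (p : form). (* binds set variable 0 *)

Definition fNot p := fImp p fBot.
Definition fAnd p q := fNot (fImp p (fNot q)).
Definition fOr p q := fImp (fNot p) q.
Definition fIff p q := fAnd (fImp p q) (fImp q p).
Definition fEx p := fNot (fAll (fNot p)).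
Definition fExS p := fNot (fAllS (fNot p)).

Fixpoint tsubst (σ : nat -> term) (t : term) : term :=
  match t with
  | tvar n => σ n
  | tzero => tzero
  | tone => tone
  | tadd s t => tadd (tsubst σ s) (tsubst σ t)
  | tmul s t => tmul (tsubst σ s) (tsubst σ t)
  end.

Definition scons {A : Type} (a : A) (σ : nat -> A) (n : nat) : A :=
  match n with 0 => a | S m => σ m end.

Definition tshift : term -> term := tsubst (fun n => tvar (S n)).

Definition tup (σ : nat -> term) : nat -> term :=
  scons (tvar 0) (fun n => tshift (σ n)).

Definition sup (ρ : nat -> nat) : nat -> nat :=
  scons 0 (fun n => S (ρ n)).

(* [σ] acts on number variables, [ρ] renames set variables. *)
Fixpoint fsubst (σ : nat -> term) (ρ : nat -> nat) (p : form) : form :=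
  match p with
  | fEq s t => fEq (tsubst σ s) (tsubst σ t)
  | fLt s t => fLt (tsubst σ s) (tsubst σ t)
  | fIn t X => fIn (tsubst σ t) (ρ X)
  | fBot => fBot
  | fImp p q => fImp (fsubst σ ρ p) (fsubst σ ρ q)
  | fAll p => fAll (fsubst (tup σ) ρ p)
  | fAllS p => fAllS (fsubst σ (sup ρ) p)
  end.

Definition shiftN : form -> form := fsubst (fun n => tvar (S n)) (fun X => X).
Definition shiftS : form -> form := fsubst tvar S.

Definition instN (t : term) : form -> form := fsubst (scons t tvar) (fun X => X).
Definition instS (X : nat) : form -> form := fsubst tvar (scons X (fun Y => Y)).

(** * Provability

    Natural deduction for classical two-sorted logic with equality between
    numbers.  The eigenvariable conditions of [pAllI] and [pAllSI] concern the
    context only: an axiom of [T] with free variables has the force of its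
    universal closure. *)

Inductive proves (T : form -> Prop) : list form -> form -> Prop :=
| pAx Γ p : T p -> proves T Γ p
| pHyp Γ p : In p Γ -> proves T Γ p
| pImpI Γ p q : proves T (p :: Γ) q -> proves T Γ (fImp p q)
| pImpE Γ p q : proves T Γ (fImp p q) -> proves T Γ p -> proves T Γ q
| pContra Γ p : proves T (fNot p :: Γ) fBot -> proves T Γ p
| pAllI Γ p : proves T (map shiftN Γ) p -> proves T Γ (fAll p)
| pAllE Γ p t : proves T Γ (fAll p) -> proves T Γ (instN t p)
| pAllSI Γ p : proves T (map shiftS Γ) p -> proves T Γ (fAllS p)
| pAllSE Γ p X : proves T Γ (fAllS p) -> proves T Γ (instS X p)
| pEqI Γ t : proves T Γ (fEq t t)
| pEqE Γ p s t :
    proves T Γ (fEq s t) -> proves T Γ (instN s p) -> proves T Γ (instN t p).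

(** * The theory [RCA0] *)

(* The bound [t] is shifted, hence does not contain the quantified variable. *)
Inductive Sigma00 : form -> Prop :=
| S00Eq s t : Sigma00 (fEq s t)
| S00Lt s t : Sigma00 (fLt s t)
| S00In t X : Sigma00 (fIn t X)
| S00Bot : Sigma00 fBot
| S00Imp p q : Sigma00 p -> Sigma00 q -> Sigma00 (fImp p q)
| S00All t p :
    Sigma00 p -> Sigma00 (fAll (fImp (fLt (tvar 0) (tshift t)) p)).

Definition Sigma01 (p : form) : Prop := exists q, Sigma00 q /\ p = fEx q.
Definition Pi01 (p : form) : Prop := exists q, Sigma00 q /\ p = fAll q.

Definition tsucc (t : term) : term := tadd t tone.

(* [p] with the successor of number variable 0 in place of that variable *)
Definition instSucc : form -> form :=
  fsubst (scons (tsucc (tvar 0)) (fun n => tvar (S n))) (fun X => X).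

Inductive RCA0 : form -> Prop :=
| ax_succ_neq_zero m : RCA0 (fNot (fEq (tsucc m) tzero))
| ax_succ_inj m n : RCA0 (fImp (fEq (tsucc m) (tsucc n)) (fEq m n))
| ax_add_zero m : RCA0 (fEq (tadd m tzero) m)
| ax_add_succ m n : RCA0 (fEq (tadd m (tsucc n)) (tsucc (tadd m n)))
| ax_mul_zero m : RCA0 (fEq (tmul m tzero) tzero)
| ax_mul_succ m n : RCA0 (fEq (tmul m (tsucc n)) (tadd (tmul m n) m))
| ax_lt_zero m : RCA0 (fNot (fLt m tzero))
| ax_lt_succ m n :
    RCA0 (fIff (fLt m (tsucc n)) (fOr (fLt m n) (fEq m n)))
| ax_Sigma01_induction p : Sigma01 p ->
    RCA0 (fImp (fAnd (instN tzero p) (fAll (fImp p (instSucc p)))) (fAll p))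
| ax_Delta01_comprehension p q : Sigma01 p -> Pi01 q ->
    RCA0 (fImp (fAll (fIff p q))
               (fExS (fAll (fIff (fIn (tvar 0) 0) (shiftS p))))).

(** * Named syntax for formulas

    To write concrete formulas with Rocq's own bound variables, an expression
    is represented as a function of the numbers [n] and [s] of enclosing number
    and set quantifiers.  The variable bound below [k] quantifiers of its sort
    is the one of de Bruijn level [k], which at depth [n > k] has de Bruijn
    index [n - S k].  A sentence is read off at depth 0. *)

Definition tm : Type := nat -> term.
Definition st : Type := nat -> nat.
Definition fm : Type := nat -> nat -> form.

Definition sentence (p : fm) : form := p 0 0.

Declare Scope fm_scope.
Delimit Scope fm_scope with fm.
Bind Scope fm_scope with tm.
Bind Scope fm_scope with fm.

Definition Zero : tm := fun _ => tzero.
Definition One : tm := fun _ => tone.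
Definition Add (a b : tm) : tm := fun n => tadd (a n) (b n).
Definition Mul (a b : tm) : tm := fun n => tmul (a n) (b n).

Definition Eq (a b : tm) : fm := fun n _ => fEq (a n) (b n).
Definition Lt (a b : tm) : fm := fun n _ => fLt (a n) (b n).
Definition Mem (a : tm) (X : st) : fm := fun n s => fIn (a n) (X s).
Definition Bot : fm := fun _ _ => fBot.
Definition Imp (p q : fm) : fm := fun n s => fImp (p n s) (q n s).
Definition Not (p : fm) : fm := fun n s => fNot (p n s).
Definition And (p q : fm) : fm := fun n s => fAnd (p n s) (q n s).
Definition Or (p q : fm) : fm := fun n s => fOr (p n s) (q n s).
Definition Iff (p q : fm) : fm := fun n s => fIff (p n s) (q n s).
Definition All (p : tm -> fm) : fm :=
  fun n s => fAll (p (fun n' => tvar (n' - S n)) (S n) s).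
Definition Ex (p : tm -> fm) : fm :=
  fun n s => fEx (p (fun n' => tvar (n' - S n)) (S n) s).
Definition AllS (p : st -> fm) : fm :=
  fun n s => fAllS (p (fun s' => s' - S s) n (S s)).
Definition ExS (p : st -> fm) : fm :=
  fun n s => fExS (p (fun s' => s' - S s) n (S s)).

Notation "0" := Zero : fm_scope.
Notation "1" := One : fm_scope.
Notation "a + b" := (Add a b) : fm_scope.
Notation "a * b" := (Mul a b) : fm_scope.
Notation "a = b" := (Eq a b) : fm_scope.
Notation "a < b" := (Lt a b) : fm_scope.
Notation "a <= b" := (Or (Lt a b) (Eq a b)) : fm_scope.
Notation "a \in X" := (Mem a X) (at level 70, no associativity) : fm_scope.
Notation "~ p" := (Not p) : fm_scope.
Notation "p /\ q" := (And p q) : fm_scope.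
Notation "p \/ q" := (Or p q) : fm_scope.
Notation "p ==> q" := (Imp p q) (at level 99, right associativity) : fm_scope.
Notation "p <==> q" := (Iff p q) (at level 95, no associativity) : fm_scope.
Notation "\all x .. y , p" := (All (fun x => .. (All (fun y => p)) ..))
  (at level 200, x binder, y binder, right associativity) : fm_scope.
Notation "\ex x .. y , p" := (Ex (fun x => .. (Ex (fun y => p)) ..))
  (at level 200, x binder, y binder, right associativity) : fm_scope.
Notation "\allS X .. Y , p" := (AllS (fun X => .. (AllS (fun Y => p)) ..))
  (at level 200, X binder, Y binder, right associativity) : fm_scope.
Notation "\exS X .. Y , p" := (ExS (fun X => .. (ExS (fun Y => p)) ..))
  (at level 200, X binder, Y binder, right associativity) : fm_scope.

Local Open Scope fm_scope.

(** * Pairs, functions, finite sets *)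

Definition pair (a b : tm) : tm := (a + b) * (a + b) + a.

(* Definable classes of numbers; sets are the members of the second sort. *)
Definition class : Type := tm -> fm.

Definition Nat : class := fun _ => ~ Bot.
Definition upto (N : tm) : class := fun a => a <= N.

Definition is_function (A B : class) (f : st) : fm :=
  (\all k, k \in f ==> \ex a b, A a /\ B b /\ k = pair a b) /\
  (\all a, A a ==>
     \ex b, B b /\ pair a b \in f /\
            \all b', B b' ==> pair a b' \in f ==> b' = b).

Definition finite (A : class) : fm := \ex b, \all n, A n ==> n < b.
Definition infinite (A : class) : fm := ~ finite A.
Definition elements (X : st) : class := fun n => n \in X.
Definition compl (A : class) : class := fun n => ~ A n.
Definition diff (A B : class) : class := fun n => A n /\ ~ B n.

(** * Combinatorial principles *)

Definition IPP : fm :=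
  \all N, \allS c, is_function Nat (upto N) c ==>
    \ex n, n <= N /\ infinite (fun i => pair i n \in c).

(* A family of sets is a single set, with the pairing function as index. *)
Definition section (R : st) (i : tm) : class := fun n => pair i n \in R.

Definition COH : fm :=
  \allS R, \exS C,
    infinite (elements C) /\
    \all i, finite (diff (elements C) (section R i)) \/
            finite (diff (elements C) (compl (section R i))).

Definition StCOH : fm := COH /\ IPP.

(** * Rational numbers

    [mkrat a b c] stands for (a - b) / c with c > 0. *)

Record rat : Type := mkrat { pos : tm; neg : tm; den : tm }.

Definition qadd (q r : rat) : rat :=
  mkrat (pos q * den r + pos r * den q)
        (neg q * den r + neg r * den q) (den q * den r).
Definition qopp (q : rat) : rat := mkrat (neg q) (pos q) (den q).
Definition qsub (q r : rat) : rat := qadd q (qopp r).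

Definition qeq (q r : rat) : fm :=
  pos q * den r + neg r * den q = pos r * den q + neg q * den r.
Definition qlt (q r : rat) : fm :=
  pos q * den r + neg r * den q < pos r * den q + neg q * den r.
Definition qle (q r : rat) : fm := qlt q r \/ qeq q r.

Definition qzero : rat := mkrat 0 0 1.
Definition qone : rat := mkrat 1 0 1.
Definition qinv_nat (N : tm) : rat := mkrat 1 0 N.

Definition qis_abs (r q : rat) : fm :=
  (qle qzero q /\ qeq r q) \/ (qle q qzero /\ qeq r (qopp q)).
Definition qabs_lt (q e : rat) : fm := qlt q e /\ qlt (qopp q) e.

(* The chosen representative of each rational: the fraction in lowest terms,
   i.e. with least denominator, whose numerator is [pos] or minus [neg].  The
   elements of Q are the codes of these. *)
Definition canonical (q : rat) : fm :=
  ~ (den q = 0) /\ (pos q = 0 \/ neg q = 0) /\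
  \all a b c, ~ (c = 0) ==> qeq (mkrat a b c) q ==> den q <= c.

Definition code (q : rat) : tm := pair (pair (pos q) (neg q)) (den q).

Definition AllQ (p : rat -> fm) : fm :=
  \all a b c, canonical (mkrat a b c) ==> p (mkrat a b c).
Definition ExQ (p : rat -> fm) : fm :=
  \ex a b c, canonical (mkrat a b c) /\ p (mkrat a b c).

Notation "\allQ x .. y , p" := (AllQ (fun x => .. (AllQ (fun y => p)) ..))
  (at level 200, x binder, y binder, right associativity) : fm_scope.
Notation "\exQ x .. y , p" := (ExQ (fun x => .. (ExQ (fun y => p)) ..))
  (at level 200, x binder, y binder, right associativity) : fm_scope.

Definition Rat : class := fun a => \exQ q, a = code q.
Definition RatNat : class := fun a => \exQ q, \ex i, a = pair (code q) i.

(** * Real numbers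

    A sequence of rationals is given by its graph: [x n q] says that [q] is its
    [n]-th entry.  This covers both sequences that are sets and those obtained
    from them by pointwise operations. *)

Definition rseq : Type := tm -> rat -> fm.

Definition entries (X : st) : rseq := fun n q => pair n (code q) \in X.
Definition const (q : rat) : rseq := fun _ r => qeq r q.
Definition sub (x y : rseq) : rseq :=
  fun n r => \exQ a b, x n a /\ y n b /\ qeq r (qsub a b).
Definition abs (x : rseq) : rseq :=
  fun n r => \exQ a, x n a /\ qis_abs r a.

Definition cauchy (x : rseq) : fm :=
  \allQ e, qlt qzero e ==>
    \ex N, \all m n, N <= m ==> N <= n ==>
      \allQ a b, x m a ==> x n b ==> qabs_lt (qsub a b) e.

Definition is_real (X : st) : fm :=
  is_function Nat Rat X /\ cauchy (entries X).

Definition AllR (p : rseq -> fm) : fm :=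
  \allS X, is_real X ==> p (entries X).
Definition ExR (p : rseq -> fm) : fm :=
  \exS X, is_real X /\ p (entries X).

Notation "\allR x .. y , p" := (AllR (fun x => .. (AllR (fun y => p)) ..))
  (at level 200, x binder, y binder, right associativity) : fm_scope.
Notation "\exR x .. y , p" := (ExR (fun x => .. (ExR (fun y => p)) ..))
  (at level 200, x binder, y binder, right associativity) : fm_scope.

Definition rle (x y : rseq) : fm :=
  \allQ e, qlt qzero e ==>
    \ex N, \all n, N <= n ==>
      \allQ a b, x n a ==> y n b ==> qle a (qadd b e).
Definition req (x y : rseq) : fm := rle x y /\ rle y x.
Definition rlt (x y : rseq) : fm := rle x y /\ ~ req x y.

Definition ball (d : rat) (y z : rseq) : fm := rlt (abs (sub y z)) (const d).
Definition unit_interval (x : rseq) : fm :=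
  rle (const qzero) x /\ rle x (const qone).

(** * Continuous functions

    A function from Q to sequences of rationals is a function from Q * N to Q:
    [entry f q i v] says that [v] is the entry f(q)_i. *)

Definition entry (f : st) (q : rat) (i : tm) (v : rat) : fm :=
  pair (pair (code q) i) (code v) \in f.

Definition partial_continuous (f : st) : fm := is_function RatNat Rat f.

Definition dom (f : st) (x : rseq) : fm :=
  \allQ e, qlt qzero e ==>
    \ex N, 0 < N /\
      \allQ q r,
        ball (qinv_nat N) x (const q) ==> ball (qinv_nat N) x (const r) ==>
        \all i j, N <= i ==> N <= j ==>
          \allQ u v, entry f q i u ==> entry f r j v ==>
            qabs_lt (qsub u v) e.

Definition value (f : st) (x : rseq) : rseq :=
  fun i v => \exQ q, x i q /\ entry f q i v.

Definition continuous_on_unit (f : st) : fm :=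
  partial_continuous f /\ \allR x, unit_interval x ==> dom f x.

Definition uniformly_continuous (f : st) : fm :=
  \allQ e, qlt qzero e ==>
    \exQ d, qlt qzero d /\
      \allR x y, unit_interval x ==> unit_interval y ==>
        rlt (abs (sub x y)) (const d) ==>
        rlt (abs (sub (value f x) (value f y))) (const e).

Definition has_maximum (f : st) : fm :=
  \exR x, unit_interval x /\
    \allR y, unit_interval y ==> rle (value f y) (value f x).

Definition has_minimum (f : st) : fm :=
  \exR x, unit_interval x /\
    \allR y, unit_interval y ==> rle (value f x) (value f y).

Definition bounded (f : st) : fm :=
  \exQ b, \allR x, unit_interval x ==> rle (abs (value f x)) (const b).

Definition all_uniformly_continuous : fm :=
  \allS f, continuous_on_unit f ==> uniformly_continuous f.

Definition all_have_extrema : fm :=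
  \allS f, continuous_on_unit f ==> has_maximum f /\ has_minimum f.

Definition all_bounded : fm :=
  \allS f, continuous_on_unit f ==> bounded f.

Definition RCA0_proves (p : fm) : Prop := proves RCA0 [] (sentence p).

Definition equivalent_over_RCA0 (ps : list fm) : Prop :=
  forall p q, In p ps -> In q ps -> RCA0_proves (p <==> q).

(* Main.v *)
(** By the completeness theorem for the two-sorted calculus, it suffices to argue
    in an arbitrary model of RCA0, over the ordered field of its rationals.
    There each of the four principles is equivalent to a weak form of the
    Bolzano-Weierstrass theorem: for every sequence q of rationals in [0,1] there
    is a function g with k <= g(k) such that the q(g(k)) form a Cauchy sequence,
    without any rate.

    If C is cohesive for the sets {n : q(n) < r}, with r rational, then q is
    Cauchy along C: colour n by the integer part of K q(n) and use the pigeonhole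
    principle to find the grid interval of length 1/K that catches almost all of C.
    Conversely, apply Bolzano-Weierstrass to colours divided by their number, and
    to the ternary expansions with digits 0 and 1 of the characteristic functions
    i -> R_i(n).

    Bolzano-Weierstrass yields uniform continuity, by searching for approximations
    of counterexamples to it, and a maximum, as a limit of points j/(n+1) at which
    the n-th approximation of the function is maximal.

    If q has no Cauchy subsequence, then each real is separated from almost all
    q(n), and f(p)_i = max_{n <= i} max(0, n - n^2 |p - q(n)|) is continuous. It is
    unbounded, as f(q(n)) >= n.  It is not uniformly continuous either: f(p)_i is
    nondecreasing in i, so a bound for f at multiples of a modulus of uniform
    continuity can be propagated along [0,1] by Pi01 induction. *)

From HB Require structures.
From Stdlib Require List Lia PeanoNat Cantor Classical ClassicalEpsilon
  FunctionalExtensionality PropExtensionality ProofIrrelevance Ring.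
From mathcomp Require all_boot all_order all_algebra boolp ring lra.
Require Defs.
Set Warnings "-notation-overridden,-ambiguous-paths,-redundant-canonical-projection".

(** * Substitution, provability and completeness of the two-sorted calculus *)

Module Completeness.
Import List Lia PeanoNat Cantor Classical ClassicalEpsilon
  FunctionalExtensionality PropExtensionality ProofIrrelevance.
Import -(notations) Defs.
Import ListNotations.

(** The numbers of a model may be nonstandard, so induction of Rocq says nothing about them: every
    induction, minimum or search has to concern a Sigma01 or Delta01 predicate with parameters, and
    every sequence that is constructed must be recursive in the model in order to exist there. Hence
    the closure calculus [sig1], [rec], [recf], [recq], which spares writing formulas. So weak a
    theory suffices because reals carry no rate: a Cauchy subsequence of rationals already is a
    real, and continuity can be applied to it at once. The n-th spike has height n, but vanishes at
    distance 1/n from q(n) and beyond; a point separated from almost all q(n) meets only finitely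
    many spikes. Ternary expansions with two digits leave gaps, so numbers that are close share
    their initial digits, and convergence of a subsequence decides each R_i along it. These
    expansions are the one place that calls for primitive recursion; the other selections are
    searches for least witnesses. *)

Lemma tsubst_comp σ1 σ2 t :
  tsubst σ2 (tsubst σ1 t) = tsubst (fun i => tsubst σ2 (σ1 i)) t.
Proof. induction t; simpl; congruence. Qed.

Lemma tsubst_id t : tsubst tvar t = t.
Proof. induction t; simpl; congruence. Qed.

Lemma tup_comp σ1 σ2 :
  (fun i => tsubst (tup σ2) (tup σ1 i)) = tup (fun i => tsubst σ2 (σ1 i)).
Proof.
  extensionality i; destruct i as [|i]; [reflexivity|].
  cbn; unfold tshift; rewrite !tsubst_comp; reflexivity.
Qed.

Lemma tup_id : tup tvar = tvar.
Proof. extensionality i; destruct i; reflexivity. Qed.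

Lemma sup_id : sup (fun X => X) = (fun X => X).
Proof. extensionality i; destruct i; reflexivity. Qed.

Lemma sup_comp ρ1 ρ2 : (fun X => sup ρ2 (sup ρ1 X)) = sup (fun X => ρ2 (ρ1 X)).
Proof. extensionality i; destruct i; reflexivity. Qed.

Lemma fsubst_comp p : forall σ1 ρ1 σ2 ρ2,
  fsubst σ2 ρ2 (fsubst σ1 ρ1 p) =
  fsubst (fun i => tsubst σ2 (σ1 i)) (fun X => ρ2 (ρ1 X)) p.
Proof.
  induction p; intros; simpl; rewrite ?tsubst_comp; f_equal; auto.
  - rewrite IHp, tup_comp; reflexivity.
  - rewrite IHp, sup_comp; reflexivity.
Qed.

Lemma fsubst_id p : fsubst tvar (fun X => X) p = p.
Proof.
  induction p; simpl; rewrite ?tsubst_id, ?tup_id, ?sup_id; congruence.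
Qed.

Lemma fsubst_eq p σ ρ σ' ρ' :
  (forall i, σ i = σ' i) -> (forall X, ρ X = ρ' X) ->
  fsubst σ ρ p = fsubst σ' ρ' p.
Proof.
  intros H1 H2.
  replace σ' with σ by (extensionality i; auto).
  replace ρ' with ρ by (extensionality i; auto). reflexivity.
Qed.

Lemma fsubst_instN σ ρ t p :
  fsubst σ ρ (instN t p) = instN (tsubst σ t) (fsubst (tup σ) ρ p).
Proof.
  unfold instN; rewrite !fsubst_comp; apply fsubst_eq; [|reflexivity].
  intros [|i]; cbn; [reflexivity|].
  unfold tshift; rewrite tsubst_comp; cbn; rewrite tsubst_id; reflexivity.
Qed.

Lemma fsubst_instS σ ρ X p :
  fsubst σ ρ (instS X p) = instS (ρ X) (fsubst σ (sup ρ) p).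
Proof.
  unfold instS; rewrite !fsubst_comp; apply fsubst_eq.
  - intros i; cbn; symmetry; apply tsubst_id.
  - intros [|Y]; reflexivity.
Qed.

Lemma fsubst_shiftN σ ρ p :
  fsubst (tup σ) ρ (shiftN p) = shiftN (fsubst σ ρ p).
Proof. unfold shiftN; rewrite !fsubst_comp; apply fsubst_eq; reflexivity. Qed.

Lemma fsubst_shiftS σ ρ p :
  fsubst σ (sup ρ) (shiftS p) = shiftS (fsubst σ ρ p).
Proof.
  unfold shiftS; rewrite !fsubst_comp; apply fsubst_eq; [|reflexivity].
  intros i; cbn; symmetry; apply tsubst_id.
Qed.

Lemma fsubst_instSucc σ ρ p :
  fsubst (tup σ) ρ (instSucc p) = instSucc (fsubst (tup σ) ρ p).
Proof.
  unfold instSucc; rewrite !fsubst_comp; apply fsubst_eq; [|reflexivity].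
  intros [|i]; [reflexivity|].
  cbn; unfold tshift; rewrite tsubst_comp; reflexivity.
Qed.

Lemma Sigma00_fsubst p : Sigma00 p -> forall σ ρ, Sigma00 (fsubst σ ρ p).
Proof.
  induction 1 as [| | | | |t p Hp IH]; intros σ ρ; try (constructor; auto; fail).
  simpl.
  replace (tsubst (tup σ) (tshift t)) with (tshift (tsubst σ t));
    [constructor; auto|].
  unfold tshift; rewrite !tsubst_comp; reflexivity.
Qed.

Lemma Sigma01_fsubst p σ ρ : Sigma01 p -> Sigma01 (fsubst σ ρ p).
Proof.
  intros [q [Hq ->]]; exists (fsubst (tup σ) ρ q); split; [|reflexivity].
  apply Sigma00_fsubst, Hq.
Qed.

Lemma Pi01_fsubst p σ ρ : Pi01 p -> Pi01 (fsubst σ ρ p).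
Proof.
  intros [q [Hq ->]]; exists (fsubst (tup σ) ρ q); split; [|reflexivity].
  apply Sigma00_fsubst, Hq.
Qed.

(** Axioms may contain free variables, so closure under substitution takes the place of being
    sentences. Completeness uses it to rename eigenvariables in proofs and to verify axioms at
    arbitrary elements of the term model. *)
Lemma RCA0_fsubst p : RCA0 p -> forall σ ρ, RCA0 (fsubst σ ρ p).
Proof.
  destruct 1; intros σ ρ; try (simpl; constructor; fail).
  - cbn [fsubst fAnd fNot]; rewrite fsubst_instN, fsubst_instSucc.
    apply (ax_Sigma01_induction (fsubst (tup σ) ρ p)), Sigma01_fsubst; assumption.
  - change (fsubst σ ρ _) with
      (fImp (fAll (fIff (fsubst (tup σ) ρ p) (fsubst (tup σ) ρ q)))
         (fExS (fAll (fIff (fIn (tvar 0) 0)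
                        (fsubst (tup σ) (sup ρ) (shiftS p)))))).
    rewrite fsubst_shiftS; constructor;
      [apply Sigma01_fsubst | apply Pi01_fsubst]; assumption.
Qed.

(* All bound variables are counted as well: only an upper bound matters. *)
Fixpoint tbound (t : term) : nat :=
  match t with
  | tvar n => S n
  | tzero | tone => 0
  | tadd s t | tmul s t => Nat.max (tbound s) (tbound t)
  end.

Fixpoint fbound (p : form) : nat :=
  match p with
  | fEq s t | fLt s t => Nat.max (tbound s) (tbound t)
  | fIn t X => Nat.max (tbound t) (S X)
  | fBot => 0
  | fImp p q => Nat.max (fbound p) (fbound q)
  | fAll p | fAllS p => fbound p
  end.

Lemma tsubst_bound t n σ σ' :
  tbound t <= n -> (forall i, i < n -> σ i = σ' i) -> tsubst σ t = tsubst σ' t.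
Proof.
  intros Ht H; induction t; simpl in *; auto; f_equal;
    (apply IHt1 || apply IHt2); lia.
Qed.

Lemma fsubst_bound p n : fbound p <= n -> forall σ σ' ρ ρ',
  (forall i, i < n -> σ i = σ' i) -> (forall X, X < n -> ρ X = ρ' X) ->
  fsubst σ ρ p = fsubst σ' ρ' p.
Proof.
  induction p as [s t|s t|t X| |p IHp q IHq|p IHp|p IHp];
    simpl; intros Hn σ σ' ρ ρ' H1 H2; auto.
  - f_equal; apply (tsubst_bound _ n); auto; lia.
  - f_equal; apply (tsubst_bound _ n); auto; lia.
  - f_equal; [apply (tsubst_bound _ n); auto; lia | apply H2; lia].
  - f_equal; [apply IHp | apply IHq]; auto; lia.
  - f_equal; apply IHp; auto.
    intros [|i] Hi; simpl; [reflexivity | rewrite H1; [reflexivity | lia]].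
  - f_equal; apply IHp; auto.
    intros [|i] Hi; simpl; [reflexivity | rewrite H2; [reflexivity | lia]].
Qed.

Section Proofs.

Variable T : form -> Prop.
Hypothesis T_fsubst : forall p, T p -> forall σ ρ, T (fsubst σ ρ p).

Lemma proves_weaken Γ p : proves T Γ p -> forall Δ, incl Γ Δ -> proves T Δ p.
Proof.
  induction 1; intros Δ HΔ.
  - apply pAx; assumption.
  - apply pHyp, HΔ; assumption.
  - apply pImpI, IHproves; intros r [->|Hr]; [left | right]; auto.
  - eapply pImpE; eauto.
  - apply pContra, IHproves; intros r [->|Hr]; [left | right]; auto.
  - apply pAllI, IHproves, incl_map, HΔ.
  - apply pAllE; auto.
  - apply pAllSI, IHproves, incl_map, HΔ.
  - apply pAllSE; auto.
  - apply pEqI.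
  - eapply pEqE; eauto.
Qed.

Lemma proves_fsubst Γ p : proves T Γ p -> forall σ ρ,
  proves T (map (fsubst σ ρ) Γ) (fsubst σ ρ p).
Proof.
  induction 1; intros σ ρ.
  - apply pAx; auto.
  - apply pHyp, in_map; assumption.
  - apply pImpI; exact (IHproves σ ρ).
  - eapply pImpE; [exact (IHproves1 σ ρ) | exact (IHproves2 σ ρ)].
  - apply pContra; exact (IHproves σ ρ).
  - apply pAllI; fold fsubst; specialize (IHproves (tup σ) ρ).
    rewrite map_map in *; erewrite map_ext; [exact IHproves|].
    intros; symmetry; apply fsubst_shiftN.
  - rewrite fsubst_instN; apply pAllE; exact (IHproves σ ρ).
  - apply pAllSI; fold fsubst; specialize (IHproves σ (sup ρ)).
    rewrite map_map in *; erewrite map_ext; [exact IHproves|].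
    intros; symmetry; apply fsubst_shiftS.
  - rewrite fsubst_instS; apply pAllSE; exact (IHproves σ ρ).
  - apply pEqI.
  - rewrite fsubst_instN; eapply pEqE; [exact (IHproves1 σ ρ)|].
    rewrite <- fsubst_instN; apply IHproves2.
Qed.

Definition consistent (Γ : list form) : Prop := ~ proves T Γ fBot.

(** The eigenvariable of [pAllI] is index 0 over a shifted context. Renaming [k] to 0 and every
    other [i] to [S i] agrees with the shift on formulas bounded by [k], and turns the instance at
    [k] back into [p]. *)
Lemma generalize_fresh Γ p k :
  (forall q, In q (p :: Γ) -> fbound q <= k) ->
  proves T Γ (instN (tvar k) p) -> proves T Γ (fAll p).
Proof.
  intros Hk H; apply pAllI.
  apply (proves_fsubst _ _) with
    (σ := fun i => if Nat.eq_dec i k then tvar 0 else tvar (S i))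
    (ρ := fun X => X) in H.
  assert (E : map shiftN Γ = map (fsubst (fun i =>
      if Nat.eq_dec i k then tvar 0 else tvar (S i)) (fun X => X)) Γ).
  { apply map_ext_in; intros q Hq; unfold shiftN; apply (fsubst_bound _ k).
    - apply Hk; right; exact Hq.
    - intros i Hi; destruct (Nat.eq_dec i k); [lia | reflexivity].
    - reflexivity. }
  rewrite E; eapply eq_ind; [exact H|].
  unfold instN; rewrite fsubst_comp; rewrite <- (fsubst_id p) at 2.
  apply (fsubst_bound _ k); [apply Hk; left; reflexivity | | reflexivity].
  intros [|i] Hi; cbn -[Nat.eq_dec];
    match goal with |- context [Nat.eq_dec ?x k] => destruct (Nat.eq_dec x k) end;
    try lia; reflexivity.
Qed.

Lemma generalize_fresh_set Γ p k :
  (forall q, In q (p :: Γ) -> fbound q <= k) ->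
  proves T Γ (instS k p) -> proves T Γ (fAllS p).
Proof.
  intros Hk H; apply pAllSI.
  apply (proves_fsubst _ _) with
    (σ := tvar) (ρ := fun X => if Nat.eq_dec X k then 0 else S X) in H.
  assert (E : map shiftS Γ =
    map (fsubst tvar (fun X => if Nat.eq_dec X k then 0 else S X)) Γ).
  { apply map_ext_in; intros q Hq; unfold shiftS; apply (fsubst_bound _ k).
    - apply Hk; right; exact Hq.
    - reflexivity.
    - intros i Hi; destruct (Nat.eq_dec i k); [lia | reflexivity]. }
  rewrite E; eapply eq_ind; [exact H|].
  unfold instS; rewrite fsubst_comp; rewrite <- (fsubst_id p) at 2.
  apply (fsubst_bound _ k); [apply Hk; left; reflexivity | reflexivity |].
  intros [|i] Hi; cbn -[Nat.eq_dec];
    match goal with |- context [Nat.eq_dec ?x k] => destruct (Nat.eq_dec x k) end;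
    try lia; reflexivity.
Qed.

(** A refutation of the counterexample at the fresh [k] would prove [p] at [k], hence the universal
    formula whose negation is assumed. *)
Lemma consistent_witness Γ p k :
  (forall q, In q (p :: fNot (fAll p) :: Γ) -> fbound q <= k) ->
  consistent (fNot (fAll p) :: Γ) ->
  consistent (fNot (instN (tvar k) p) :: fNot (fAll p) :: Γ).
Proof.
  intros Hk Hc H; apply Hc; eapply pImpE; [apply pHyp; left; reflexivity|].
  apply (generalize_fresh _ _ k Hk), pContra, H.
Qed.

Lemma consistent_witness_set Γ p k :
  (forall q, In q (p :: fNot (fAllS p) :: Γ) -> fbound q <= k) ->
  consistent (fNot (fAllS p) :: Γ) ->
  consistent (fNot (instS k p) :: fNot (fAllS p) :: Γ).
Proof.
  intros Hk Hc H; apply Hc; eapply pImpE; [apply pHyp; left; reflexivity|].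
  apply (generalize_fresh_set _ _ k Hk), pContra, H.
Qed.

End Proofs.

(** * Enumeration of formulas *)

Fixpoint tdecode (fuel c : nat) : term :=
  match fuel with
  | 0 => tzero
  | S f =>
      let (tag, r) := of_nat c in
      let (a, b) := of_nat r in
      match tag with
      | 0 => tvar r
      | 1 => tone
      | 2 => tadd (tdecode f a) (tdecode f b)
      | 3 => tmul (tdecode f a) (tdecode f b)
      | _ => tzero
      end
  end.

Fixpoint fdecode (fuel c : nat) : form :=
  match fuel with
  | 0 => fBot
  | S f =>
      let (tag, r) := of_nat c in
      let (a, b) := of_nat r in
      match tag with
      | 0 => fEq (tdecode f a) (tdecode f b)
      | 1 => fLt (tdecode f a) (tdecode f b)
      | 2 => fIn (tdecode f a) b
      | 3 => fImp (fdecode f a) (fdecode f b)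
      | 4 => fAll (fdecode f r)
      | 5 => fAllS (fdecode f r)
      | _ => fBot
      end
  end.

Lemma tdecode_surj t :
  exists c n, forall m, n <= m -> tdecode m c = t.
Proof.
  induction t as [x| | |s [a [n Ha]] t [b [m Hb]]|s [a [n Ha]] t [b [m Hb]]].
  - exists (to_nat (0, x)), 1; intros [|m] Hm; [lia|].
    cbn [tdecode]; rewrite cancel_of_to; destruct (of_nat x); reflexivity.
  - exists (to_nat (4, 0)), 1; intros [|m] Hm; [lia|].
    cbn [tdecode]; rewrite cancel_of_to; reflexivity.
  - exists (to_nat (1, 0)), 1; intros [|m] Hm; [lia|].
    cbn [tdecode]; rewrite cancel_of_to; reflexivity.
  - exists (to_nat (2, to_nat (a, b))), (S (n + m)); intros [|k] Hk; [lia|].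
    cbn [tdecode]; rewrite !cancel_of_to; rewrite Ha, Hb by lia; reflexivity.
  - exists (to_nat (3, to_nat (a, b))), (S (n + m)); intros [|k] Hk; [lia|].
    cbn [tdecode]; rewrite !cancel_of_to; rewrite Ha, Hb by lia; reflexivity.
Qed.

Lemma fdecode_surj p :
  exists c n, forall m, n <= m -> fdecode m c = p.
Proof.
  induction p as [s t|s t|t X| |p [a [n Ha]] q [b [m Hb]]
                 |p [a [n Ha]]|p [a [n Ha]]].
  - destruct (tdecode_surj s) as [a [n Ha]], (tdecode_surj t) as [b [m Hb]].
    exists (to_nat (0, to_nat (a, b))), (S (n + m)); intros [|k] Hk; [lia|].
    cbn [fdecode]; rewrite !cancel_of_to; rewrite Ha, Hb by lia; reflexivity.
  - destruct (tdecode_surj s) as [a [n Ha]], (tdecode_surj t) as [b [m Hb]].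
    exists (to_nat (1, to_nat (a, b))), (S (n + m)); intros [|k] Hk; [lia|].
    cbn [fdecode]; rewrite !cancel_of_to; rewrite Ha, Hb by lia; reflexivity.
  - destruct (tdecode_surj t) as [a [n Ha]].
    exists (to_nat (2, to_nat (a, X))), (S n); intros [|k] Hk; [lia|].
    cbn [fdecode]; rewrite !cancel_of_to; rewrite Ha by lia; reflexivity.
  - exists (to_nat (6, 0)), 1; intros [|m] Hm; [lia|].
    cbn [fdecode]; rewrite cancel_of_to; reflexivity.
  - exists (to_nat (3, to_nat (a, b))), (S (n + m)); intros [|k] Hk; [lia|].
    cbn [fdecode]; rewrite !cancel_of_to; rewrite Ha, Hb by lia; reflexivity.
  - exists (to_nat (4, a)), (S n); intros [|k] Hk; [lia|].
    cbn [fdecode]; rewrite !cancel_of_to; rewrite Ha by lia.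
    destruct (of_nat a); reflexivity.
  - exists (to_nat (5, a)), (S n); intros [|k] Hk; [lia|].
    cbn [fdecode]; rewrite !cancel_of_to; rewrite Ha by lia.
    destruct (of_nat a); reflexivity.
Qed.

(** The number carries its own fuel, so every formula is reached without a bound on the depth of its
    code. *)
Definition fenum (n : nat) : form := let (m, c) := of_nat n in fdecode m c.

Lemma fenum_surj p : exists n, fenum n = p.
Proof.
  destruct (fdecode_surj p) as [c [n Hn]].
  exists (to_nat (n, c)); unfold fenum; rewrite cancel_of_to; auto.
Qed.

(** * Semantics *)

(** Henkin semantics: sets form an arbitrary second sort with a membership relation. Formulas cannot
    compare sets, so extensionality is not an issue. *)
Record model : Type := Model {
  num : Type;
  sets : Type;
  m_zero : num;
  m_one : num;
  m_add : num -> num -> num;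
  m_mul : num -> num -> num;
  m_lt : num -> num -> Prop;
  m_mem : num -> sets -> Prop }.

Fixpoint eval (m : model) (e : nat -> num m) (t : term) : num m :=
  match t with
  | tvar n => e n
  | tzero => m_zero m
  | tone => m_one m
  | tadd s t => m_add m (eval m e s) (eval m e t)
  | tmul s t => m_mul m (eval m e s) (eval m e t)
  end.

Fixpoint sat (m : model) (e : nat -> num m) (E : nat -> sets m) (p : form) : Prop :=
  match p with
  | fEq s t => eval m e s = eval m e t
  | fLt s t => m_lt m (eval m e s) (eval m e t)
  | fIn t X => m_mem m (eval m e t) (E X)
  | fBot => False
  | fImp p q => sat m e E p -> sat m e E q
  | fAll p => forall x, sat m (scons x e) E p
  | fAllS p => forall X, sat m e (scons X E) p
  end.

Definition is_model_of (T : form -> Prop) (m : model) : Prop :=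
  forall p e E, T p -> sat m e E p.

Lemma eval_tsubst m e σ t :
  eval m e (tsubst σ t) = eval m (fun i => eval m e (σ i)) t.
Proof. induction t; simpl; congruence. Qed.

Lemma sat_fsubst m p : forall e E σ ρ,
  sat m e E (fsubst σ ρ p) <->
  sat m (fun i => eval m e (σ i)) (fun X => E (ρ X)) p.
Proof.
  induction p as [s t|s t|t X| |p IHp q IHq|p IHp|p IHp];
    intros e E σ ρ; simpl; rewrite ?eval_tsubst; try reflexivity.
  - rewrite IHp, IHq; reflexivity.
  - assert (H : forall x, (fun i => eval m (scons x e) (tup σ i)) =
                  scons x (fun i => eval m e (σ i))).
    { intros x; extensionality i; destruct i as [|i]; [reflexivity|].
      cbn; unfold tshift; rewrite eval_tsubst; reflexivity. }
    split; intros Hx x; specialize (Hx x); [rewrite IHp in Hx | rewrite IHp];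
      rewrite H in *; exact Hx.
  - assert (H : forall X, (fun Y => scons X E (sup ρ Y)) =
                  scons X (fun Y => E (ρ Y))).
    { intros X; extensionality i; destruct i; reflexivity. }
    split; intros Hx x; specialize (Hx x); [rewrite IHp in Hx | rewrite IHp];
      rewrite H in *; exact Hx.
Qed.

(** * Completeness *)

Section Completeness.

Variable T : form -> Prop.
Hypothesis T_fsubst : forall p, T p -> forall σ ρ, T (fsubst σ ρ p).

Fixpoint bound_all (Γ : list form) : nat :=
  match Γ with [] => 0 | p :: Γ => Nat.max (fbound p) (bound_all Γ) end.

Lemma bound_all_in Γ q : In q Γ -> fbound q <= bound_all Γ.
Proof.
  induction Γ as [|p Γ IH]; [intros []|].
  intros [->|H]; simpl; [lia | specialize (IH H); lia].
Qed.

(** The patterns are negated universal formulas: existential quantifiers are not primitive, so a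
    Henkin witness is a counterexample. *)
Definition witness (k : nat) (p : form) : list form :=
  match p with
  | fImp (fAll q) fBot => [fNot (instN (tvar k) q)]
  | fImp (fAllS q) fBot => [fNot (instS k q)]
  | _ => []
  end.

Definition extend (Γ : list form) (p : form) : list form :=
  if excluded_middle_informative (consistent T (p :: Γ))
  then witness (bound_all (p :: Γ)) p ++ p :: Γ else Γ.

Lemma extend_consistent Γ p : consistent T Γ -> consistent T (extend Γ p).
Proof.
  intros HΓ; unfold extend.
  destruct (excluded_middle_informative _) as [Hp|_]; [|exact HΓ].
  assert (Hb : forall q q', fbound q <= fbound p ->
    In q' (q :: p :: Γ) -> fbound q' <= bound_all (p :: Γ)).
  { intros q q' Hq [<-|Hq']; [simpl; lia | apply bound_all_in, Hq']. }
  destruct p as [| | | |[| | | | |q|q] []| |]; try exact Hp.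
  - apply consistent_witness; [exact T_fsubst| |exact Hp].
    intros q'; apply Hb; simpl; lia.
  - apply consistent_witness_set; [exact T_fsubst| |exact Hp].
    intros q'; apply Hb; simpl; lia.
Qed.

Lemma extend_incl Γ p : incl Γ (extend Γ p).
Proof.
  unfold extend; destruct (excluded_middle_informative _); [|apply incl_refl].
  apply incl_appr, incl_tl, incl_refl.
Qed.

Variable Γ0 : list form.
Hypothesis Γ0_consistent : consistent T Γ0.

Fixpoint stage (n : nat) : list form :=
  match n with 0 => Γ0 | S n => extend (stage n) (fenum n) end.

Lemma stage_consistent n : consistent T (stage n).
Proof. induction n; [assumption | apply extend_consistent; assumption]. Qed.

Lemma stage_incl m n : m <= n -> incl (stage m) (stage n).
Proof.
  induction 1; [apply incl_refl|].
  eapply incl_tran; [exact IHle | apply extend_incl].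
Qed.

Definition Th (p : form) : Prop := exists n, proves T (stage n) p.

Lemma Th_impE p q : Th (fImp p q) -> Th p -> Th q.
Proof.
  intros [m Hm] [n Hn]; exists (m + n); eapply pImpE;
    (eapply proves_weaken; [eassumption | apply stage_incl; lia]).
Qed.

Lemma Th_consistent : ~ Th fBot.
Proof. intros [n Hn]; exact (stage_consistent n Hn). Qed.

(** At the stage that enumerates [p], the formula is added unless it is inconsistent with what is
    already there; in that case its negation is derivable. *)
Lemma Th_complete p : ~ Th p -> Th (fNot p).
Proof.
  intros Hp; destruct (fenum_surj p) as [n Hn].
  exists n; apply pImpI, NNPP; intros Hc; apply Hp; exists (S n).
  apply pHyp; simpl; unfold extend; rewrite Hn.
  destruct (excluded_middle_informative _) as [_|Hc'].
  - apply in_or_app; right; left; reflexivity.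
  - exfalso; apply Hc', Hc.
Qed.

Lemma Th_imp p q : Th (fImp p q) <-> (Th p -> Th q).
Proof.
  split; [apply Th_impE|]; intros H.
  destruct (classic (Th p)) as [Hp|Hp].
  - destruct (H Hp) as [n Hn]; exists n; apply pImpI.
    eapply proves_weaken; [exact Hn | apply incl_tl, incl_refl].
  - destruct (Th_complete p Hp) as [n Hn]; exists n; apply pImpI, pContra.
    eapply pImpE; [|apply pHyp; right; left; reflexivity].
    eapply proves_weaken; [exact Hn | apply incl_tl, incl_tl, incl_refl].
Qed.

Lemma Th_witness p : Th p -> exists k, forall q, In q (witness k p) -> Th q.
Proof.
  intros [m Hm]; destruct (fenum_surj p) as [n Hn].
  exists (bound_all (p :: stage n)); intros r Hr; exists (S n).
  apply pHyp; simpl; unfold extend; rewrite Hn.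
  destruct (excluded_middle_informative _) as [_|Hc].
  - apply in_or_app; left; exact Hr.
  - exfalso; apply Hc; intros Hp; apply Th_consistent; exists (m + n).
    eapply pImpE with p.
    + eapply proves_weaken; [apply pImpI, Hp | apply stage_incl; lia].
    + eapply proves_weaken; [exact Hm | apply stage_incl; lia].
Qed.

Lemma Th_all p : Th (fAll p) <-> forall t, Th (instN t p).
Proof.
  split.
  - intros [n Hn] t; exists n; apply pAllE, Hn.
  - intros H; apply NNPP; intros Hn; apply Th_complete in Hn.
    destruct (Th_witness (fNot (fAll p)) Hn) as [k Hk].
    apply Th_consistent; eapply Th_impE; [|exact (H (tvar k))].
    apply Hk; left; reflexivity.
Qed.

Lemma Th_allS p : Th (fAllS p) <-> forall X, Th (instS X p).
Proof.
  split.
  - intros [n Hn] t; exists n; apply pAllSE, Hn.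
  - intros H; apply NNPP; intros Hn; apply Th_complete in Hn.
    destruct (Th_witness (fNot (fAllS p)) Hn) as [k Hk].
    apply Th_consistent; eapply Th_impE; [|exact (H k)].
    apply Hk; left; reflexivity.
Qed.

Lemma Th_eq_refl t : Th (fEq t t).
Proof. exists 0; apply pEqI. Qed.

Lemma Th_subst p s t : Th (fEq s t) -> Th (instN s p) -> Th (instN t p).
Proof.
  intros [m Hm] [n Hn]; exists (m + n); eapply pEqE;
    (eapply proves_weaken; [eassumption | apply stage_incl; lia]).
Qed.

Lemma instN_tshift s t : tsubst (scons t tvar) (tshift s) = s.
Proof. unfold tshift; rewrite tsubst_comp; apply tsubst_id. Qed.

Lemma Th_eq_sym s t : Th (fEq s t) -> Th (fEq t s).
Proof.
  intros H; apply (Th_subst (fEq (tvar 0) (tshift s)) s t) in H;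
    unfold instN in *; simpl in *; rewrite instN_tshift in *;
    [exact H | apply Th_eq_refl].
Qed.

(** Provable equality must become identity in the model. Provably equal terms are equal to the same
    terms, so [epsilon] picks the same representative for them; the quotient is then the subtype of
    representatives. *)
Definition repr (t : term) : term :=
  epsilon (inhabits tzero) (fun u => Th (fEq t u)).

Lemma Th_repr t : Th (fEq t (repr t)).
Proof.
  unfold repr; apply (epsilon_spec (inhabits tzero) (fun u => Th (fEq t u))).
  exists t; apply Th_eq_refl.
Qed.

Lemma Th_eq_trans s t u : Th (fEq s t) -> Th (fEq t u) -> Th (fEq s u).
Proof.
  intros Hs Ht; apply (Th_subst (fEq (tshift s) (tvar 0)) t u) in Ht;
    unfold instN in *; simpl in *; rewrite instN_tshift in *; assumption.
Qed.

Lemma repr_eq s t : repr s = repr t <-> Th (fEq s t).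
Proof.
  split; intros H.
  - eapply Th_eq_trans; [apply Th_repr|]; rewrite H; apply Th_eq_sym, Th_repr.
  - unfold repr; f_equal; extensionality u; apply propositional_extensionality.
    split; apply Th_eq_trans; [apply Th_eq_sym|]; exact H.
Qed.

Definition hnum : Type := {t : term | repr t = t}.

Definition hclass (t : term) : hnum :=
  exist _ (repr t) (proj2 (repr_eq _ _) (Th_eq_sym _ _ (Th_repr t))).

Lemma hclass_eq s t : hclass s = hclass t <-> Th (fEq s t).
Proof.
  rewrite <- repr_eq; split; [intros H; exact (f_equal (@proj1_sig _ _) H)|].
  intros H; apply subset_eq_compat, H.
Qed.

Lemma hclass_surj (x : hnum) : x = hclass (proj1_sig x).
Proof. destruct x as [t Ht]; apply subset_eq_compat; symmetry; exact Ht. Qed.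

Definition henkin : model := {|
  num := hnum;
  sets := nat;
  m_zero := hclass tzero;
  m_one := hclass tone;
  m_add x y := hclass (tadd (proj1_sig x) (proj1_sig y));
  m_mul x y := hclass (tmul (proj1_sig x) (proj1_sig y));
  m_lt x y := Th (fLt (proj1_sig x) (proj1_sig y));
  m_mem x X := Th (fIn (proj1_sig x) X) |}.

Lemma Th_congr p s t : Th (fEq s t) -> Th (instN s p) <-> Th (instN t p).
Proof. split; apply Th_subst; [|apply Th_eq_sym]; exact H. Qed.

(** The rule for equality replaces a single variable, so the arguments are exchanged one at a time,
    with the other one shifted out of reach. *)
Lemma Th_congr2 (f : term -> term -> form) :
  (forall σ s t, fsubst σ (fun X => X) (f s t) = f (tsubst σ s) (tsubst σ t)) ->
  forall s s' t t', Th (fEq s s') -> Th (fEq t t') -> Th (f s t) <-> Th (f s' t').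
Proof.
  intros Hf s s' t t' Hs Ht.
  assert (H1 := Th_congr (f (tvar 0) (tshift t)) s s' Hs).
  assert (H2 := Th_congr (f (tshift s') (tvar 0)) t t' Ht).
  unfold instN in *; rewrite !Hf in *; simpl in *; rewrite !instN_tshift in *.
  rewrite H1; exact H2.
Qed.

Lemma Th_eq_congr2 (f : term -> term -> term) :
  (forall σ s t, tsubst σ (f s t) = f (tsubst σ s) (tsubst σ t)) ->
  forall s s' t t', Th (fEq s s') -> Th (fEq t t') -> Th (fEq (f s t) (f s' t')).
Proof.
  intros Hf s s' t t' Hs Ht; apply Th_eq_trans with (f s' t).
  - apply (Th_subst (fEq (tshift (f s t)) (f (tvar 0) (tshift t)))) in Hs;
      unfold instN in *; simpl in *; rewrite ?Hf, ?instN_tshift in *;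
      [exact Hs | apply Th_eq_refl].
  - apply (Th_subst (fEq (tshift (f s' t)) (f (tshift s') (tvar 0)))) in Ht;
      unfold instN in *; simpl in *; rewrite ?Hf, ?instN_tshift in *;
      [exact Ht | apply Th_eq_refl].
Qed.

Lemma henkin_eval σ t :
  eval henkin (fun i => hclass (σ i)) t = hclass (tsubst σ t).
Proof.
  induction t as [n| | |s IHs t IHt|s IHs t IHt]; try reflexivity; simpl;
    rewrite IHs, IHt; apply hclass_eq; apply Th_eq_congr2;
    try reflexivity; apply Th_eq_sym, Th_repr.
Qed.

(** Truth lemma. Elements of the model are classes of terms and sets are variable indices, so an
    environment is a substitution; quantifiers change it, hence the generality in [σ] and [ρ]. *)
Lemma henkin_sat p : forall σ ρ,
  sat henkin (fun i => hclass (σ i)) ρ p <-> Th (fsubst σ ρ p).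
Proof.
  induction p as [s t|s t|t X| |p IHp q IHq|p IHp|p IHp]; intros σ ρ; simpl;
    rewrite ?henkin_eval.
  - apply hclass_eq.
  - apply (Th_congr2 fLt); try reflexivity; apply Th_eq_sym, Th_repr.
  - apply (Th_congr2 (fun u v => fIn u (ρ X))) with (t := t) (t' := t);
      [reflexivity | apply Th_eq_sym, Th_repr | apply Th_eq_refl].
  - split; [intros [] | apply Th_consistent].
  - rewrite Th_imp, IHp, IHq; reflexivity.
  - rewrite Th_all.
    assert (E : forall t, instN t (fsubst (tup σ) ρ p) = fsubst (scons t σ) ρ p).
    { intros t; unfold instN; rewrite fsubst_comp; apply fsubst_eq; [|reflexivity].
      intros [|i]; [reflexivity | apply instN_tshift]. }
    assert (E' : forall t, scons (hclass t) (fun i => hclass (σ i)) =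
                           fun i => hclass (scons t σ i)).
    { intros t; extensionality i; destruct i; reflexivity. }
    split.
    + intros H t; rewrite E, <- IHp, <- E'; apply H.
    + intros H x; rewrite (hclass_surj x), E', IHp, <- E; apply H.
  - rewrite Th_allS.
    assert (E : forall X, instS X (fsubst σ (sup ρ) p) = fsubst σ (scons X ρ) p).
    { intros X; unfold instS; rewrite fsubst_comp; apply fsubst_eq.
      - intros i; apply tsubst_id.
      - intros [|Y]; reflexivity. }
    split; intros H X; specialize (H X); [rewrite E, <- IHp | rewrite IHp, <- E];
      exact H.
Qed.

Lemma henkin_model : is_model_of T henkin.
Proof.
  intros p e E Hp.
  replace e with (fun i => hclass (proj1_sig (e i)))
    by (extensionality i; symmetry; apply hclass_surj).
  apply henkin_sat; exists 0; apply pAx, T_fsubst, Hp.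
Qed.

Lemma henkin_sat_hyp p : In p Γ0 -> sat henkin (fun i => hclass (tvar i)) (fun X => X) p.
Proof.
  intros Hp; apply henkin_sat; rewrite fsubst_id; exists 0; apply pHyp, Hp.
Qed.

End Completeness.

Theorem completeness (T : form -> Prop) (p : form) :
  (forall q, T q -> forall σ ρ, T (fsubst σ ρ q)) ->
  (forall m e E, is_model_of T m -> sat m e E p) -> proves T [] p.
Proof.
  intros HT Hp; apply NNPP; intros Hn.
  assert (Hc : consistent T [fNot p]) by (intros H; apply Hn, pContra, H).
  apply (henkin_sat_hyp T HT [fNot p] Hc (fNot p)); [left; reflexivity|].
  apply Hp, henkin_model; assumption.
Qed.

End Completeness.

(** * Arithmetic of the numbers in a model of [RCA0] *)

Module Arithmetic.
Import PeanoNat Lia Classical ClassicalEpsilon ProofIrrelevance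
  FunctionalExtensionality PropExtensionality Ring.
Import -(notations) Defs.
Import Completeness.

Declare Scope num_scope.
Delimit Scope num_scope with num.

(** Axioms are evaluated in an environment, which takes an element of the second sort. *)
Record rca0_model : Type := RCA0Model {
  carrier :> model;
  carrier_axioms : is_model_of RCA0 carrier;
  some_set : sets carrier }.

Section Arithmetic.

Variable M : rca0_model.

Local Open Scope num_scope.
Local Notation "0" := (m_zero M) : num_scope.
Local Notation "1" := (m_one M) : num_scope.
Local Notation "x + y" := (m_add M x y) : num_scope.
Local Notation "x * y" := (m_mul M x y) : num_scope.
Local Notation "x < y" := (m_lt M x y) : num_scope.
Local Notation "x .: e" := (scons x e) (at level 55, right associativity).

Let E0 : nat -> sets M := fun _ => some_set M.

Lemma sat_fAnd (e : nat -> num M) E p q :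
  sat M e E (fAnd p q) <-> sat M e E p /\ sat M e E q.
Proof. simpl; tauto. Qed.

Lemma sat_fOr (e : nat -> num M) E p q :
  sat M e E (fOr p q) <-> sat M e E p \/ sat M e E q.
Proof. simpl; tauto. Qed.

Lemma sat_fEx (e : nat -> num M) E p :
  sat M e E (fEx p) <-> exists x, sat M (x .: e) E p.
Proof.
  simpl; split; [intros H; apply NNPP; intros Hn; apply H | intros [x Hx] H];
    firstorder.
Qed.

Lemma sat_fExS (e : nat -> num M) E p :
  sat M e E (fExS p) <-> exists X, sat M e (X .: E) p.
Proof.
  simpl; split; [intros H; apply NNPP; intros Hn; apply H | intros [x Hx] H];
    firstorder.
Qed.

Lemma Sigma01_ind p (e : nat -> num M) E : Sigma01 p ->
  sat M (0 .: e) E p ->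
  (forall x, sat M (x .: e) E p -> sat M (x + 1 .: e) E p) ->
  forall x, sat M (x .: e) E p.
Proof.
  intros Hp H0 HS.
  assert (H := carrier_axioms M _ e E (ax_Sigma01_induction p Hp)).
  apply H; apply sat_fAnd; split.
  - unfold instN; apply sat_fsubst.
    replace (fun i => _) with (0 .: e); [exact H0|].
    extensionality i; destruct i; reflexivity.
  - intros x Hx; unfold instSucc; apply sat_fsubst.
    replace (fun i => _) with (x + 1 .: e); [apply HS, Hx|].
    extensionality i; destruct i; reflexivity.
Qed.

Lemma Sigma00_ind p (e : nat -> num M) E : Sigma00 p ->
  sat M (0 .: e) E p ->
  (forall x, sat M (x .: e) E p -> sat M (x + 1 .: e) E p) ->
  forall x, sat M (x .: e) E p.
Proof.
  intros Hp H0 HS.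
  (* A dummy existential quantifier brings the bounded formula into Sigma01 form. *)
  assert (Hq : forall x, sat M (x .: e) E (fEx (shiftN p)) <-> sat M (x .: e) E p).
  { intros x; rewrite sat_fEx; unfold shiftN.
    split; [intros [y Hy]; apply sat_fsubst in Hy; exact Hy|].
    intros Hx; exists 0; apply sat_fsubst; exact Hx. }
  intros x; apply Hq; apply Sigma01_ind.
  - exists (shiftN p); split; [apply Sigma00_fsubst, Hp | reflexivity].
  - apply Hq, H0.
  - intros y Hy; apply Hq, HS, Hq, Hy.
Qed.


Lemma succ_neq_zero x : x + 1 <> 0.
Proof.
  exact (carrier_axioms M _ (fun _ => x) E0 (ax_succ_neq_zero (tvar 0%nat))).
Qed.

Lemma succ_inj x y : x + 1 = y + 1 -> x = y.
Proof.
  exact (carrier_axioms M _ (x .: fun _ => y) E0 (ax_succ_inj (tvar 0) (tvar 1))).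
Qed.

Lemma num_addr0 x : x + 0 = x.
Proof. exact (carrier_axioms M _ (fun _ => x) E0 (ax_add_zero (tvar 0))). Qed.

Lemma num_addrS x y : x + (y + 1) = x + y + 1.
Proof.
  exact (carrier_axioms M _ (x .: fun _ => y) E0 (ax_add_succ (tvar 0) (tvar 1))).
Qed.

Lemma num_mulr0 x : x * 0 = 0.
Proof. exact (carrier_axioms M _ (fun _ => x) E0 (ax_mul_zero (tvar 0))). Qed.

Lemma num_mulrS x y : x * (y + 1) = x * y + x.
Proof.
  exact (carrier_axioms M _ (x .: fun _ => y) E0 (ax_mul_succ (tvar 0) (tvar 1))).
Qed.

Lemma num_lt0 x : ~ x < 0.
Proof. exact (carrier_axioms M _ (fun _ => x) E0 (ax_lt_zero (tvar 0))). Qed.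

Lemma num_ltS x y : x < y + 1 <-> x < y \/ x = y.
Proof.
  assert (H := carrier_axioms M _ (x .: fun _ => y) E0
                 (ax_lt_succ (tvar 0) (tvar 1))).
  apply sat_fAnd in H; destruct H as [H1 H2]; simpl in H1, H2; tauto.
Qed.

Lemma num_add0r x : 0 + x = x.
Proof.
  apply (Sigma00_ind (fEq (tadd tzero (tvar 0)) (tvar 0)) (fun _ => 0) E0);
    [constructor | apply num_addr0 |]; simpl.
  intros y Hy; rewrite num_addrS, Hy; reflexivity.
Qed.

Lemma num_addSr x y : x + 1 + y = x + y + 1.
Proof.
  apply (Sigma00_ind (fEq (tadd (tadd (tvar 1) tone) (tvar 0))
                        (tadd (tadd (tvar 1) (tvar 0)) tone)) (fun _ => x) E0);
    [constructor | simpl; rewrite !num_addr0; reflexivity |]; simpl.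
  intros z Hz; rewrite !num_addrS, Hz; reflexivity.
Qed.

Lemma num_addC x y : x + y = y + x.
Proof.
  apply (Sigma00_ind (fEq (tadd (tvar 1) (tvar 0)) (tadd (tvar 0) (tvar 1)))
           (fun _ => x) E0);
    [constructor | simpl; rewrite num_addr0, num_add0r; reflexivity |]; simpl.
  intros z Hz; rewrite num_addrS, num_addSr, Hz; reflexivity.
Qed.

Lemma num_addA x y z : x + (y + z) = x + y + z.
Proof.
  apply (Sigma00_ind (fEq (tadd (tvar 1) (tadd (tvar 2) (tvar 0)))
           (tadd (tadd (tvar 1) (tvar 2)) (tvar 0))) (x .: fun _ => y) E0);
    [constructor | simpl; rewrite !num_addr0; reflexivity |]; simpl.
  intros t Ht; rewrite !num_addrS, Ht; reflexivity.
Qed.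

Lemma num_mul0r x : 0 * x = 0.
Proof.
  apply (Sigma00_ind (fEq (tmul tzero (tvar 0)) tzero) (fun _ => 0) E0);
    [constructor | apply num_mulr0 |]; simpl.
  intros y Hy; rewrite num_mulrS, Hy; apply num_addr0.
Qed.

Lemma num_mulSr x y : (x + 1) * y = x * y + y.
Proof.
  apply (Sigma00_ind (fEq (tmul (tadd (tvar 1) tone) (tvar 0))
           (tadd (tmul (tvar 1) (tvar 0)) (tvar 0))) (fun _ => x) E0);
    [constructor | simpl; rewrite !num_mulr0, num_addr0; reflexivity |]; simpl.
  intros z Hz; rewrite !num_mulrS, Hz, !num_addrS; f_equal.
  rewrite <- !num_addA; f_equal; apply num_addC.
Qed.

Lemma num_mulC x y : x * y = y * x.
Proof.
  apply (Sigma00_ind (fEq (tmul (tvar 1) (tvar 0)) (tmul (tvar 0) (tvar 1)))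
           (fun _ => x) E0);
    [constructor | simpl; rewrite num_mulr0, num_mul0r; reflexivity |]; simpl.
  intros z Hz; rewrite num_mulrS, num_mulSr, Hz; reflexivity.
Qed.

Lemma num_mulDr x y z : x * (y + z) = x * y + x * z.
Proof.
  apply (Sigma00_ind (fEq (tmul (tvar 1) (tadd (tvar 2) (tvar 0)))
           (tadd (tmul (tvar 1) (tvar 2)) (tmul (tvar 1) (tvar 0))))
           (x .: fun _ => y) E0);
    [constructor | simpl; rewrite num_mulr0, !num_addr0; reflexivity |]; simpl.
  intros t Ht; rewrite num_addrS, !num_mulrS, Ht, num_addA; reflexivity.
Qed.

Lemma num_mulA x y z : x * (y * z) = x * y * z.
Proof.
  apply (Sigma00_ind (fEq (tmul (tvar 1) (tmul (tvar 2) (tvar 0)))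
           (tmul (tmul (tvar 1) (tvar 2)) (tvar 0))) (x .: fun _ => y) E0);
    [constructor | simpl; rewrite !num_mulr0; reflexivity |]; simpl.
  intros t Ht; rewrite !num_mulrS, num_mulDr, Ht; reflexivity.
Qed.

Lemma num_mul1r x : 1 * x = x.
Proof.
  rewrite <- (num_add0r 1), num_mulSr, num_mul0r; apply num_add0r.
Qed.

Lemma num_semiring : semi_ring_theory 0 1 (m_add M) (m_mul M) eq.
Proof.
  constructor; intros.
  - apply num_add0r.
  - apply num_addC.
  - apply num_addA.
  - apply num_mul1r.
  - apply num_mul0r.
  - apply num_mulC.
  - apply num_mulA.
  - rewrite num_mulC, num_mulDr, !(num_mulC p); reflexivity.
Qed.

Add Ring num_ring : num_semiring.

Lemma num_addI x y z : x + z = y + z -> x = y.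
Proof.
  apply (Sigma00_ind (fImp (fEq (tadd (tvar 1) (tvar 0)) (tadd (tvar 2) (tvar 0)))
           (fEq (tvar 1) (tvar 2))) (x .: fun _ => y) E0);
    [repeat constructor | simpl; rewrite !num_addr0; auto |]; simpl.
  intros t Ht; rewrite !num_addrS; intros H; apply Ht, succ_inj, H.
Qed.

Lemma num_lt_exists x y : x < y <-> exists z, y = x + z + 1.
Proof.
  split.
  (* The assumption [x < y] is moved inside the existential quantifier, so that the induction
     formula is literally Sigma01. *)
  - revert y; assert (H : forall y, sat M (y .: fun _ => x) E0
      (fEx (fImp (fLt (tvar 2) (tvar 1))
         (fEq (tvar 1) (tadd (tadd (tvar 2) (tvar 0)) tone))))).
    { apply Sigma01_ind; [eexists; split; [|reflexivity]; repeat constructor | |].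
      - apply sat_fEx; exists 0; simpl; intros H; destruct (num_lt0 _ H).
      - intros y Hy; apply sat_fEx in Hy; destruct Hy as [z Hz].
        apply sat_fEx; simpl in *.
        destruct (classic (x < y)) as [H|H].
        + exists (z + 1); intros _; rewrite (Hz H) at 1; ring.
        + exists 0; intros H'; apply num_ltS in H'; destruct H' as [H'| ->];
            [contradiction | ring]. }
    intros y Hxy; specialize (H y); apply sat_fEx in H; destruct H as [z Hz].
    exists z; exact (Hz Hxy).
  - intros [z ->].
    apply (Sigma00_ind (fLt (tvar 1) (tadd (tadd (tvar 1) (tvar 0)) tone))
             (fun _ => x) E0); [constructor | |]; simpl.
    + apply num_ltS; right; ring.
    + intros t Ht; apply num_ltS; left; rewrite num_addA; exact Ht.
Qed.

Lemma num_zero_or_succ x : x = 0 \/ exists y, x = y + 1.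
Proof.
  destruct (classic (x = 0)) as [H|H]; [left; exact H | right].
  assert (H0 : sat M (x .: fun _ => 0) E0
    (fImp (fNot (fEq (tvar 0) tzero)) (fLt tzero (tvar 0)))).
  { apply Sigma00_ind; [repeat constructor | simpl; intros H'; destruct (H' eq_refl)|].
    simpl; intros y _ _; apply num_lt_exists; exists y; ring. }
  apply num_lt_exists in H0; [|exact H].
  destruct H0 as [z Hz]; simpl in Hz; exists z; rewrite Hz; ring.
Qed.

Lemma num_lt_irrefl x : ~ x < x.
Proof.
  intros H; apply num_lt_exists in H; destruct H as [z Hz].
  apply (succ_neq_zero z), (num_addI _ _ x).
  rewrite Hz at 2; ring.
Qed.

Lemma num_lt_trans x y z : x < y -> y < z -> x < z.
Proof.
  rewrite !num_lt_exists; intros [u ->] [v ->]; exists (u + v + 1); ring.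
Qed.

Lemma num_lt_trichotomy x y : x < y \/ x = y \/ y < x.
Proof.
  assert (H : sat M (x .: fun _ => y) E0 (fOr (fLt (tvar 0) (tvar 1))
    (fOr (fEq (tvar 0) (tvar 1)) (fLt (tvar 1) (tvar 0))))).
  { apply Sigma00_ind; [repeat constructor | |].
    - rewrite !sat_fOr; simpl.
      destruct (num_zero_or_succ y) as [->|[z ->]]; [right; left; reflexivity|].
      left; apply num_lt_exists; exists z; ring.
    - intros z; rewrite !sat_fOr; simpl; intros [H|[->|H]].
      + apply num_lt_exists in H; destruct H as [u ->].
        destruct (num_zero_or_succ u) as [->|[v ->]].
        * right; left; ring.
        * left; apply num_lt_exists; exists v; ring.
      + right; right; apply num_ltS; right; reflexivity.
      + right; right; apply num_ltS; left; exact H. }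
  rewrite !sat_fOr in H; exact H.
Qed.

Lemma num_lt_add x y z : x + z < y + z <-> x < y.
Proof.
  rewrite !num_lt_exists; split; intros [u Hu]; exists u.
  - apply (num_addI _ _ z); rewrite Hu; ring.
  - rewrite Hu; ring.
Qed.

Lemma num_lt_mul x y z : x < y -> x * (z + 1) < y * (z + 1).
Proof.
  rewrite !num_lt_exists; intros [u ->]; exists (u * z + u + z); ring.
Qed.

Lemma num_mulI x y z : x * (z + 1) = y * (z + 1) -> x = y.
Proof.
  intros H; destruct (num_lt_trichotomy x y) as [H'|[H'|H']]; [|exact H'|];
    apply (num_lt_mul _ _ z) in H'; rewrite H in H'; destruct (num_lt_irrefl _ H').
Qed.

Lemma num_lt_mulE x y z : x * (z + 1) < y * (z + 1) <-> x < y.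
Proof.
  split; [|apply num_lt_mul]; intros H.
  destruct (num_lt_trichotomy x y) as [H'|[H'|H']]; [exact H'| |].
  - rewrite H' in H; destruct (num_lt_irrefl _ H).
  - apply (num_lt_mul _ _ z) in H'; destruct (num_lt_irrefl _ (num_lt_trans _ _ _ H H')).
Qed.

End Arithmetic.

(** * Definability with parameters, search and pairing *)

Section Definability.

Variable M : rca0_model.

Local Notation "0" := (m_zero M) : num_scope.
Local Notation "1" := (m_one M) : num_scope.
Local Notation "x + y" := (m_add M x y) : num_scope.
Local Notation "x * y" := (m_mul M x y) : num_scope.
Local Notation "x < y" := (m_lt M x y) : num_scope.
Local Notation "x .: e" := (scons x e) (at level 55, right associativity).

Add Ring num_ring : (num_semiring M).

Local Notation env := (nat -> num M).

(* Parameters are interleaved with the arguments, so that neither their number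
   nor that of the arguments has to be tracked. *)
Definition mix {A} (e π : nat -> A) (i : nat) : A :=
  if Nat.even i then e (Nat.div2 i) else π (Nat.div2 i).

Lemma mix_even {A} (e π : nat -> A) i : mix e π (2 * i) = e i.
Proof. unfold mix; rewrite Nat.even_mul, Nat.div2_double; reflexivity. Qed.

Lemma mix_odd {A} (e π : nat -> A) i : mix e π (S (2 * i)) = π i.
Proof.
  unfold mix; rewrite Nat.even_succ, Nat.odd_mul, Nat.div2_succ_double; reflexivity.
Qed.

Lemma even_or_odd i : exists j, i = 2 * j \/ i = S (2 * j).
Proof.
  destruct (Nat.Even_or_Odd i) as [[j Hj]|[j Hj]]; exists j; [left | right]; lia.
Qed.

Lemma mix_eq {A} (e π f : nat -> A) :
  (forall i, f (2 * i) = e i) -> (forall i, f (S (2 * i)) = π i) -> mix e π = f.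
Proof.
  intros He Hπ; extensionality i.
  destruct (even_or_odd i) as [j [->| ->]];
    [rewrite mix_even, He | rewrite mix_odd, Hπ]; reflexivity.
Qed.

(** Bounded definability with number and set parameters. Predicates of environments stand in for
    formulas, so that closure properties can be used without displaying syntax. *)
Definition def0 (P : env -> Prop) : Prop :=
  exists p π E, Sigma00 p /\ forall e, P e <-> sat M (mix e π) E p.

Lemma def0_ext (P Q : env -> Prop) :
  (forall e, P e <-> Q e) -> def0 P -> def0 Q.
Proof.
  intros H [p [π [E [Hp HP]]]]; exists p, π, E; split; [exact Hp|].
  intros e; rewrite <- H; apply HP.
Qed.

Lemma sat_mix (f : nat -> nat) (g : nat -> nat) e π π' E E' p :
  (forall i, π' (f i) = π i) -> (forall X, E' (g X) = E X) ->
  sat M (mix e π') E' (fsubst (mix (fun i => tvar (2 * i))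
     (fun i => tvar (S (2 * f i)))) g p) <-> sat M (mix e π) E p.
Proof.
  intros Hf Hg; rewrite sat_fsubst.
  replace (fun i => eval M (mix e π') _) with (mix e π).
  - replace (fun X => E' (g X)) with E; [reflexivity|].
    extensionality X; auto.
  - apply mix_eq; intros i; rewrite ?mix_even, ?mix_odd; cbn [eval];
      rewrite ?mix_even, ?mix_odd; auto.
Qed.

(** The two families of parameters are interleaved once more, so that both formulas are evaluated in
    the same environment. *)
Lemma def0_common P Q : def0 P -> def0 Q ->
  exists p q π E, Sigma00 p /\ Sigma00 q /\
    (forall e, P e <-> sat M (mix e π) E p) /\
    (forall e, Q e <-> sat M (mix e π) E q).
Proof.
  intros [p [π [E [Hp HP]]]] [q [π' [E' [Hq HQ]]]].
  exists (fsubst (mix (fun i => tvar (2 * i)) (fun i => tvar (S (2 * (2 * i)))))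
            (fun X => 2 * X) p).
  exists (fsubst (mix (fun i => tvar (2 * i)) (fun i => tvar (S (2 * (S (2 * i))))))
            (fun X => S (2 * X)) q).
  exists (mix π π'), (mix E E').
  split; [|split; [|split]]; try (apply Sigma00_fsubst; assumption); intros e.
  - rewrite HP; symmetry; apply (sat_mix (fun i => 2 * i)); apply mix_even.
  - rewrite HQ; symmetry; apply (sat_mix (fun i => S (2 * i))); apply mix_odd.
Qed.

Lemma def0_eq i j : def0 (fun e => e i = e j).
Proof.
  exists (fEq (tvar (2 * i)) (tvar (2 * j))), (fun _ => 0%num), (fun _ => some_set M).
  split; [constructor|]; intros e; cbn [sat eval]; rewrite !mix_even; reflexivity.
Qed.

Lemma def0_const i c : def0 (fun e => e i = c).
Proof.
  exists (fEq (tvar (2 * i)) (tvar (S (2 * 0)))), (fun _ => c), (fun _ => some_set M).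
  split; [constructor|]; intros e; cbn [sat eval]; rewrite mix_even, mix_odd; reflexivity.
Qed.

Lemma def0_lt i j : def0 (fun e => e i < e j)%num.
Proof.
  exists (fLt (tvar (2 * i)) (tvar (2 * j))), (fun _ => 0%num), (fun _ => some_set M).
  split; [constructor|]; intros e; cbn [sat eval]; rewrite !mix_even; reflexivity.
Qed.

Lemma def0_add i j k : def0 (fun e => e i = e j + e k)%num.
Proof.
  exists (fEq (tvar (2 * i)) (tadd (tvar (2 * j)) (tvar (2 * k)))),
    (fun _ => 0%num), (fun _ => some_set M).
  split; [constructor|]; intros e; cbn [sat eval]; rewrite !mix_even; reflexivity.
Qed.

Lemma def0_mul i j k : def0 (fun e => e i = e j * e k)%num.
Proof.
  exists (fEq (tvar (2 * i)) (tmul (tvar (2 * j)) (tvar (2 * k)))),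
    (fun _ => 0%num), (fun _ => some_set M).
  split; [constructor|]; intros e; cbn [sat eval]; rewrite !mix_even; reflexivity.
Qed.

Lemma def0_mem i X : def0 (fun e => m_mem M (e i) X).
Proof.
  exists (fIn (tvar (2 * i)) 0), (fun _ => 0%num), (fun _ => X).
  split; [constructor|]; intros e; cbn [sat eval]; rewrite !mix_even; reflexivity.
Qed.

Lemma def0_imp P Q : def0 P -> def0 Q -> def0 (fun e => P e -> Q e).
Proof.
  intros HP HQ.
  destruct (def0_common P Q HP HQ) as [p [q [π [E [Hp [Hq [HP' HQ']]]]]]].
  exists (fImp p q), π, E; split; [constructor; assumption|].
  intros e; rewrite HP', HQ'; reflexivity.
Qed.

Lemma def0_false : def0 (fun _ => False).
Proof.
  exists fBot, (fun _ => 0%num), (fun _ => some_set M); split; [constructor|].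
  reflexivity.
Qed.

Lemma def0_not P : def0 P -> def0 (fun e => ~ P e).
Proof. intros HP; apply (def0_imp P (fun _ => False) HP def0_false). Qed.

Lemma def0_and P Q : def0 P -> def0 Q -> def0 (fun e => P e /\ Q e).
Proof.
  intros HP HQ; eapply def0_ext; [|exact (def0_not _ (def0_imp _ _ HP (def0_not _ HQ)))].
  intros e; cbv beta; split; [intros H; apply NNPP|]; tauto.
Qed.

Lemma def0_rename r P : def0 P -> def0 (fun e => P (fun i => e (r i))).
Proof.
  intros [p [π [E [Hp HP]]]].
  exists (fsubst (mix (fun i => tvar (2 * r i)) (fun i => tvar (S (2 * i))))
            (fun X => X) p), π, E.
  split; [apply Sigma00_fsubst, Hp|]; intros e; rewrite HP, sat_fsubst.
  replace (fun i => eval M (mix e π) _) with (mix (fun i => e (r i)) π);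
    [reflexivity|].
  apply mix_eq; intros i; rewrite ?mix_even, ?mix_odd; cbn [eval];
    rewrite ?mix_even, ?mix_odd; reflexivity.
Qed.

Lemma def0_ball i P : def0 P -> def0 (fun e => forall x, (x < e i)%num -> P (x .: e)).
Proof.
  intros [p [π [E [Hp HP]]]].
  set (σ := mix ((tvar 0) .: fun i => tvar (S (2 * i))) (fun i => tvar (S (S (2 * i))))).
  exists (fAll (fImp (fLt (tvar 0) (tshift (tvar (2 * i)))) (fsubst σ (fun X => X) p))),
    π, E.
  split; [constructor; apply Sigma00_fsubst, Hp|].
  intros e; cbn [sat eval tshift tsubst]; cbn [scons]; rewrite mix_even.
  assert (H : forall x, P (x .: e) <->
                sat M (x .: mix e π) E (fsubst σ (fun X => X) p)).
  { intros x; rewrite HP, sat_fsubst.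
    replace (fun i => eval M (x .: mix e π) _) with (mix (x .: e) π); [reflexivity|].
    apply mix_eq; intros j; unfold σ; rewrite ?mix_even, ?mix_odd.
    - destruct j as [|j]; [reflexivity|]; cbn [scons eval]; apply mix_even.
    - cbn [scons eval]; apply mix_odd. }
  split; intros HB x Hx; apply H, HB, Hx.
Qed.

Lemma def0_bex i P : def0 P -> def0 (fun e => exists x, (x < e i)%num /\ P (x .: e)).
Proof.
  intros HP; eapply def0_ext; [|apply def0_not, (def0_ball i), def0_not, HP].
  intros e; cbv beta; split.
  - intros H; apply NNPP; intros Hn; apply H; intros x Hx Hx'; apply Hn; eauto.
  - intros [x [Hx Hx']] H; exact (H x Hx Hx').
Qed.

Lemma sat_args2 x y π E p :
  sat M (x .: y .: π) E (fsubst (mix (tvar 0 .: tvar 1 .: fun _ => tzero)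
     (fun i => tvar (S (S i)))) (fun X => X) p) <->
  sat M (mix (x .: y .: fun _ => 0%num) π) E p.
Proof.
  rewrite sat_fsubst.
  replace (fun i => eval M (x .: y .: π) _) with (mix (x .: y .: fun _ => 0%num) π);
    [reflexivity|].
  apply mix_eq; intros j; rewrite ?mix_even, ?mix_odd; [|reflexivity].
  destruct j as [|[|j]]; reflexivity.
Qed.

Lemma def0_args2 (P : num M -> num M -> Prop) :
  def0 (fun e => P (e 0%nat) (e 1%nat)) ->
  exists p e E, Sigma00 p /\ forall x y, P x y <-> sat M (x .: y .: e) E p.
Proof.
  intros [p [π [E [Hp HP]]]].
  exists (fsubst (mix (tvar 0 .: tvar 1 .: fun _ => tzero) (fun i => tvar (S (S i))))
            (fun X => X) p), π, E.
  split; [apply Sigma00_fsubst, Hp|]; intros x y; rewrite sat_args2.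
  apply (HP (x .: y .: fun _ => 0%num)).
Qed.

Lemma comprehension00 (A B : num M -> num M -> Prop) :
  def0 (fun e => A (e 0%nat) (e 1%nat)) ->
  def0 (fun e => B (e 0%nat) (e 1%nat)) ->
  (forall x, (exists y, A y x) <-> (forall y, B y x)) ->
  exists X, forall x, m_mem M x X <-> exists y, A y x.
Proof.
  intros HA HB HAB.
  assert (H : exists p q e E, Sigma00 p /\ Sigma00 q /\
    (forall x y, A x y <-> sat M (x .: y .: e) E p) /\
    (forall x y, B x y <-> sat M (x .: y .: e) E q)).
  { destruct (def0_common _ _ HA HB) as [p [q [π [E [Hp [Hq [HA' HB']]]]]]].
    set (σ := mix (tvar 0 .: tvar 1 .: fun _ => tzero) (fun i => tvar (S (S i)))).
    exists (fsubst σ (fun X => X) p), (fsubst σ (fun X => X) q), π, E.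
    split; [|split; [|split]]; try (apply Sigma00_fsubst; assumption);
      intros x y; unfold σ; rewrite sat_args2;
      [apply (HA' (x .: y .: fun _ => 0%num)) | apply (HB' (x .: y .: fun _ => 0%num))]. }
  destruct H as [p [q [e [E [Hp [Hq [HA' HB']]]]]]].
  assert (H := carrier_axioms M _ e E
    (ax_Delta01_comprehension (fEx p) (fAll q)
       (ex_intro _ p (conj Hp eq_refl)) (ex_intro _ q (conj Hq eq_refl)))).
  assert (HA'' : forall x, sat M (x .: e) E (fEx p) <-> exists y, A y x).
  { intros x; rewrite sat_fEx; split; intros [y Hy]; exists y; apply HA', Hy. }
  cbn [sat] in H.
  assert (H' : sat M e E (fExS (fAll (fIff (fIn (tvar 0) 0) (shiftS (fEx p)))))).
  { apply H; intros x; apply sat_fAnd; split.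
    - intros H1 y; apply HB', HAB, HA'', H1.
    - intros H1; apply HA'', HAB; intros y; apply HB', H1. }
  apply sat_fExS in H'; destruct H' as [X HX]; exists X; intros x.
  specialize (HX x); apply sat_fAnd in HX; destruct HX as [HX1 HX2].
  rewrite <- HA''; split.
  - intros Hx; specialize (HX1 Hx); apply sat_fsubst in HX1; exact HX1.
  - intros Hx; apply HX2; apply sat_fsubst; exact Hx.
Qed.

(** * Sigma01 and Delta01 predicates *)

Definition sig1 (P : env -> Prop) : Prop :=
  exists A, def0 A /\ forall e, P e <-> exists y, A (y .: e).

Lemma sig1_ext (P Q : env -> Prop) :
  (forall e, P e <-> Q e) -> sig1 P -> sig1 Q.
Proof.
  intros H [A [HA HP]]; exists A; split; [exact HA|].
  intros e; rewrite <- H; apply HP.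
Qed.

Lemma def0_fix e0 A : def0 A ->
  def0 (fun e => A (e 0%nat .: e 1%nat .: e0)).
Proof.
  intros [p [π [E [Hp HP]]]].
  exists (fsubst (mix (tvar 0 .: tvar 2 .: fun i => tvar (S (2 * (2 * i))))
            (fun i => tvar (S (2 * (S (2 * i)))))) (fun X => X) p), (mix e0 π), E.
  split; [apply Sigma00_fsubst, Hp|]; intros e; rewrite HP, sat_fsubst.
  replace (fun i => eval M (mix e (mix e0 π)) _)
    with (mix (e 0%nat .: e 1%nat .: e0) π); [reflexivity|].
  apply mix_eq; intros i; rewrite ?mix_even, ?mix_odd.
  - destruct i as [|[|i]]; [reflexivity | reflexivity |].
    cbn [scons eval]; rewrite mix_odd, mix_even; reflexivity.
  - cbn [eval]; rewrite !mix_odd; reflexivity.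
Qed.

Lemma sig1_ind (P : num M -> Prop) : sig1 (fun e => P (e 0%nat)) ->
  P 0%num -> (forall x, P x -> P (x + 1)%num) -> forall x, P x.
Proof.
  intros [A [HA HP]].
  destruct (def0_args2 (fun y x => A (y .: x .: fun _ => 0%num)))
    as [p [e [E [Hp HA']]]]; [apply (def0_fix (fun _ => 0%num) A HA)|].
  assert (HP' : forall x, P x <-> sat M (x .: e) E (fEx p)).
  { intros x; rewrite sat_fEx, (HP (x .: fun _ => 0%num)).
    split; intros [y Hy]; exists y; apply HA', Hy. }
  intros H0 HS x; apply HP', Sigma01_ind.
  - exists p; auto.
  - apply HP', H0.
  - intros y Hy; apply HP', HS, HP', Hy.
Qed.

Lemma sig1_def0 P : def0 P -> sig1 P.
Proof.
  intros HP; exists (fun e => P (fun i => e (S i))); split.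
  - apply (def0_rename S P HP).
  - intros e; split; [intros H; exists 0%num; exact H | intros [y H]; exact H].
Qed.

Lemma sig1_rename r P : sig1 P -> sig1 (fun e => P (fun i => e (r i))).
Proof.
  intros [A [HA HP]].
  exists (fun e => A (fun i => e (match i with O => O | S i => S (r i) end))).
  split; [apply (def0_rename _ A HA)|].
  intros e; rewrite HP.
  assert (E : forall y, (fun i => (y .: e) (match i with O => O | S i => S (r i) end))
                 = y .: fun i => e (r i)).
  { intros y; extensionality i; destruct i; reflexivity. }
  split; intros [y Hy]; exists y; [rewrite E | rewrite E in Hy]; exact Hy.
Qed.

Lemma num_upper2 x y : exists w : num M, (x < w /\ y < w)%num.
Proof.
  exists (x + y + 1)%num; rewrite !num_lt_exists; split; [exists y | exists x]; ring.
Qed.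

(** Two unbounded quantifiers are contracted to one over a common bound [w] of both witnesses, which
    leaves only bounded quantifiers behind it. *)
Lemma sig1_ex P : sig1 P -> sig1 (fun e => exists x, P (x .: e)).
Proof.
  intros [A [HA HP]].
  exists (fun e => exists x, (x < e 0%nat)%num /\ exists y, (y < (x .: e) 1%nat)%num /\
            A ((fun x y i => match i with O => y | S O => x | S (S i) => e (S i) end) x y)).
  split.
  - apply (def0_bex 0 (fun e => exists y, (y < e 1%nat)%num /\ A
      ((fun x y i => match i with O => y | S O => x | S (S i) => e (S (S i)) end) (e 0%nat) y))).
    apply (def0_bex 1 (fun e => A
      (fun i => match i with O => e 0%nat | S O => e 1%nat | S (S i) => e (S (S (S i))) end))).
    eapply def0_ext; [|exact (def0_rename
      (fun i => match i with O => O | S O => 1 | S (S i) => S (S (S i)) end) A HA)].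
    intros e; cbv beta.
    replace (fun i => e _) with
      (fun i => match i with O => e 0%nat | S O => e 1%nat | S (S i) => e (S (S (S i))) end);
      [reflexivity | extensionality i; destruct i as [|[|i]]; reflexivity].
  - intros e.
    assert (E : forall x y, y .: x .: e =
      (fun i => match i with O => y | S O => x | S (S i) => e i end)).
    { intros x y; extensionality i; destruct i as [|[|i]]; reflexivity. }
    split.
    + intros [x Hx]; apply HP in Hx; destruct Hx as [y Hy].
      destruct (num_upper2 x y) as [w [H1 H2]].
      exists w, x; split; [exact H1|]; exists y; split; [exact H2|].
      rewrite E in Hy; exact Hy.
    + intros [w [x [_ [y [_ Hy]]]]]; exists x; apply HP; exists y; rewrite E; exact Hy.
Qed.

Lemma sig1_and P Q : sig1 P -> sig1 Q -> sig1 (fun e => P e /\ Q e).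
Proof.
  intros [A [HA HP]] [B [HB HQ]].
  eapply sig1_ext; [|apply sig1_ex, sig1_ex, sig1_def0, def0_and;
    [exact (def0_rename (fun i => match i with O => O | S i => S (S i) end) A HA)
    |exact (def0_rename S B HB)]].
  intros e; cbv beta; rewrite HP, HQ.
  assert (E : forall y z, (fun i =>
      (z .: y .: e) (match i with O => O | S i => S (S i) end)) = z .: e).
  { intros y z; extensionality i; destruct i; reflexivity. }
  split.
  - intros [y [z [Hz Hy]]]; split; [exists z; rewrite <- (E y z) | exists y]; assumption.
  - intros [[z Hz] [y Hy]]; exists y, z; rewrite E; auto.
Qed.

Lemma sig1_or P Q : sig1 P -> sig1 Q -> sig1 (fun e => P e \/ Q e).
Proof.
  intros [A [HA HP]] [B [HB HQ]].
  exists (fun e => ~ (~ A e /\ ~ B e)); split.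
  - apply def0_not, def0_and; apply def0_not; assumption.
  - intros e; rewrite HP, HQ; split.
    + intros [[y Hy]|[y Hy]]; exists y; tauto.
    + intros [y Hy]; destruct (classic (A (y .: e))); [left; eauto|].
      destruct (classic (B (y .: e))); [right; eauto | tauto].
Qed.

Lemma sig1_const c i : sig1 (fun e => e i = c).
Proof. apply sig1_def0, def0_const. Qed.

(** Sigma01 collection, by induction on an initial segment [a] of the range below [c]: that the
    [x < a] have a common bound is itself a Sigma01 statement. *)
Lemma collection (A : num M -> num M -> Prop) c :
  def0 (fun e => A (e 0%nat) (e 1%nat)) ->
  (forall x, (x < c)%num -> exists y, A y x) ->
  exists b, forall x, (x < c)%num -> exists y, (y < b)%num /\ A y x.
Proof.
  intros HA H.
  set (P := fun a => exists b, forall x, (x < a)%num -> (x < c)%num ->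
                    exists y, (y < b)%num /\ A y x).
  assert (HP : forall a, P a).
  { apply sig1_ind.
    (* The closure lemmas so far compare variables only, so the parameter [c] enters as a variable
       equal to it. *)
    - apply sig1_ext with (P := fun e => exists c', (c' .: e) 0%nat = c /\
        exists b, forall x, (x < e 0%nat)%num -> (x < c')%num ->
                    exists y, (y < b)%num /\ A y x).
      { intros e; unfold P; split; [intros [c' [Hc H']]; cbn in Hc; subst c'; exact H'|].
        intros H'; exists c; split; [reflexivity | exact H']. }
      apply (sig1_ex (fun e => e 0%nat = c /\ exists b,
         forall x, (x < e 1%nat)%num -> (x < e 0%nat)%num ->
                    exists y, (y < b)%num /\ A y x)).
      apply sig1_and; [apply sig1_const|].
      apply (sig1_ex (fun e => forall x, (x < e 2%nat)%num -> (x < e 1%nat)%num ->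
                    exists y, (y < e 0%nat)%num /\ A y x)).
      apply sig1_def0.
      apply (def0_ball 2 (fun e => (e 0%nat < e 2%nat)%num ->
                    exists y, (y < e 1%nat)%num /\ A y (e 0%nat))).
      apply def0_imp; [apply def0_lt|].
      apply (def0_bex 1 (fun e => A (e 0%nat) (e 1%nat))), HA.
    - exists 0%num; intros x Hx; destruct (num_lt0 M x Hx).
    - intros a [b Hb].
      destruct (classic (a < c)%num) as [Ha|Ha].
      + destruct (H a Ha) as [y Hy]; destruct (num_upper2 b y) as [w [H1 H2]].
        exists w; intros x Hx Hxc; apply num_ltS in Hx; destruct Hx as [Hx| ->]; [|eauto].
        destruct (Hb x Hx Hxc) as [z [Hz HA']].
        exists z; split; [eapply num_lt_trans; eassumption | exact HA'].
      + exists b; intros x Hx Hxc; apply num_ltS in Hx; destruct Hx as [Hx| ->]; [auto|].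
        contradiction. }
  destruct (HP c) as [b Hb]; exists b; auto.
Qed.

(** By [collection] the witnesses for all [x < e i] have a common bound, which can be pulled in
    front of the bounded quantifier. *)
Lemma sig1_ball i P :
  sig1 P -> sig1 (fun e => forall x, (x < e i)%num -> P (x .: e)).
Proof.
  intros [A [HA HP]].
  set (B := fun e : env => forall x, (x < e (S i))%num ->
              exists y, (y < e 0%nat)%num /\ A (y .: x .: fun i => e (S i))).
  exists B; split.
  - apply (def0_ball (S i) (fun e => exists y, (y < e 1%nat)%num /\
              A (y .: e 0%nat .: fun i => e (S (S i))))).
    apply (def0_bex 1 (fun e => A (e 0%nat .: e 1%nat .: fun i => e (S (S (S i)))))).
    eapply def0_ext; [|exact (def0_rename
      (O .: 1 .: fun i => S (S (S i))) A HA)].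
    intros e; cbv beta.
    replace (fun i => e _) with (e 0%nat .: e 1%nat .: fun i => e (S (S (S i))));
      [reflexivity | extensionality j; destruct j as [|[|j]]; reflexivity].
  - intros e; split.
    + intros H.
      destruct (collection (fun y x => A (y .: x .: e)) (e i) (def0_fix e A HA))
        as [b Hb]; [|exists b; intros x Hx; apply Hb, Hx].
      intros x Hx; apply HP, H, Hx.
    + intros [b Hb] x Hx; apply HP.
      destruct (Hb x Hx) as [y [_ Hy]]; exists y; exact Hy.
Qed.

(** Delta01 with parameters, that is, recursive in sets of the model. By [rec_set] and [rec_mem] the
    sets of the model are exactly the unary predicates of this kind. *)
Definition rec (P : env -> Prop) : Prop := sig1 P /\ sig1 (fun e => ~ P e).

Definition tail (e : env) : env := fun i => e (S i).

Definition recf (t : env -> num M) : Prop := rec (fun e => e 0%nat = t (tail e)).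

Lemma rec_ext (P Q : env -> Prop) : (forall e, P e <-> Q e) -> rec P -> rec Q.
Proof.
  intros H [H1 H2]; split; [exact (sig1_ext _ _ H H1)|].
  apply (sig1_ext (fun e => ~ P e)); [|exact H2].
  intros e; cbv beta; rewrite H; reflexivity.
Qed.

Lemma rec_def0 P : def0 P -> rec P.
Proof. intros HP; split; apply sig1_def0; [|apply def0_not]; exact HP. Qed.

Lemma rec_not P : rec P -> rec (fun e => ~ P e).
Proof.
  intros [H1 H2]; split; [exact H2|].
  eapply sig1_ext; [|exact H1]; intros e; cbv beta; split; [tauto | apply NNPP].
Qed.

Lemma rec_and P Q : rec P -> rec Q -> rec (fun e => P e /\ Q e).
Proof.
  intros [H1 H2] [H3 H4]; split; [apply sig1_and; assumption|].
  eapply sig1_ext; [|exact (sig1_or _ _ H2 H4)].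
  intros e; cbv beta; split; [tauto | apply not_and_or].
Qed.

Lemma rec_or P Q : rec P -> rec Q -> rec (fun e => P e \/ Q e).
Proof.
  intros HP HQ; eapply rec_ext; [|exact (rec_not _ (rec_and _ _ (rec_not _ HP) (rec_not _ HQ)))].
  intros e; cbv beta; split; [intros H; apply NNPP|]; tauto.
Qed.

Lemma rec_imp P Q : rec P -> rec Q -> rec (fun e => P e -> Q e).
Proof.
  intros HP HQ; eapply rec_ext; [|exact (rec_or _ _ (rec_not _ HP) HQ)].
  intros e; cbv beta; split; [tauto|]; intros H; apply NNPP; tauto.
Qed.

Lemma rec_iff P Q : rec P -> rec Q -> rec (fun e => P e <-> Q e).
Proof. intros HP HQ; apply rec_and; apply rec_imp; assumption. Qed.

Lemma rec_const (P : Prop) : rec (fun _ => P).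
Proof.
  apply rec_def0; destruct (classic P) as [H|H].
  - eapply def0_ext; [|exact (def0_not _ def0_false)]; intros e; cbv beta; tauto.
  - eapply def0_ext; [|exact def0_false]; intros e; cbv beta; tauto.
Qed.

Lemma rec_rename r P : rec P -> rec (fun e => P (fun i => e (r i))).
Proof. intros [H1 H2]; split; [exact (sig1_rename r _ H1) | exact (sig1_rename r _ H2)]. Qed.

Lemma sig1_exists (P : num M -> env -> Prop) :
  sig1 (fun e => P (e 0%nat) (tail e)) -> sig1 (fun e => exists x, P x e).
Proof. intros HP; apply (sig1_ex _ HP). Qed.

(** The value of [t] is guessed and its recursive graph checked. As the value exists and is unique,
    this works for complements as well, which gives [rec_app]. *)
Lemma sig1_app (P : num M -> env -> Prop) t :
  sig1 (fun e => P (e 0%nat) (tail e)) -> recf t -> sig1 (fun e => P (t e) e).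
Proof.
  intros HP [Ht _]; eapply sig1_ext;
    [|exact (sig1_exists (fun x e => x = t e /\ P x e) (sig1_and _ _ Ht HP))].
  intros e; cbv beta; split; [intros [x [-> Hx]]; exact Hx | eauto].
Qed.

Lemma rec_app (P : num M -> env -> Prop) t :
  rec (fun e => P (e 0%nat) (tail e)) -> recf t -> rec (fun e => P (t e) e).
Proof.
  intros [H1 H2] Ht; split; [exact (sig1_app P t H1 Ht)|].
  exact (sig1_app (fun x e => ~ P x e) t H2 Ht).
Qed.

Lemma rec_forall_lt (P : num M -> env -> Prop) t :
  rec (fun e => P (e 0%nat) (tail e)) -> recf t ->
  rec (fun e => forall x, (x < t e)%num -> P x e).
Proof.
  intros HP Ht.
  apply (rec_app (fun b e => forall x, (x < b)%num -> P x e) t); [|exact Ht].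
  assert (H : rec (fun e => P (e 0%nat) (fun i => e (S (S i))))).
  { eapply rec_ext; [|exact (rec_rename (O .: fun i => S (S i)) _ HP)].
    intros e; reflexivity. }
  destruct H as [H1 H2]; split.
  - exact (sig1_ball 0 _ H1).
  - eapply sig1_ext; [|exact (sig1_exists (fun x e => (x < e 0%nat)%num /\
      ~ P x (tail e)) (sig1_and _ _ (sig1_def0 _ (def0_lt 0 1)) H2))].
    intros e; cbv beta; split.
    + intros [x [Hx Hn]] H; exact (Hn (H x Hx)).
    + intros H; apply NNPP; intros Hn; apply H; intros x Hx; apply NNPP; eauto.
Qed.

Lemma rec_exists_lt (P : num M -> env -> Prop) t :
  rec (fun e => P (e 0%nat) (tail e)) -> recf t ->
  rec (fun e => exists x, (x < t e)%num /\ P x e).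
Proof.
  intros HP Ht; eapply rec_ext;
    [|exact (rec_not _ (rec_forall_lt (fun x e => ~ P x e) t (rec_not _ HP) Ht))].
  intros e; cbv beta; split.
  - intros H; apply NNPP; intros Hn; apply H; intros x Hx Hx'; apply Hn; eauto.
  - intros [x [Hx Hx']] H; exact (H x Hx Hx').
Qed.

Lemma recf_var i : recf (fun e => e i).
Proof. exact (rec_def0 _ (def0_eq 0 (S i))). Qed.

Lemma recf_const c : recf (fun _ => c).
Proof. exact (rec_def0 _ (def0_const 0 c)). Qed.

(* Substituting for two variables at once keeps the environments separate. *)
Lemma rec_app2 (P : num M -> num M -> Prop) s t :
  rec (fun e => P (e 0%nat) (e 1%nat)) -> recf s -> recf t ->
  rec (fun e => P (s e) (t e)).
Proof.
  intros HP Hs Ht.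
  apply (rec_app (fun x e => P x (t e)) s); [|exact Hs].
  apply (rec_app (fun y e => P (e 0%nat) y) (fun e => t (tail e))).
  - eapply rec_ext; [|exact (rec_rename (1 .: O .: fun i => i) _ HP)].
    intros e; reflexivity.
  - eapply rec_ext; [|exact (rec_rename (O .: fun i => S (S i)) _ Ht)].
    intros e; reflexivity.
Qed.

Definition recfun1 (f : num M -> num M) : Prop := recf (fun e => f (e 0%nat)).
Definition recfun2 (f : num M -> num M -> num M) : Prop :=
  recf (fun e => f (e 0%nat) (e 1%nat)).

Lemma recf_app1 f t : recfun1 f -> recf t -> recf (fun e => f (t e)).
Proof.
  intros Hf Ht; apply (rec_app2 (fun v x => v = f x) (fun e => e 0%nat)
                         (fun e => t (tail e))).
  - exact Hf.
  - apply recf_var.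
  - eapply rec_ext; [|exact (rec_rename (O .: fun i => S (S i)) _ Ht)].
    intros e; reflexivity.
Qed.

Lemma recf_weaken t : recf t -> recf (fun e => t (tail e)).
Proof.
  intros Ht; eapply rec_ext; [|exact (rec_rename (O .: fun i => S (S i)) _ Ht)].
  intros e; reflexivity.
Qed.

Lemma recf_app2 f s t : recfun2 f -> recf s -> recf t -> recf (fun e => f (s e) (t e)).
Proof.
  intros Hf Hs Ht.
  apply (rec_app (fun x e => e 0%nat = f x (t (tail e))) (fun e => s (tail e)));
    [|apply recf_weaken, Hs].
  apply (rec_app (fun y e => e 1%nat = f (e 0%nat) y) (fun e => t (tail (tail e))));
    [|exact (recf_weaken (fun e => t (tail e)) (recf_weaken t Ht))].
  eapply rec_ext; [|exact (rec_rename (2 .: 1 .: O .: fun i => i) _ Hf)].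
  intros e; reflexivity.
Qed.

Lemma rec_eq s t : recf s -> recf t -> rec (fun e => s e = t e).
Proof. apply rec_app2, rec_def0, def0_eq. Qed.

Lemma rec_lt s t : recf s -> recf t -> rec (fun e => s e < t e)%num.
Proof. apply rec_app2, rec_def0, def0_lt. Qed.

Lemma rec_mem t X : recf t -> rec (fun e => m_mem M (t e) X).
Proof.
  intros Ht; apply (rec_app (fun x e => m_mem M x X) t); [|exact Ht].
  apply rec_def0, def0_mem.
Qed.

Lemma recf_add s t : recf s -> recf t -> recf (fun e => s e + t e)%num.
Proof. apply recf_app2; exact (rec_def0 _ (def0_add 0 1 2)). Qed.

Lemma recf_mul s t : recf s -> recf t -> recf (fun e => s e * t e)%num.
Proof. apply recf_app2; exact (rec_def0 _ (def0_mul 0 1 2)). Qed.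

Definition m_le (x y : num M) : Prop := (x < y)%num \/ x = y.

Lemma rec_le s t : recf s -> recf t -> rec (fun e => m_le (s e) (t e)).
Proof. intros Hs Ht; apply rec_or; [apply rec_lt | apply rec_eq]; assumption. Qed.

Lemma m_le_lt_succ x y : m_le x y <-> (x < y + 1)%num.
Proof. symmetry; apply num_ltS. Qed.

Lemma rec_forall_le (P : num M -> env -> Prop) t :
  rec (fun e => P (e 0%nat) (tail e)) -> recf t ->
  rec (fun e => forall x, m_le x (t e) -> P x e).
Proof.
  intros HP Ht; eapply rec_ext; [|exact (rec_forall_lt P (fun e => t e + 1)%num HP
    (recf_add _ _ Ht (recf_const _)))].
  intros e; cbv beta; split; intros H x Hx; apply H, m_le_lt_succ, Hx.
Qed.

Lemma rec_exists_le (P : num M -> env -> Prop) t :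
  rec (fun e => P (e 0%nat) (tail e)) -> recf t ->
  rec (fun e => exists x, m_le x (t e) /\ P x e).
Proof.
  intros HP Ht; eapply rec_ext; [|exact (rec_exists_lt P (fun e => t e + 1)%num HP
    (recf_add _ _ Ht (recf_const _)))].
  intros e; cbv beta; split; intros [x [H Hx]]; exists x; split; auto;
    apply m_le_lt_succ, H.
Qed.

Lemma sig1_rec P : rec P -> sig1 P.
Proof. intros H; apply H. Qed.

Lemma rec_set (P : num M -> Prop) : rec (fun e => P (e 0%nat)) ->
  exists X, forall x, m_mem M x X <-> P x.
Proof.
  intros [[A [HA HP]] [B [HB HQ]]].
  pose (z := fun _ : nat => 0%num).
  destruct (comprehension00 (fun y x => A (y .: x .: z)) (fun y x => ~ B (y .: x .: z)))
    as [X HX].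
  - apply (def0_fix z A HA).
  - apply def0_not, (def0_fix z B HB).
  - intros x; rewrite <- (HP (x .: z)).
    assert (H := HQ (x .: z)); cbn [scons] in *; split.
    + intros Hx y Hy; apply H; eauto.
    + intros Hn; apply NNPP; intros Hx; apply H in Hx; destruct Hx as [y Hy].
      exact (Hn y Hy).
  - exists X; intros x; rewrite HX, <- (HP (x .: z)); reflexivity.
Qed.

Lemma m_le_refl x : m_le x x.
Proof. right; reflexivity. Qed.

Lemma m_le_or_lt x y : m_le x y \/ (y < x)%num.
Proof. unfold m_le; destruct (num_lt_trichotomy M x y); tauto. Qed.

(** Descent written as an induction: without a least element, every [x] admits some [z] in [P] with
    [z + x] at most [a], which is absurd for [x = a + 1]. The induction statement is Sigma01 because
    [P] is. *)
Lemma sig1_least (P : num M -> Prop) a : sig1 (fun e => P (e 0%nat)) -> P a ->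
  exists x, P x /\ forall y, (y < x)%num -> ~ P y.
Proof.
  intros HP Ha; apply NNPP; intros Hn.
  assert (H : forall x, exists z, P z /\ m_le (z + x)%num a).
  { apply sig1_ind.
    - apply (sig1_exists (fun z e => P z /\ m_le (z + e 0%nat)%num a)).
      apply sig1_and; [exact HP|].
      apply sig1_rec, rec_le; [apply recf_add; apply recf_var | apply recf_const].
    - exists a; split; [exact Ha|]; rewrite num_addr0; apply m_le_refl.
    - intros x [z [Hz Hx]].
      destruct (classic (exists y, (y < z)%num /\ P y)) as [[y [Hy HPy]]|Hno].
      + exists y; split; [exact HPy|].
        apply num_lt_exists in Hy; destruct Hy as [w ->].
        destruct (m_le_or_lt (y + (x + 1))%num a) as [H|H]; [exact H | exfalso].
        assert (H' : (a < y + w + 1 + x)%num).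
        { destruct (num_zero_or_succ M w) as [->|[v ->]].
          - replace (y + 0 + 1 + x)%num with (y + (x + 1))%num by ring; exact H.
          - apply (num_lt_trans M _ _ _ H), num_lt_exists; exists v; ring. }
        destruct Hx as [Hx| Hx].
        * exact (num_lt_irrefl M _ (num_lt_trans M _ _ _ Hx H')).
        * rewrite Hx in H'; exact (num_lt_irrefl M _ H').
      + exfalso; apply Hn; exists z; split; [exact Hz|].
        intros y Hy Hy'; apply Hno; eauto. }
  destruct (H (a + 1)%num) as [z [_ Hz]].
  apply (num_lt_irrefl M a); destruct Hz as [Hz| Hz].
  - eapply num_lt_trans; [|exact Hz]; apply num_lt_exists; exists z; ring.
  - apply num_lt_exists; exists z; rewrite <- Hz at 1; ring.
Qed.

Lemma recf_graph (f : num M -> num M) (R : num M -> num M -> Prop) :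
  rec (fun e => R (e 0%nat) (e 1%nat)) ->
  (forall x y, y = f x <-> R x y) -> recfun1 f.
Proof.
  intros HR H; eapply rec_ext; [|exact (rec_rename (1 .: O .: fun i => i) _ HR)].
  intros e; cbv beta; cbn [scons]; rewrite <- H; reflexivity.
Qed.

(** Unbounded search. The least witness has a Delta01 graph, since minimality adds only a bounded
    quantifier. Most sequences and functions below arise in this way. *)
Lemma rec_choice (R : num M -> num M -> Prop) :
  rec (fun e => R (e 0%nat) (e 1%nat)) -> (forall x, exists y, R x y) ->
  exists f, recfun1 f /\ forall x, R x (f x).
Proof.
  intros HR H.
  set (Q := fun x y => R x y /\ forall z, (z < y)%num -> ~ R x z).
  assert (HQ : forall x, exists y, Q x y).
  { intros x; destruct (H x) as [y0 Hy0].
    apply (sig1_least (R x) y0); [|exact Hy0].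
    apply sig1_rec, (rec_app2 R (fun _ => x) (fun e => e 0%nat)); auto;
      [apply recf_const | apply recf_var]. }
  set (f := fun x => proj1_sig (constructive_indefinite_description _ (HQ x))).
  assert (Hf : forall x, Q x (f x)).
  { intros x; unfold f; destruct (constructive_indefinite_description _ _); assumption. }
  exists f; split; [|intros x; apply Hf].
  apply (recf_graph f Q).
  - apply rec_and; [exact HR|].
    apply (rec_forall_lt (fun z e => ~ R (e 0%nat) z) (fun e => e 1%nat));
      [|apply recf_var].
    apply rec_not, (rec_app2 R (fun e => e 1%nat) (fun e => e 0%nat) HR); apply recf_var.
  - intros x y; split; [intros ->; apply Hf|].
    intros [H1 H2]; destruct (Hf x) as [H3 H4].
    destruct (num_lt_trichotomy M y (f x)) as [Hl|[Hl|Hl]]; [|exact Hl|].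
    + destruct (H4 y Hl H1).
    + destruct (H2 _ Hl H3).
Qed.

(** * Pairs *)

Definition m_pair (a b : num M) : num M := ((a + b) * (a + b) + a)%num.

(** As [a] is at most [a + b], the square of [a + b] plus [a] stays below the next square. So a pair
    determines the sum of its components, and then the components. *)
Lemma m_pair_lt a b a' b' : (a + b < a' + b')%num -> (m_pair a b < m_pair a' b')%num.
Proof.
  unfold m_pair; intros H; apply num_lt_exists in H; destruct H as [z H].
  rewrite H; apply num_lt_exists.
  exists (z * z + z + z + (a + b) * z + (a + b) * z + a + b + b + a')%num; ring.
Qed.

Lemma m_pair_inj a b a' b' : m_pair a b = m_pair a' b' -> a = a' /\ b = b'.
Proof.
  intros H; destruct (num_lt_trichotomy M (a + b)%num (a' + b')%num) as [Hl|[Hl|Hl]].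
  - apply m_pair_lt in Hl; rewrite H in Hl; destruct (num_lt_irrefl M _ Hl).
  - unfold m_pair in H; rewrite Hl in H.
    assert (Ha : a = a').
    { apply (num_addI M _ _ ((a' + b') * (a' + b'))%num).
      rewrite !(num_addC M _ (_ * _)%num); exact H. }
    split; [exact Ha|]; subst a'.
    apply (num_addI M _ _ a); rewrite !(num_addC M _ a); exact Hl.
  - apply m_pair_lt in Hl; rewrite H in Hl; destruct (num_lt_irrefl M _ Hl).
Qed.

Lemma m_le_add x y : m_le x (x + y)%num.
Proof.
  destruct (num_zero_or_succ M y) as [->|[z ->]]; [right; ring | left].
  apply num_lt_exists; exists z; ring.
Qed.

Lemma m_pair_fst a b : m_le a (m_pair a b).
Proof. unfold m_pair; rewrite num_addC; apply m_le_add. Qed.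

Lemma m_pair_snd a b : m_le b (m_pair a b).
Proof.
  unfold m_pair; destruct (num_zero_or_succ M b) as [->|[z ->]].
  - assert (H := m_le_add 0%num ((a + 0) * (a + 0) + a)%num).
    rewrite num_add0r in H; exact H.
  - replace ((a + (z + 1)) * (a + (z + 1)) + a)%num
      with ((z + 1) + (z * z + z + a * (a + z + 1 + z + 1) + a))%num by ring.
    apply m_le_add.
Qed.

Lemma m_le_fst z a b : z = m_pair a b -> m_le a z.
Proof. intros ->; apply m_pair_fst. Qed.

Lemma m_le_snd z a b : z = m_pair a b -> m_le b z.
Proof. intros ->; apply m_pair_snd. Qed.

Lemma recf_pair s t : recf s -> recf t -> recf (fun e => m_pair (s e) (t e)).
Proof.
  intros Hs Ht; unfold m_pair.
  repeat first [assumption | apply recf_add | apply recf_mul].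
Qed.

(* Numbers that are not pairs have both components [0]. *)
Definition is_fst (z a : num M) : Prop :=
  (exists b, m_le b z /\ z = m_pair a b) \/
  (a = 0%num /\ forall x, m_le x z -> forall y, m_le y z -> z <> m_pair x y).

Definition is_snd (z b : num M) : Prop :=
  (exists a, m_le a z /\ z = m_pair a b) \/
  (b = 0%num /\ forall x, m_le x z -> forall y, m_le y z -> z <> m_pair x y).

Definition m_fst (z : num M) : num M := epsilon (inhabits 0%num) (is_fst z).
Definition m_snd (z : num M) : num M := epsilon (inhabits 0%num) (is_snd z).

Lemma is_fst_pair a b : is_fst (m_pair a b) a.
Proof. left; exists b; split; [apply m_pair_snd | reflexivity]. Qed.

Lemma is_snd_pair a b : is_snd (m_pair a b) b.
Proof. left; exists a; split; [apply m_pair_fst | reflexivity]. Qed.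

Lemma is_fst_spec z a : a = m_fst z <-> is_fst z a.
Proof.
  assert (Hex : exists a, is_fst z a).
  { destruct (classic (exists x y, z = m_pair x y)) as [[x [y ->]]|H].
    - exists x; apply is_fst_pair.
    - exists 0%num; right; split; [reflexivity|]; intros x _ y _ E; apply H; eauto. }
  assert (Hf := epsilon_spec (inhabits 0%num) (is_fst z) Hex); fold (m_fst z) in Hf.
  split; [intros ->; exact Hf|].
  destruct Hf as [[b [Hb E]]|[-> H]]; intros [[b' [Hb' E']]|[-> H']].
  - rewrite E in E'; apply m_pair_inj in E'; symmetry; apply E'.
  - exfalso; exact (H' _ (m_le_fst _ _ _ E) b Hb E).
  - exfalso; exact (H _ (m_le_fst _ _ _ E') b' Hb' E').
  - reflexivity.
Qed.

Lemma is_snd_spec z a : a = m_snd z <-> is_snd z a.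
Proof.
  assert (Hex : exists a, is_snd z a).
  { destruct (classic (exists x y, z = m_pair x y)) as [[x [y ->]]|H].
    - exists y; apply is_snd_pair.
    - exists 0%num; right; split; [reflexivity|]; intros x _ y _ E; apply H; eauto. }
  assert (Hf := epsilon_spec (inhabits 0%num) (is_snd z) Hex); fold (m_snd z) in Hf.
  split; [intros ->; exact Hf|].
  destruct Hf as [[b [Hb E]]|[-> H]]; intros [[b' [Hb' E']]|[-> H']].
  - rewrite E in E'; apply m_pair_inj in E'; symmetry; apply E'.
  - exfalso; exact (H' b Hb _ (m_le_snd _ _ _ E) E).
  - exfalso; exact (H b' Hb' _ (m_le_snd _ _ _ E') E').
  - reflexivity.
Qed.

Lemma m_fst_pair a b : m_fst (m_pair a b) = a.
Proof. symmetry; apply is_fst_spec, is_fst_pair. Qed.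

Lemma m_snd_pair a b : m_snd (m_pair a b) = b.
Proof. symmetry; apply is_snd_spec, is_snd_pair. Qed.

Lemma recfun1_fst : recfun1 m_fst.
Proof.
  apply (recf_graph m_fst is_fst); [|intros; apply is_fst_spec].
  apply rec_or.
  - apply (rec_exists_le (fun b e => e 0%nat = m_pair (e 1%nat) b) (fun e => e 0%nat)).
    + apply rec_eq; [|apply recf_pair]; apply recf_var.
    + apply recf_var.
  - apply rec_and; [apply rec_eq; [apply recf_var | apply recf_const]|].
    apply (rec_forall_le (fun x e => forall y, m_le y (e 0%nat) -> e 0%nat <> m_pair x y)
      (fun e => e 0%nat)); [|apply recf_var].
    apply (rec_forall_le (fun y e => e 1%nat <> m_pair (e 0%nat) y) (fun e => e 1%nat));
      [|apply recf_var].
    apply rec_not, rec_eq; [|apply recf_pair]; apply recf_var.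
Qed.

Lemma recfun1_snd : recfun1 m_snd.
Proof.
  apply (recf_graph m_snd is_snd); [|intros; apply is_snd_spec].
  apply rec_or.
  - apply (rec_exists_le (fun b e => e 0%nat = m_pair b (e 1%nat)) (fun e => e 0%nat)).
    + apply rec_eq; [|apply recf_pair]; apply recf_var.
    + apply recf_var.
  - apply rec_and; [apply rec_eq; [apply recf_var | apply recf_const]|].
    apply (rec_forall_le (fun x e => forall y, m_le y (e 0%nat) -> e 0%nat <> m_pair x y)
      (fun e => e 0%nat)); [|apply recf_var].
    apply (rec_forall_le (fun y e => e 1%nat <> m_pair (e 0%nat) y) (fun e => e 1%nat));
      [|apply recf_var].
    apply rec_not, rec_eq; [|apply recf_pair]; apply recf_var.
Qed.

End Definability.

(** * Fractions over a model and their quotient *)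

Section Fractions.

Variable M : rca0_model.

Local Open Scope num_scope.
Local Notation "0" := (m_zero M) : num_scope.
Local Notation "1" := (m_one M) : num_scope.
Local Notation "x + y" := (m_add M x y) : num_scope.
Local Notation "x * y" := (m_mul M x y) : num_scope.
Local Notation "x < y" := (m_lt M x y) : num_scope.

Add Ring num_ring : (num_semiring M).

(* Stands for (fnum - fneg) / (fden + 1): no denominator can vanish. *)
Record frac : Type := Frac { fnum : num M; fneg : num M; fden : num M }.

Definition feq (x y : frac) : Prop :=
  fnum x * (fden y + 1) + fneg y * (fden x + 1) =
  fnum y * (fden x + 1) + fneg x * (fden y + 1).

Definition fadd (x y : frac) : frac :=
  Frac (fnum x * (fden y + 1) + fnum y * (fden x + 1))
       (fneg x * (fden y + 1) + fneg y * (fden x + 1))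
       (fden x * fden y + fden x + fden y).
Definition fmul (x y : frac) : frac :=
  Frac (fnum x * fnum y + fneg x * fneg y) (fnum x * fneg y + fneg x * fnum y)
       (fden x * fden y + fden x + fden y).
Definition fopp (x : frac) : frac := Frac (fneg x) (fnum x) (fden x).
Definition fzero : frac := Frac 0 0 0.
Definition fone : frac := Frac 1 0 0.
Definition fnonneg (x : frac) : Prop := fneg x < fnum x \/ fneg x = fnum x.

Lemma feq_refl x : feq x x.
Proof. reflexivity. Qed.

Lemma feq_sym x y : feq x y -> feq y x.
Proof. unfold feq; intros ->; reflexivity. Qed.

Lemma feq_trans x y z : feq x y -> feq y z -> feq x z.
Proof.
  destruct x as [a b c], y as [a' b' c'], z as [a'' b'' c'']; unfold feq; simpl.
  intros H1 H2; apply (num_mulI M _ _ c').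
  (* Numbers cannot be subtracted: terms with the middle fraction are added on both sides, so that
     both hypotheses can be rewritten as they stand. *)
  apply (num_addI M _ _ (b' * (c + 1) * (c'' + 1) + a' * (c'' + 1) * (c + 1))).
  transitivity ((a * (c' + 1) + b' * (c + 1)) * (c'' + 1) +
                (a' * (c'' + 1) + b'' * (c' + 1)) * (c + 1)); [ring|].
  rewrite H1, H2; ring.
Qed.

Lemma fadd_feq x x' y : feq x x' -> feq (fadd x y) (fadd x' y).
Proof.
  destruct x as [a b c], x' as [a' b' c'], y as [u v w]; unfold feq; simpl; intros H.
  transitivity ((a * (c' + 1) + b' * (c + 1)) * ((w + 1) * (w + 1)) +
    (u + v) * (c + 1) * (c' + 1) * (w + 1)); [ring|].
  rewrite H; ring.
Qed.

Lemma fmul_feq x x' y : feq x x' -> feq (fmul x y) (fmul x' y).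
Proof.
  destruct x as [a b c], x' as [a' b' c'], y as [u v w]; unfold feq; simpl; intros H.
  transitivity ((a * (c' + 1) + b' * (c + 1)) * (w + 1) * u +
    (a' * (c + 1) + b * (c' + 1)) * (w + 1) * v); [ring|].
  rewrite H; rewrite <- H at 2; ring.
Qed.

Lemma fopp_feq x x' : feq x x' -> feq (fopp x) (fopp x').
Proof.
  destruct x as [a b c], x' as [a' b' c']; unfold feq; simpl; intros H.
  transitivity (a' * (c + 1) + b * (c' + 1)); [ring|]; rewrite <- H; ring.
Qed.

Lemma fnonneg_feq x x' : feq x x' -> fnonneg x -> fnonneg x'.
Proof.
  destruct x as [a b c], x' as [a' b' c']; unfold feq, fnonneg; simpl; intros H.
  intros [Hn|Hn]; [left | right].
  - apply (num_lt_mulE M _ _ c), (num_lt_add M _ _ (b * (c' + 1))).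
    rewrite <- H, (num_addC M (b' * (c + 1))).
    apply num_lt_add, num_lt_mul, Hn.
  - subst b; apply (num_mulI M _ _ c), (num_addI M _ _ (a * (c' + 1))).
    rewrite <- H; ring.
Qed.

Lemma fnonneg_add x y : fnonneg x -> fnonneg y -> fnonneg (fadd x y).
Proof.
  destruct x as [a b c], y as [u v w]; unfold fnonneg; simpl.
  rewrite !num_lt_exists; intros [[s ->]| ->] [[t ->]| ->]; [left|left|left|right; ring].
  - exists (s * (w + 1) + w + t * (c + 1) + c + 1); ring.
  - exists (s * (w + 1) + w); ring.
  - exists (t * (c + 1) + c); ring.
Qed.

Lemma fnonneg_mul x y : fnonneg x -> fnonneg y -> fnonneg (fmul x y).
Proof.
  destruct x as [a b c], y as [u v w]; unfold fnonneg; simpl.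
  rewrite !num_lt_exists; intros [[s ->]| ->] [[t ->]| ->];
    [left|right; ring|right; ring|right; ring].
  exists (s * t + s + t); ring.
Qed.

Lemma fnonneg_anti x : fnonneg x -> fnonneg (fopp x) -> feq x fzero.
Proof.
  destruct x as [a b c]; unfold fnonneg, feq; simpl; intros [H| ->]; [|intros; ring].
  intros [H'| ->]; [|ring]; destruct (num_lt_irrefl M _ (num_lt_trans M _ _ _ H H')).
Qed.

Lemma fnonneg_total x : fnonneg x \/ fnonneg (fopp x).
Proof.
  destruct x as [a b c]; unfold fnonneg; simpl.
  destruct (num_lt_trichotomy M a b) as [H|[H|H]]; auto.
Qed.

Lemma feq_fzero x : feq x fzero <-> fnum x = fneg x.
Proof.
  destruct x as [a b c]; unfold feq; simpl; split; intros H; [|rewrite H; ring].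
  replace a with (a * (0 + 1) + 0 * (c + 1)) by ring; rewrite H; ring.
Qed.

Lemma finv x : ~ feq x fzero -> exists y, feq (fmul y x) fone.
Proof.
  rewrite feq_fzero; destruct x as [a b c]; simpl; intros H.
  destruct (num_lt_trichotomy M a b) as [Hl|[Hl|Hl]]; [|contradiction|];
    apply num_lt_exists in Hl; destruct Hl as [z ->].
  - exists (Frac 0 (c + 1) z); unfold feq; simpl; ring.
  - exists (Frac (c + 1) 0 z); unfold feq; simpl; ring.
Qed.

(** * The quotient *)

Definition frepr (x : frac) : frac := epsilon (inhabits fzero) (feq x).

Lemma frepr_feq x : feq x (frepr x).
Proof. apply (epsilon_spec (inhabits fzero) (feq x)); exists x; apply feq_refl. Qed.

Lemma frepr_eq x y : frepr x = frepr y <-> feq x y.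
Proof.
  split; intros H.
  - eapply feq_trans; [apply frepr_feq|]; rewrite H; apply feq_sym, frepr_feq.
  - unfold frepr; f_equal; extensionality u; apply propositional_extensionality.
    split; apply feq_trans; [apply feq_sym|]; exact H.
Qed.

Definition ratio : Type := {x : frac | frepr x = x}.

Definition cls (x : frac) : ratio :=
  exist _ (frepr x) (proj2 (frepr_eq _ _) (feq_sym _ _ (frepr_feq x))).

Definition rep (x : ratio) : frac := proj1_sig x.

Lemma cls_eq x y : cls x = cls y <-> feq x y.
Proof.
  rewrite <- frepr_eq; split; [intros H; exact (f_equal (@proj1_sig _ _) H)|].
  intros H; apply subset_eq_compat, H.
Qed.

Lemma cls_rep x : cls (rep x) = x.
Proof. destruct x as [t Ht]; apply subset_eq_compat; exact Ht. Qed.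

Definition radd (x y : ratio) : ratio := cls (fadd (rep x) (rep y)).
Definition rmul (x y : ratio) : ratio := cls (fmul (rep x) (rep y)).
Definition ropp (x : ratio) : ratio := cls (fopp (rep x)).
Definition rnonneg (x : ratio) : Prop := fnonneg (rep x).

Lemma rep_cls x : feq (rep (cls x)) x.
Proof. apply feq_sym, frepr_feq. Qed.

Lemma fadd_comm x y : feq (fadd x y) (fadd y x).
Proof. unfold feq; simpl; ring. Qed.

Lemma fmul_comm x y : feq (fmul x y) (fmul y x).
Proof. unfold feq; simpl; ring. Qed.

Lemma cls_add x y : radd (cls x) (cls y) = cls (fadd x y).
Proof.
  apply cls_eq; eapply feq_trans; [apply fadd_feq, rep_cls|].
  eapply feq_trans; [apply fadd_comm|]; eapply feq_trans; [apply fadd_feq, rep_cls|].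
  apply fadd_comm.
Qed.

Lemma cls_mul x y : rmul (cls x) (cls y) = cls (fmul x y).
Proof.
  apply cls_eq; eapply feq_trans; [apply fmul_feq, rep_cls|].
  eapply feq_trans; [apply fmul_comm|]; eapply feq_trans; [apply fmul_feq, rep_cls|].
  apply fmul_comm.
Qed.

Lemma cls_opp x : ropp (cls x) = cls (fopp x).
Proof. apply cls_eq, fopp_feq, rep_cls. Qed.

Lemma cls_nonneg x : rnonneg (cls x) <-> fnonneg x.
Proof. split; apply fnonneg_feq; [|apply feq_sym]; apply rep_cls. Qed.

Lemma ratio_ind (P : ratio -> Prop) : (forall x, P (cls x)) -> forall x, P x.
Proof. intros H x; rewrite <- cls_rep; apply H. Qed.

Ltac ratio_law :=
  repeat (refine (ratio_ind _ _); intro);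
  rewrite ?cls_opp, ?cls_add, ?cls_mul, ?cls_add, ?cls_mul, ?cls_add;
  apply cls_eq; unfold feq; simpl; ring.

Lemma radd_assoc : forall x y z, radd x (radd y z) = radd (radd x y) z.
Proof. ratio_law. Qed.
Lemma radd_comm : forall x y, radd x y = radd y x.
Proof. ratio_law. Qed.
Lemma radd_zero : forall x, radd (cls fzero) x = x.
Proof. ratio_law. Qed.
Lemma radd_opp : forall x, radd (ropp x) x = cls fzero.
Proof. ratio_law. Qed.
Lemma rmul_assoc : forall x y z, rmul x (rmul y z) = rmul (rmul x y) z.
Proof. ratio_law. Qed.
Lemma rmul_comm : forall x y, rmul x y = rmul y x.
Proof. ratio_law. Qed.
Lemma rmul_one : forall x, rmul (cls fone) x = x.
Proof. ratio_law. Qed.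
Lemma rmul_add : forall x y z, rmul (radd x y) z = radd (rmul x z) (rmul y z).
Proof. ratio_law. Qed.

Lemma rone_neq_zero : cls fone <> cls fzero.
Proof.
  rewrite cls_eq, feq_fzero; simpl; intros H.
  apply (succ_neq_zero M 0); rewrite num_add0r; exact H.
Qed.

Lemma rinv_exists x : x <> cls fzero -> exists y, rmul y x = cls fone.
Proof.
  revert x; refine (ratio_ind _ _); intros x Hx.
  destruct (finv x) as [y Hy]; [rewrite <- cls_eq; exact Hx|].
  exists (cls y); rewrite cls_mul; apply cls_eq, Hy.
Qed.

Lemma rnonneg_add : forall x y, rnonneg x -> rnonneg y -> rnonneg (radd x y).
Proof.
  refine (ratio_ind _ _); intros x; refine (ratio_ind _ _); intros y.
  rewrite cls_add, !cls_nonneg; apply fnonneg_add.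
Qed.

Lemma rnonneg_mul : forall x y, rnonneg x -> rnonneg y -> rnonneg (rmul x y).
Proof.
  refine (ratio_ind _ _); intros x; refine (ratio_ind _ _); intros y.
  rewrite cls_mul, !cls_nonneg; apply fnonneg_mul.
Qed.

Lemma rnonneg_anti : forall x, rnonneg x -> rnonneg (ropp x) -> x = cls fzero.
Proof.
  refine (ratio_ind _ _); intros x; rewrite cls_opp, !cls_nonneg, cls_eq.
  apply fnonneg_anti.
Qed.

Lemma rnonneg_total : forall x, rnonneg x \/ rnonneg (ropp x).
Proof.
  refine (ratio_ind _ _); intros x; rewrite cls_opp, !cls_nonneg; apply fnonneg_total.
Qed.

Definition rof (a : num M) : ratio := cls (Frac a 0 0).

Lemma rof_add a b : rof (a + b) = radd (rof a) (rof b).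
Proof. unfold rof; rewrite cls_add; apply cls_eq; unfold feq; simpl; ring. Qed.

Lemma rof_mul a b : rof (a * b) = rmul (rof a) (rof b).
Proof. unfold rof; rewrite cls_mul; apply cls_eq; unfold feq; simpl; ring. Qed.

Lemma rof_nonneg a b : rnonneg (radd (rof b) (ropp (rof a))) <-> a < b \/ a = b.
Proof.
  unfold rof; rewrite cls_opp, cls_add, cls_nonneg; unfold fnonneg; simpl.
  replace (0 * (0 + 1) + a * (0 + 1)) with a by ring.
  replace (b * (0 + 1) + 0 * (0 + 1)) with b by ring; reflexivity.
Qed.

Lemma ratio_surj x : exists a b c,
  rmul x (rof (c + 1)) = radd (rof a) (ropp (rof b)).
Proof.
  revert x; refine (ratio_ind _ _); intros [a b c]; exists a, b, c.
  unfold rof; rewrite cls_opp, cls_add, cls_mul; apply cls_eq; unfold feq; simpl; ring.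
Qed.

End Fractions.

End Arithmetic.

(** * The ordered field of rationals of a model *)

Module OrderedField.
Import structures.
Import all_boot all_order all_algebra boolp.
Import -(notations) Completeness Arithmetic.
Set Implicit Arguments.
Unset Strict Implicit.
Unset Printing Implicit Defensive.
Import Order.TTheory GRing.Theory Num.Theory.
Local Open Scope ring_scope.

Definition fieldM (M : rca0_model) : Type := ratio M.

HB.instance Definition _ (M : rca0_model) := gen_eqMixin (fieldM M).
HB.instance Definition _ (M : rca0_model) := gen_choiceMixin (fieldM M).

HB.instance Definition _ (M : rca0_model) :=
  GRing.isZmodule.Build (fieldM M)
    (@radd_assoc M) (@radd_comm M) (@radd_zero M) (@radd_opp M).

Fact fieldM_one_neq0 (M : rca0_model) : (cls M (fone M) : fieldM M) != 0.
Proof. by apply/eqP; apply: rone_neq_zero. Qed.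

HB.instance Definition _ (M : rca0_model) :=
  GRing.Zmodule_isComNzRing.Build (fieldM M)
    (@rmul_assoc M) (@rmul_comm M) (@rmul_one M) (@rmul_add M) (@fieldM_one_neq0 M).

Fact fieldM_inv_exists (M : rca0_model) (x : fieldM M) :
  exists y : fieldM M, (x != 0 -> y * x = 1) /\ (x = 0 -> y = 0).
Proof.
case: (eqVneq x 0) => [x0|xn0].
  by exists 0; split.
have [y yx1] := @rinv_exists M x (elimN eqP xn0).
by exists y; split => // x0; rewrite x0 eqxx in xn0.
Qed.

Definition fieldM_inv (M : rca0_model) (x : fieldM M) : fieldM M :=
  projT1 (cid (fieldM_inv_exists x)).

Fact fieldM_mulVf (M : rca0_model) (x : fieldM M) : x != 0 -> fieldM_inv x * x = 1.
Proof. by rewrite /fieldM_inv; case: cid => y []. Qed.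

Fact fieldM_invr0 (M : rca0_model) : fieldM_inv 0 = 0 :> fieldM M.
Proof. exact: (projT2 (cid (fieldM_inv_exists (0 : fieldM M)))).2. Qed.

HB.instance Definition _ (M : rca0_model) :=
  GRing.ComNzRing_isField.Build (fieldM M) (@fieldM_mulVf M) (@fieldM_invr0 M).

Definition fieldM_le (M : rca0_model) : rel (fieldM M) := fun x y => `[< rnonneg M (y - x) >].
Definition fieldM_norm (M : rca0_model) (x : fieldM M) : fieldM M :=
  if fieldM_le 0 x then x else - x.

Section Order.
Variable M : rca0_model.
Implicit Types x y : fieldM M.

Fact fieldM_le0_add x y : fieldM_le 0 x -> fieldM_le 0 y -> fieldM_le 0 (x + y).
Proof.
by rewrite /fieldM_le !subr0 => /asboolP x0 /asboolP y0; apply/asboolP/rnonneg_add.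
Qed.

Fact fieldM_le0_mul x y : fieldM_le 0 x -> fieldM_le 0 y -> fieldM_le 0 (x * y).
Proof.
by rewrite /fieldM_le !subr0 => /asboolP x0 /asboolP y0; apply/asboolP/rnonneg_mul.
Qed.

Fact fieldM_le0_anti x : fieldM_le 0 x -> fieldM_le x 0 -> x = 0.
Proof.
by rewrite /fieldM_le subr0 sub0r => /asboolP x0 /asboolP y0; apply: rnonneg_anti.
Qed.

Fact fieldM_sub_ge0 x y : fieldM_le 0 (y - x) = fieldM_le x y.
Proof. by rewrite /fieldM_le subr0. Qed.

Fact fieldM_le0_total x : fieldM_le 0 x || fieldM_le x 0.
Proof.
rewrite /fieldM_le subr0 sub0r.
by case: (@rnonneg_total M x) => ?; apply/orP; [left|right]; apply/asboolP.
Qed.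

Fact fieldM_normN x : fieldM_norm (- x) = fieldM_norm x.
Proof.
rewrite /fieldM_norm; have [x0|x0] := boolP (fieldM_le 0 x);
  have [y0|y0] := boolP (fieldM_le 0 (- x)); rewrite ?opprK //.
  by rewrite (@fieldM_le0_anti x) ?oppr0 // -fieldM_sub_ge0 sub0r.
by have := fieldM_le0_total x; rewrite (negbTE x0) -fieldM_sub_ge0 sub0r (negbTE y0).
Qed.

Fact fieldM_ge0_norm x : fieldM_le 0 x -> fieldM_norm x = x.
Proof. by rewrite /fieldM_norm => ->. Qed.

End Order.

HB.instance Definition _ (M : rca0_model) :=
  Num.IntegralDomain_isLeReal.Build (fieldM M)
    (@fieldM_le0_add M) (@fieldM_le0_mul M) (@fieldM_le0_anti M) (@fieldM_sub_ge0 M)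
    (@fieldM_le0_total M) (@fieldM_normN M) (@fieldM_ge0_norm M) (fun _ _ => erefl).

Definition fieldM_of (M : rca0_model) (a : num M) : fieldM M := rof M a.

Fact fieldM_ofD (M : rca0_model) a b :
  fieldM_of (m_add M a b) = fieldM_of a + fieldM_of b .
Proof. exact: rof_add. Qed.

Fact fieldM_ofM (M : rca0_model) a b :
  fieldM_of (m_mul M a b) = fieldM_of a * fieldM_of b .
Proof. exact: rof_mul. Qed.

Fact fieldM_of_le (M : rca0_model) a b :
  (m_lt M a b \/ a = b) <-> fieldM_of a <= fieldM_of b.
Proof.
rewrite -(rof_nonneg M a b); split=> [ab|/asboolP//].
exact/asboolP.
Qed.

Fact fieldM_surj (M : rca0_model) (x : fieldM M) : exists a b c,
  x * (fieldM_of c + 1) = fieldM_of a - fieldM_of b.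
Proof.
have [a [b [c abc]]] := @ratio_surj M x; exists a, b, c.
by rewrite -[RHS]abc rof_add.
Qed.

(* An ordered field of fractions of the differences of numbers of [M]. *)
Record rat_field (M : rca0_model) := RatField {
  rat_sort :> realFieldType;
  inj : num M -> rat_sort;
  inj0 : inj (m_zero M) = 0;
  inj1 : inj (m_one M) = 1;
  injD : forall a b, inj (m_add M a b) = inj a + inj b;
  injM : forall a b, inj (m_mul M a b) = inj a * inj b;
  inj_le : forall a b, (m_lt M a b \/ a = b) <-> inj a <= inj b;
  rat_surj : forall x, exists a b c, x * (inj c + 1) = inj a - inj b }.

Definition fieldM_rat_field (M : rca0_model) : rat_field M :=
  @RatField M (fieldM M) (@fieldM_of M) erefl erefl
    (@fieldM_ofD M) (@fieldM_ofM M) (@fieldM_of_le M) (@fieldM_surj M).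

End OrderedField.

(** * Lowest terms, codes of rationals and recursive rational functions *)

Module Rationals.
Import all_boot all_order all_algebra boolp ring lra.
Import -(notations) Defs Completeness Arithmetic OrderedField.
Set Implicit Arguments.
Unset Strict Implicit.
Unset Printing Implicit Defensive.
Import Order.TTheory GRing.Theory Num.Theory.
Local Open Scope ring_scope.

Section Rationals.
Variables (M : rca0_model) (F : rat_field M).
Local Notation N := (num M).
Local Notation ι := (@inj M F).
Local Notation add := (m_add M).
Local Notation mul := (m_mul M).
Local Notation zero := (m_zero M).
Local Notation one := (m_one M).

Lemma inj_ge0 a : 0 <= ι a.
Proof.
rewrite -(inj0 F); apply/inj_le.
case: (num_zero_or_succ M a) => [->|[z ->]]; [by right | left].
by apply/num_lt_exists; exists z; rewrite num_add0r.
Qed.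

Lemma m_ltP a b : m_lt M a b <-> ι a < ι b.
Proof.
split=> [ab|].
  rewrite ltNge; apply/negP => /(inj_le F) [ba|ba].
    exact: (num_lt_irrefl M a (num_lt_trans M _ _ _ ab ba)).
  by move: ab; rewrite ba; apply: num_lt_irrefl.
case: (num_lt_trichotomy M a b) => [//|[->|ba]]; first by rewrite ltxx.
by rewrite ltNge => /negP[]; apply/inj_le; left.
Qed.

Lemma m_leP a b : m_le M a b <-> ι a <= ι b.
Proof. exact: inj_le. Qed.

Lemma inj_inj a b : ι a = ι b -> a = b.
Proof.
case: (num_lt_trichotomy M a b) => [/m_ltP ab|[//|/m_ltP ab]] eab;
  by rewrite eab ltxx in ab.
Qed.

Lemma inj_succ_le a b : ι a < ι b -> ι a + 1 <= ι b.
Proof.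
move/m_ltP/num_lt_exists => [z ->].
by rewrite !injD inj1; have := inj_ge0 z; lra.
Qed.

Lemma inj_gt0 a : a <> zero <-> 0 < ι a.
Proof.
rewrite -(inj0 F) -m_ltP; case: (num_zero_or_succ M a) => [->|[z ->]].
  by split=> // /num_lt_irrefl.
split=> _; last exact: succ_neq_zero.
by apply/num_lt_exists; exists z; rewrite num_add0r.
Qed.

Lemma inj_neq0 a : a <> zero -> ι a != 0.
Proof. by move/inj_gt0/lt0r_neq0. Qed.

(** Archimedean relative to the possibly nonstandard numbers of the model: the fraction (a - b) / (c
    + 1) is below a + 1. *)
Lemma archimedean (x : F) : exists n, x < ι n.
Proof.
have [a [b [c abc]]] := rat_surj x; exists (add a one).
rewrite injD inj1 ltNge; apply/negP => ax.
have := inj_ge0 a; have := inj_ge0 b; have := inj_ge0 c.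
by nra.
Qed.

Definition ratio_of (a b c : N) : F := (ι a - ι b) / ι c.

Lemma ratio_of_eq a b c a' b' c' : c <> zero -> c' <> zero ->
  add (mul a c') (mul b' c) = add (mul a' c) (mul b c') <->
  ratio_of a b c = ratio_of a' b' c'.
Proof.
move=> /inj_neq0 c0 /inj_neq0 c'0; rewrite /ratio_of; split.
  move/(congr1 ι); rewrite !injD !injM => e.
  by apply/eqP; rewrite eqr_div //; apply/eqP; lra.
move/eqP; rewrite eqr_div // => /eqP e.
by apply: inj_inj; rewrite !injD !injM; lra.
Qed.

Lemma ratio_of_lt a b c a' b' c' : c <> zero -> c' <> zero ->
  m_lt M (add (mul a c') (mul b' c)) (add (mul a' c) (mul b c')) <->
  ratio_of a b c < ratio_of a' b' c'.
Proof.
move=> /inj_gt0 c0 /inj_gt0 c'0; rewrite m_ltP /ratio_of !injD !injM.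
rewrite ltr_pdivrMr // mulrAC ltr_pdivlMr //.
by split; lra.
Qed.

Definition lowest_terms (a b c : N) : Prop :=
  c <> zero /\ (a = zero \/ b = zero) /\
  forall a' b' c', c' <> zero ->
    add (mul a' c) (mul b c') = add (mul a c') (mul b' c) -> m_le M c c'.

(** The denominators of [x] form a Sigma01 class, so there is a least one. Subtracting the smaller
    of the two parts of the numerator from both then makes one of them zero. *)
Lemma lowest_terms_exist (x : F) :
  exists a b c, lowest_terms a b c /\ ratio_of a b c = x.
Proof.
have [a0 [b0 [c0 abc]]] := rat_surj x.
have c1 : add c0 one <> zero by apply: succ_neq_zero.
have xE : x = ratio_of a0 b0 (add c0 one).
  by rewrite /ratio_of -abc injD inj1 mulfK // -inj1 -injD; apply: inj_neq0.
pose P c := c <> zero /\ exists a b,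
  add (mul a (add c0 one)) (mul b0 c) = add (mul a0 c) (mul b (add c0 one)).
have [||c [[cn0 [a [b abE]]] cmin]] := @sig1_least M P (add c0 one).
- apply: sig1_and.
    by apply/sig1_rec/rec_not/rec_eq; [apply: recf_var | apply: recf_const].
  apply: (@sig1_exists M (fun a e => exists b,
    add (mul a (add c0 one)) (mul b0 (e 0)) =
    add (mul a0 (e 0)) (mul b (add c0 one)))).
  apply: (@sig1_exists M (fun b e =>
    add (mul (e 0) (add c0 one)) (mul b0 (e 1)) =
    add (mul a0 (e 1)) (mul b (add c0 one)))).
  apply/sig1_rec/rec_eq; repeat first [apply: recf_var | apply: recf_const |
    apply: recf_add | apply: recf_mul].
- by split=> //; exists a0, b0; congr (add _ _); rewrite num_mulC.
have abx : ratio_of a b c = x by rewrite xE; apply/ratio_of_eq.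
have cmin' a' b' c' : c' <> zero -> ratio_of a' b' c' = x -> m_le M c c'.
  move=> c'0 abx'; case: (m_le_or_lt M c c') => // /cmin [].
  by split=> //; exists a', b'; apply/ratio_of_eq; rewrite // abx'.
suff [a' [b' [z abx']]] : exists a' b',
    (a' = zero \/ b' = zero) /\ ratio_of a' b' c = x.
  exists a', b', c; split=> //; split=> //; split=> // a'' b'' c'' c''0.
  by move=> /ratio_of_eq - /(_ c''0) - /(_ cn0) E; apply: (cmin' a'' b''); rewrite // E.
case: (num_lt_trichotomy M a b) => [/num_lt_exists[z bE]|[ab|/num_lt_exists[z aE]]].
- exists zero, (add z one); split; first by left.
  by rewrite -abx bE /ratio_of !injD inj0; congr (_ / _); ring.
- exists zero, zero; split; first by left.
  by rewrite -abx ab /ratio_of !subrr.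
exists (add z one), zero; split; first by right.
by rewrite -abx aE /ratio_of !injD inj0; congr (_ / _); ring.
Qed.

Lemma lowest_terms_uniq a b c a' b' c' :
  lowest_terms a b c -> lowest_terms a' b' c' -> ratio_of a b c = ratio_of a' b' c' ->
  [/\ a = a', b = b' & c = c'].
Proof.
move=> [c0 [ab cmin]] [c'0 [ab' cmin']] E.
have cc' : c = c'.
  apply: inj_inj; apply/eqP; rewrite eq_le; apply/andP; split; apply/m_leP.
    by apply: (cmin a' b') => //; apply/ratio_of_eq.
  by apply: (cmin' a b) => //; apply/ratio_of_eq.
rewrite -cc' in E *; move: E => /(congr1 ( *%R^~ (ι c))).
rewrite /ratio_of !divfK ?inj_neq0 // => E.
have := inj_ge0 a; have := inj_ge0 b; have := inj_ge0 a'; have := inj_ge0 b'.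
move=> ? ? ? ?; split=> //; apply: inj_inj;
  move: ab ab' E => [|] -> [|] ->; rewrite inj0; lra.
Qed.

Definition terms (x : F) : N * N * N :=
  let: exist a Ha := cid (lowest_terms_exist x) in
  let: exist b Hb := cid Ha in
  let: exist c _ := cid Hb in (a, b, c).

Definition qnum x := (terms x).1.1.
Definition qneg x := (terms x).1.2.
Definition qden x := (terms x).2.

Lemma terms_spec x :
  lowest_terms (qnum x) (qneg x) (qden x) /\ ratio_of (qnum x) (qneg x) (qden x) = x.
Proof.
by rewrite /qnum /qneg /qden /terms; case: cid => a Ha; case: cid => b Hb; case: cid.
Qed.

Lemma qden_neq0 x : qden x <> zero.
Proof. by case: (terms_spec x) => [[]]. Qed.

Lemma terms_ratio_of a b c : lowest_terms a b c ->
  [/\ qnum (ratio_of a b c) = a, qneg (ratio_of a b c) = b & qden (ratio_of a b c) = c].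
Proof.
move=> abc; have [abc' E] := terms_spec (ratio_of a b c).
exact: lowest_terms_uniq abc' abc E.
Qed.

Definition mkcode (a b c : N) : N := m_pair M (m_pair M a b) c.
Definition code (x : F) : N := mkcode (qnum x) (qneg x) (qden x).

Lemma code_inj : injective code.
Proof.
move=> x y /m_pair_inj[/m_pair_inj[E1 E2] E3].
have [_ <-] := terms_spec x; have [_ <-] := terms_spec y.
by rewrite E1 E2 E3.
Qed.

Definition num_of z := m_fst M (m_fst M z).
Definition neg_of z := m_snd M (m_fst M z).
Definition den_of z := m_snd M z.

Lemma num_of_code x : num_of (code x) = qnum x.
Proof. by rewrite /num_of !m_fst_pair. Qed.
Lemma neg_of_code x : neg_of (code x) = qneg x.
Proof. by rewrite /neg_of m_fst_pair m_snd_pair. Qed.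
Lemma den_of_code x : den_of (code x) = qden x.
Proof. by rewrite /den_of m_snd_pair. Qed.

Definition is_code (z : N) : Prop :=
  z = mkcode (num_of z) (neg_of z) (den_of z) /\
  lowest_terms (num_of z) (neg_of z) (den_of z).

Lemma is_codeP z : is_code z <-> exists x, z = code x.
Proof.
split=> [[E L]|[x ->]].
  exists (ratio_of (num_of z) (neg_of z) (den_of z)).
  by rewrite /code; have [-> -> ->] := terms_ratio_of L.
rewrite /is_code num_of_code neg_of_code den_of_code; split=> //.
by case: (terms_spec x).
Qed.

End Rationals.

(** The rule is selected by the shape of the predicate, one connective or function symbol at a time;
    hypotheses [recfun1] and [recfun2] extend it to functions obtained by search. *)
Ltac rec_step :=
  cbv beta delta [Arithmetic.tail];
  lazymatch goal with
  | |- Arithmetic.recf _ (fun e => e ?i) => exact: recf_var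
  | |- Arithmetic.recf _ (fun _ => ?c) => exact: recf_const
  | H : Arithmetic.recf _ ?t |- Arithmetic.recf _ ?t => exact: H
  | |- Arithmetic.recf _ (fun e => m_add _ _ _) => apply: recf_add
  | |- Arithmetic.recf _ (fun e => m_mul _ _ _) => apply: recf_mul
  | |- Arithmetic.recf _ (fun e => m_pair _ _ _) => apply: recf_pair
  | |- Arithmetic.recf _ (fun e => m_fst _ _) => apply: (recf_app1 _ _ _ (recfun1_fst _))
  | |- Arithmetic.recf _ (fun e => m_snd _ _) => apply: (recf_app1 _ _ _ (recfun1_snd _))
  | H : Arithmetic.recfun1 _ ?f |- Arithmetic.recf _ (fun e => ?f _) => apply: (recf_app1 _ f _ H)
  | H : Arithmetic.recfun2 _ ?f |- Arithmetic.recf _ (fun e => ?f _ _) => apply: (recf_app2 _ f _ _ H)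
  | |- Arithmetic.rec _ (fun _ => ?c) => exact: rec_const
  | H : Arithmetic.rec _ ?P |- Arithmetic.rec _ ?P => exact: H
  | |- Arithmetic.rec _ (fun e => _ /\ _) => apply: rec_and
  | |- Arithmetic.rec _ (fun e => _ \/ _) => apply: rec_or
  | |- Arithmetic.rec _ (fun e => ~ _) => apply: rec_not
  | |- Arithmetic.rec _ (fun e => _ <-> _) => apply: rec_iff
  | |- Arithmetic.rec _ (fun e => m_lt _ _ _) => apply: rec_lt
  | |- Arithmetic.rec _ (fun e => m_le _ _ _) => apply: rec_le
  | |- Arithmetic.rec _ (fun e => m_mem _ _ _) => apply: rec_mem
  | |- Arithmetic.rec _ (fun e => @eq (num _) _ _) => apply: rec_eq
  | |- Arithmetic.rec _ (fun e => exists x, m_le _ x _ /\ _) => apply: rec_exists_le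
  | |- Arithmetic.rec _ (fun e => exists x, m_lt _ x _ /\ _) => apply: rec_exists_lt
  | |- Arithmetic.rec _ (fun e => forall x, m_le _ x _ -> _) => apply: rec_forall_le
  | |- Arithmetic.rec _ (fun e => forall x, m_lt _ x _ -> _) => apply: rec_forall_lt
  | |- Arithmetic.rec _ (fun e => _ -> _) => apply: rec_imp
  end.
Ltac rec_tac := repeat rec_step.

Section RecursiveRationals.
Variables (M : rca0_model) (F : rat_field M).
Local Notation N := (num M).
Local Notation ι := (@inj M F).
Local Notation add := (m_add M).
Local Notation mul := (m_mul M).
Local Notation zero := (m_zero M).
Local Notation one := (m_one M).
Local Notation rec := (Arithmetic.rec M).
Local Notation recf := (Arithmetic.recf M).
Local Notation env := (nat -> N).

(** Bounding the quantifiers makes the predicate recursive. A rival fraction with smaller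
    denominator can be taken to have a zero part as well; as the values agree, its other part is
    then at most that of the given fraction. *)
Lemma lowest_terms_bounded (a b c : N) : lowest_terms a b c <->
  c <> zero /\ (a = zero \/ b = zero) /\
  forall c', m_lt M c' c -> c' <> zero -> forall a', m_le M a' a ->
  forall b', m_le M b' b ->
  add (mul a' c) (mul b c') <> add (mul a c') (mul b' c).
Proof.
split=> [[c0 [ab cmin]]|[c0 [ab cmin]]].
  split=> //; split=> // c' c'c c'0 a' _ b' _ /cmin -/(_ c'0).
  by move/m_ltP: c'c => /(_ F) c'c /m_leP -/(_ F); lra.
split=> //; split=> // a' b' c' c'0 E.
case: (m_le_or_lt M c c') => // c'c; exfalso.
move/m_ltP: (c'c) => /(_ F) c'ltc.
have cgt0 := (inj_gt0 F c).1 c0; have c'gt0 := (inj_gt0 F c').1 c'0.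
have := congr1 ι E; rewrite !injD !injM => EK.
have a0 := inj_ge0 F a; have b0 := inj_ge0 F b.
case: (num_lt_trichotomy M a' b') => [/num_lt_exists[z bE]|[aE|/num_lt_exists[z aE]]].
- move: EK; rewrite bE !injD inj1 => EK; have z0 := inj_ge0 F z.
  have aZ : a = zero.
    case: ab => // bZ; exfalso; move: EK; rewrite bZ inj0; nra.
  apply: (cmin c' c'c c'0 zero _ (add z one)).
  + by apply/(m_leP F); rewrite inj0.
  + apply/(m_leP F); rewrite injD inj1.
    move: EK; rewrite aZ inj0; nra.
  + apply: (@inj_inj M F); rewrite !injD !injM !injD inj1 inj0.
    by move: EK; rewrite aZ inj0; lra.
- apply: (cmin c' c'c c'0 zero _ zero).
  + by apply/(m_leP F); rewrite inj0.
  + by apply/(m_leP F); rewrite inj0.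
  + by apply: (@inj_inj M F); rewrite !injD !injM inj0; move: EK; rewrite aE; lra.
move: EK; rewrite aE !injD inj1 => EK; have z0 := inj_ge0 F z.
have bZ : b = zero.
  case: ab => // aZ; exfalso; move: EK; rewrite aZ inj0; nra.
apply: (cmin c' c'c c'0 (add z one) _ zero).
+ apply/(m_leP F); rewrite injD inj1.
  move: EK; rewrite bZ inj0; nra.
+ by apply/(m_leP F); rewrite inj0.
+ apply: (@inj_inj M F); rewrite !injD !injM !injD inj1 inj0.
  by move: EK; rewrite bZ inj0; lra.
Qed.

Lemma rec_lowest_terms (s t u : env -> N) : recf s -> recf t -> recf u ->
  rec (fun e => lowest_terms (s e) (t e) (u e)).
Proof.
move=> Hs Ht Hu.
have H : rec (fun e => lowest_terms (e 0) (e 1) (e 2)).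
  apply: rec_ext => [e|]; first by apply: iff_sym; exact: lowest_terms_bounded.
  by rec_tac.
apply: (rec_app _ (fun x e => lowest_terms x (t e) (u e)) s) => //.
cbv beta.
apply: (rec_app _ (fun y e => lowest_terms (e 0) y (u (Arithmetic.tail M e)))
  (fun e => t (Arithmetic.tail M e))); last exact: recf_weaken.
cbv beta.
apply: (rec_app _ (fun z e => lowest_terms (e 1) (e 0) z)
  (fun e => u (Arithmetic.tail M (Arithmetic.tail M e)))).
  exact: (rec_rename _ (fun i => match i with O => 2 | S O => 1 | _ => O end)%N _ H).
exact: (recf_weaken _ (fun e => u (Arithmetic.tail M e)) (recf_weaken _ u Hu)).
Qed.

Lemma recf_num_of s : recf s -> recf (fun e => num_of (s e)).
Proof. by move=> Hs; rewrite /num_of; rec_tac. Qed.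

Lemma recf_neg_of s : recf s -> recf (fun e => neg_of (s e)).
Proof. by move=> Hs; rewrite /neg_of; rec_tac. Qed.

Lemma recf_den_of s : recf s -> recf (fun e => den_of (s e)).
Proof. by move=> Hs; rewrite /den_of; rec_tac. Qed.

Lemma rec_is_code s : recf s -> rec (fun e => is_code (s e)).
Proof.
move=> Hs; have H1 := recf_num_of Hs; have H2 := recf_neg_of Hs.
have H3 := recf_den_of Hs; apply: rec_and; last exact: rec_lowest_terms.
by rewrite /mkcode; rec_tac.
Qed.

Definition recq (u : env -> F) : Prop := recf (fun e => code (u e)).

Lemma recf_num u : recq u -> recf (fun e => qnum (u e)).
Proof.
move=> Hu; have := recf_num_of Hu.
by under [X in recf X]funext do rewrite num_of_code.
Qed.

Lemma recf_neg u : recq u -> recf (fun e => qneg (u e)).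
Proof.
move=> Hu; have := recf_neg_of Hu.
by under [X in recf X]funext do rewrite neg_of_code.
Qed.

Lemma recf_den u : recq u -> recf (fun e => qden (u e)).
Proof.
move=> Hu; have := recf_den_of Hu.
by under [X in recf X]funext do rewrite den_of_code.
Qed.

Lemma recq_const x : recq (fun _ => x).
Proof. exact: recf_const. Qed.

Lemma qratio (x : F) : x = ratio_of F (qnum x) (qneg x) (qden x).
Proof. by case: (terms_spec x) => _ ->. Qed.

Lemma rec_qlt u v : recq u -> recq v -> rec (fun e => u e < v e).
Proof.
move=> Hu Hv; apply: rec_ext => [e|].
  rewrite [u e]qratio [v e]qratio; apply: ratio_of_lt; exact: qden_neq0.
have H1 := recf_num Hu; have H2 := recf_neg Hu; have H3 := recf_den Hu.
have H4 := recf_num Hv; have H5 := recf_neg Hv; have H6 := recf_den Hv.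
by rec_tac.
Qed.

Lemma rec_qeq u v : recq u -> recq v -> rec (fun e => u e = v e).
Proof.
move=> Hu Hv; apply: rec_ext => [e|]; last exact: (rec_eq _ _ _ Hu Hv).
by split=> [/code_inj|->].
Qed.

Lemma rec_qle u v : recq u -> recq v -> rec (fun e => u e <= v e).
Proof.
move=> Hu Hv; apply: rec_ext => [e|]; last exact: (rec_not _ _ (rec_qlt Hv Hu)).
by rewrite leNgt; split=> /negP.
Qed.

(** No algorithm for reduction to lowest terms is involved: the code of the value is the one code
    whose fraction equals [n - g] over [d] by cross multiplication, and this is a recursive
    condition. *)
Lemma recq_ratio (u : env -> F) n g d : recf n -> recf g -> recf d ->
  (forall e, d e <> zero) -> (forall e, u e = ratio_of F (n e) (g e) (d e)) -> recq u.
Proof.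
move=> Hn Hg Hd d0 uE.
apply: (rec_ext _ (fun e => is_code (e 0%N) /\
  add (mul (num_of (e 0%N)) (d (Arithmetic.tail M e))) (mul (g (Arithmetic.tail M e)) (den_of (e 0%N))) =
  add (mul (n (Arithmetic.tail M e)) (den_of (e 0%N))) (mul (neg_of (e 0%N)) (d (Arithmetic.tail M e)))))
  => [e|].
  split=> [[/is_codeP-/(_ F)[x ->]]|->].
    rewrite num_of_code neg_of_code den_of_code.
    move/ratio_of_eq => /(_ F (@qden_neq0 _ _ _) (d0 _)).
    by rewrite -qratio => ->; rewrite uE.
  split; first by apply/is_codeP; exists (u (Arithmetic.tail M e)).
  rewrite num_of_code neg_of_code den_of_code.
  by apply/(ratio_of_eq F) => //; [exact: qden_neq0 | rewrite -qratio uE].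
have Hn' := recf_weaken _ _ Hn; have Hg' := recf_weaken _ _ Hg.
have Hd' := recf_weaken _ _ Hd; have H0 := recf_var M 0.
have H1 := recf_num_of H0; have H2 := recf_neg_of H0; have H3 := recf_den_of H0.
apply: rec_and; first exact: rec_is_code.
by apply: rec_eq; apply: recf_add; apply: recf_mul.
Qed.

Lemma recq_add u v : recq u -> recq v -> recq (fun e => u e + v e).
Proof.
move=> Hu Hv.
have H1 := recf_num Hu; have H2 := recf_neg Hu; have H3 := recf_den Hu.
have H4 := recf_num Hv; have H5 := recf_neg Hv; have H6 := recf_den Hv.
apply: (recq_ratio
  (n := fun e => add (mul (qnum (u e)) (qden (v e))) (mul (qnum (v e)) (qden (u e))))
  (g := fun e => add (mul (qneg (u e)) (qden (v e))) (mul (qneg (v e)) (qden (u e))))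
  (d := fun e => mul (qden (u e)) (qden (v e)))); [by rec_tac|by rec_tac|by rec_tac| |].
  move=> e; apply/(inj_gt0 F); rewrite injM.
  by apply: mulr_gt0; apply/(inj_gt0 F); exact: qden_neq0.
move=> e; rewrite {1}[u e]qratio {1}[v e]qratio /ratio_of !injD !injM.
have := inj_neq0 F (@qden_neq0 _ _ (u e)); have := inj_neq0 F (@qden_neq0 _ _ (v e)).
by move=> ? ?; field; apply/andP.
Qed.

Lemma recq_mul u v : recq u -> recq v -> recq (fun e => u e * v e).
Proof.
move=> Hu Hv.
have H1 := recf_num Hu; have H2 := recf_neg Hu; have H3 := recf_den Hu.
have H4 := recf_num Hv; have H5 := recf_neg Hv; have H6 := recf_den Hv.
apply: (recq_ratio
  (n := fun e => add (mul (qnum (u e)) (qnum (v e))) (mul (qneg (u e)) (qneg (v e))))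
  (g := fun e => add (mul (qnum (u e)) (qneg (v e))) (mul (qneg (u e)) (qnum (v e))))
  (d := fun e => mul (qden (u e)) (qden (v e)))); [by rec_tac|by rec_tac|by rec_tac| |].
  move=> e; apply/(inj_gt0 F); rewrite injM.
  by apply: mulr_gt0; apply/(inj_gt0 F); exact: qden_neq0.
move=> e; rewrite {1}[u e]qratio {1}[v e]qratio /ratio_of !injD !injM.
have := inj_neq0 F (@qden_neq0 _ _ (u e)); have := inj_neq0 F (@qden_neq0 _ _ (v e)).
by move=> ? ?; field; apply/andP.
Qed.

Lemma recq_opp u : recq u -> recq (fun e => - u e).
Proof.
move=> Hu.
have H1 := recf_num Hu; have H2 := recf_neg Hu; have H3 := recf_den Hu.
apply: (recq_ratio H2 H1 H3) => e; first exact: qden_neq0.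
by rewrite {1}[u e]qratio /ratio_of -mulNr opprB.
Qed.

Lemma recq_inj t : recf t -> recq (fun e => ι (t e)).
Proof.
move=> Ht; apply: (recq_ratio Ht (recf_const _ zero) (recf_const _ one)) => e.
  by apply/(inj_gt0 F); rewrite inj1.
by rewrite /ratio_of inj0 inj1 subr0 divr1.
Qed.

(** Reciprocals of successors have no exceptional denominator, which is why tolerances in the
    recursive relations below are written with [ι k + 1]. *)
Lemma recq_invS t : recf t -> recq (fun e => (ι (t e) + 1)^-1).
Proof.
move=> Ht.
apply: (recq_ratio (d := fun e => add (t e) one) (recf_const _ one) (recf_const _ zero)).
- by rec_tac.
- by move=> e; apply: succ_neq_zero.
by move=> e; rewrite /ratio_of injD inj0 inj1 subr0 mul1r.
Qed.

Lemma recf_if (b : env -> bool) s t : rec (fun e => b e) -> recf s -> recf t ->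
  recf (fun e => if b e then s e else t e).
Proof.
move=> Hb Hs Ht.
have Hb' := rec_rename _ S _ Hb; have Hs' := recf_weaken _ _ Hs.
have Ht' := recf_weaken _ _ Ht.
apply: (rec_ext _ (fun e => (b (Arithmetic.tail M e) /\ e 0%N = s (Arithmetic.tail M e)) \/
  (~ b (Arithmetic.tail M e) /\ e 0%N = t (Arithmetic.tail M e)))) => [e|].
  by case: (b _); split=> [[[]|[]]|] //; [left|right].
apply: rec_or; apply: rec_and.
- exact: Hb'.
- by apply: rec_eq => //; exact: recf_var.
- exact: (rec_not _ _ Hb').
- by apply: rec_eq => //; exact: recf_var.
Qed.

Lemma recq_if (b : env -> bool) u v : rec (fun e => b e) -> recq u -> recq v ->
  recq (fun e => if b e then u e else v e).
Proof.
move=> Hb Hu Hv; have := recf_if Hb Hu Hv.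
by congr recf; apply: funext => e; case: (b e).
Qed.

Lemma recq_max u v : recq u -> recq v -> recq (fun e => Num.max (u e) (v e)).
Proof.
move=> Hu Hv; apply: (recq_if (b := fun e => u e < v e)) => //; exact: rec_qlt.
Qed.

Lemma recq_norm u : recq u -> recq (fun e => `|u e|).
Proof.
move=> Hu; have := recq_max Hu (recq_opp Hu).
congr recq; apply: funext => e; rewrite /Num.max.
by case: ltrP => h; [rewrite ltr0_norm | rewrite ger0_norm]; lra.
Qed.

(** Total, so that searches for rationals and families indexed by rationals can run over all
    numbers. Numbers that are not codes also get a value, with a zero denominator replaced by
    one. *)
Definition decode (z : N) : F :=
  let c := den_of z in
  ratio_of F (num_of z) (neg_of z) (if `[< c = zero >] then one else c).

Lemma codeK : cancel (@code M F) decode.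
Proof.
move=> x; rewrite /decode num_of_code neg_of_code den_of_code.
by case: asboolP => [/qden_neq0//|_]; rewrite -qratio.
Qed.

Lemma recq_decode t : recf t -> recq (fun e => decode (t e)).
Proof.
move=> Ht; have H1 := recf_num_of Ht; have H2 := recf_neg_of Ht.
have H3 := recf_den_of Ht.
apply: (recq_ratio H1 H2 (d := fun e => if `[< den_of (t e) = zero >]
   then one else den_of (t e))) => // [|e].
  apply: (recf_if (b := fun e => `[< _ >])); [|exact: recf_const|exact: H3].
  apply: (rec_ext _ (fun e => den_of (t e) = zero)) => [e|].
    exact: (rwP (asboolP _)).
  by apply: rec_eq => //; exact: recf_const.
by case: asboolP => // _; apply/(inj_gt0 F); rewrite inj1.
Qed.

End RecursiveRationals.

End Rationals.

(** * The principles inside a model, and strict inequality of reals *)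

Module Analysis.
Import all_boot all_order all_algebra boolp ring lra.
Import -(notations) Completeness Arithmetic OrderedField Rationals.
Set Implicit Arguments.
Unset Strict Implicit.
Unset Printing Implicit Defensive.
Import Order.TTheory GRing.Theory Num.Theory.
Local Open Scope ring_scope.

Section Analysis.
Variables (M : rca0_model) (F : rat_field M).
Local Notation N := (num M).
Local Notation ι := (@inj M F).
Local Notation add := (m_add M).
Local Notation mul := (m_mul M).
Local Notation zero := (m_zero M).
Local Notation one := (m_one M).
Local Notation rec := (Arithmetic.rec M).
Local Notation recf := (Arithmetic.recf M).
Local Notation recfun1 := (Arithmetic.recfun1 M).
Local Notation env := (nat -> N).

Definition recseq (x : N -> F) : Prop := recq (fun e => x (e 0%N)).
(** Closure under substitution of recursive arguments expresses recursiveness without coding the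
    pair of arguments. These are the maps represented by sets of the model, by [function_graph_map]
    and [map_function_graph]. *)
Definition recmap (f : F -> N -> F) : Prop :=
  forall (u : env -> F) t, recq u -> recf t -> recq (fun e => f (u e) (t e)).

Lemma recq_app x t : recseq x -> recf t -> recq (fun e => x (t e)).
Proof. exact: (recf_app1 M (fun n => code (x n))). Qed.

Definition bounded_class (A : N -> Prop) : Prop := exists b, forall n, A n -> ι n < ι b.

(** Families of sets become recursive relations. The double negation is what [diff] of a [compl]
    unfolds to. *)
Definition cohesive : Prop :=
  forall R : N -> N -> Prop, rec (fun e => R (e 0%N) (e 1%N)) ->
  exists C : N -> Prop, rec (fun e => C (e 0%N)) /\ ~ bounded_class C /\
    forall i, bounded_class (fun n => C n /\ ~ R i n) \/
              bounded_class (fun n => C n /\ ~ ~ R i n).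

Definition pigeonhole : Prop :=
  forall (b : N) c, recfun1 c -> (forall n, ι (c n) <= ι b) ->
  exists n, ι n <= ι b /\ ~ bounded_class (fun i => c i = n).

Definition cauchy_seq (x : N -> F) : Prop :=
  forall ε : F, 0 < ε -> exists n0, forall m n, ι n0 <= ι m -> ι n0 <= ι n ->
    `|x m - x n| < ε.

Definition le_real (x y : N -> F) : Prop :=
  forall ε : F, 0 < ε -> exists n0, forall n, ι n0 <= ι n -> x n <= y n + ε.
Definition lt_real (x y : N -> F) : Prop :=
  le_real x y /\ ~ (le_real x y /\ le_real y x).
Definition real (x : N -> F) : Prop := recseq x /\ cauchy_seq x.
Definition in_unit (x : N -> F) : Prop :=
  le_real (fun _ => 0) x /\ le_real x (fun _ => 1).
Definition in_ball (n : N) (x : N -> F) (q : F) : Prop :=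
  lt_real (fun i => `|x i - q|) (fun _ => (ι n)^-1).

Definition in_dom (f : F -> N -> F) (x : N -> F) : Prop :=
  forall ε : F, 0 < ε -> exists n, 0 < ι n /\
    forall q r, in_ball n x q -> in_ball n x r ->
    forall i j, ι n <= ι i -> ι n <= ι j -> `|f q i - f r j| < ε.
Definition app (f : F -> N -> F) (x : N -> F) : N -> F := fun i => f (x i) i.

Definition continuous (f : F -> N -> F) : Prop :=
  recmap f /\ forall x, real x -> in_unit x -> in_dom f x.
Definition uniform (f : F -> N -> F) : Prop :=
  forall ε : F, 0 < ε -> exists δ : F, 0 < δ /\
    forall x y, real x -> real y -> in_unit x -> in_unit y ->
    lt_real (fun i => `|x i - y i|) (fun _ => δ) ->
    lt_real (fun i => `|app f x i - app f y i|) (fun _ => ε).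
Definition has_max (f : F -> N -> F) : Prop :=
  exists x, real x /\ in_unit x /\
    forall y, real y -> in_unit y -> le_real (app f y) (app f x).
Definition has_min (f : F -> N -> F) : Prop :=
  exists x, real x /\ in_unit x /\
    forall y, real y -> in_unit y -> le_real (app f x) (app f y).
Definition bounded_map (f : F -> N -> F) : Prop :=
  exists b : F, forall x, real x -> in_unit x ->
    le_real (fun i => `|app f x i|) (fun _ => b).

(* The subsequence need not be increasing: [k <= g k] suffices, which spares a
   primitive recursion wherever a subsequence is selected. *)
Definition bolzano_weierstrass : Prop :=
  forall q, recseq q -> (forall n, 0 <= q n <= 1) ->
  exists g, recfun1 g /\ (forall k, ι k <= ι (g k)) /\ cauchy_seq (fun k => q (g k)).

Lemma inv_lt (ε k : F) : 0 < ε -> ε^-1 < k -> 0 < k /\ k^-1 < ε.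
Proof.
move=> e0 ek; have k0 : 0 < k by apply: lt_trans ek; rewrite invr_gt0.
by split=> //; rewrite -[ε]invrK ltf_pV2 ?posrE ?invr_gt0.
Qed.

Lemma floor_exists (t : F) : 0 <= t -> exists j, ι j <= t < ι j + 1.
Proof.
move=> t0; have [b tb] := archimedean t.
have [||j [tj jmin]] := @sig1_least M (fun j => t < ι j) b => //.
  by apply/sig1_rec/rec_qlt; [exact: recq_const | exact/recq_inj/recf_var].
case: (num_zero_or_succ M j) => [jZ|[i iE]].
  by move: tj; rewrite jZ inj0 ltNge t0.
exists i; move: tj; rewrite iE injD inj1 => ->; rewrite andbT leNgt; apply/negP.
by apply: jmin; apply/(m_ltP F); rewrite iE injD inj1; lra.
Qed.

Lemma unbounded_class A : ~ bounded_class A -> forall k, exists n, ι k <= ι n /\ A n.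
Proof.
move=> nA k; apply: contrapT => nk; apply: nA; exists k => n An.
by rewrite ltNge; apply/negP => kn; apply: nk; exists n.
Qed.

(** Here and in the next two lemmas, strict inequality of a real with a rational is exchanged for
    bounds on late entries. Each passage costs a gap between two rationals, which accounts for the
    slack in the estimates below. *)
Lemma lt_real_const x (c d : F) (n0 : N) :
  (forall n, ι n0 <= ι n -> x n <= c) -> c < d -> lt_real x (fun _ => d).
Proof.
move=> xc cd; split=> [ε e0|[_ /(_ ((d - c) / 2))]].
  by exists n0 => n /xc; lra.
case=> [|n1 dx]; first by lra.
have := xc (add n0 n1); have := dx (add n0 n1); rewrite !injD.
have := inj_ge0 F n0; have := inj_ge0 F n1 => h0 h1.
by move=> /(_ ltac:(lra)) h2 /(_ ltac:(lra)); lra.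
Qed.

Lemma not_lt_real_const x (c d : F) : ~ lt_real x (fun _ => d) -> c < d ->
  forall n0, exists n, ι n0 <= ι n /\ c <= x n.
Proof.
move=> nx cd n0; apply: contrapT => H.
apply: nx; apply: (@lt_real_const _ c d n0) => // n nn.
by rewrite leNgt; apply/negP => cx; apply: H; exists n; split=> //; apply: ltW.
Qed.

Lemma lt_real_le x (c d : F) : lt_real x (fun _ => c) -> c < d ->
  exists n0, forall n, ι n0 <= ι n -> x n <= d.
Proof.
move=> [xc _] cd; case: (xc (d - c)) => [|n0 H]; first by rewrite subr_gt0.
by exists n0 => n /H; rewrite addrCA subrr addr0.
Qed.

Lemma in_ball_near x q (n n0 : N) (c : F) :
  (forall i, ι n0 <= ι i -> `|x i - q| <= c) -> c < (ι n)^-1 -> in_ball n x q.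
Proof. exact: lt_real_const. Qed.

End Analysis.

Ltac recq_step :=
  lazymatch goal with
  | |- recseq _ => rewrite /recseq
  | |- recq (fun _ => ?c) => exact: recq_const
  | H : recq ?u |- recq ?u => exact: H
  | H : recseq ?x |- recq (fun e => ?x _) => apply: (recq_app H)
  | H : recmap ?f |- recq (fun e => ?f _ _) => apply: H
  | |- recq (fun e => GRing.add _ _) => apply: recq_add
  | |- recq (fun e => GRing.opp _) => apply: recq_opp
  | |- recq (fun e => (inj _ _ + 1)^-1) => apply: recq_invS
  | |- recq (fun e => GRing.mul _ _) => apply: recq_mul
  | |- recq (fun e => `|_|) => apply: recq_norm
  | |- recq (fun e => Num.max _ _) => apply: recq_max
  | |- recq (fun e => inj _ _) => apply: recq_inj
  | |- recq (fun e => decode _ _) => apply: recq_decode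
  | |- Arithmetic.rec _ (fun e => is_true (_ <= _)) => apply: rec_qle
  | |- Arithmetic.rec _ (fun e => is_true (_ < _)) => apply: rec_qlt
  | |- Arithmetic.rec _ (fun e => @eq (Num.RealField.sort _) _ _) => apply: rec_qeq
  end.
Ltac recs := repeat first [ progress cbv beta delta [Arithmetic.tail] | recq_step | rec_step ].

(** * Cohesiveness and the pigeonhole principle against Bolzano-Weierstrass *)

Section Principles.
Variables (M : rca0_model) (F : rat_field M).
Local Notation N := (num M).
Local Notation ι := (@inj M F).
Local Notation add := (m_add M).
Local Notation mul := (m_mul M).
Local Notation zero := (m_zero M).
Local Notation one := (m_one M).
Local Notation rec := (Arithmetic.rec M).
Local Notation recf := (Arithmetic.recf M).
Local Notation recfun1 := (Arithmetic.recfun1 M).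
Local Notation env := (nat -> N).

Lemma bolzano_of_cohesive : cohesive F -> pigeonhole F -> bolzano_weierstrass F.
Proof.
move=> COH IPP q recqq q01.
(* Indexing by [decode] puts the cuts at all rationals into one family. *)
have [|C [recC [infC cohC]]] := COH (fun i n => q n < decode F i); first by recs.
have infC' := unbounded_class infC.
have [||g [recg gP]] := @rec_choice M (fun k m => ι k <= ι m /\ C m).
- recs; exact: (rec_rename _ (fun _ => 1%N) _ recC).
- by move=> k; have [n] := infC' k; exists n.
exists g; split=> //; split=> [k|ε e0]; first by case: (gP k).
have [K Ke] := archimedean ε^-1; have [K0 Kinv] := inv_lt e0 Ke.
(* [K] exceeds the inverse of [ε], so entries with the same integer part after scaling by [K] differ
   by less than [ε]. Colours are at most [K] because [q] is at most 1. *)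
have [||c [recc cP]] := @rec_choice M
   (fun n j => ι j <= q (g n) * ι K /\ q (g n) * ι K < ι j + 1).
- by recs.
- move=> n; have /andP[q0 _] := q01 (g n).
  have [|j /andP[]] := floor_exists (t := q (g n) * ι K); last by exists j.
  by rewrite mulr_ge0 // inj_ge0.
have [|j [_ infj]] := IPP K c recc.
  by move=> n; have [] := cP n; have := q01 (g n); nra.
have infj' := unbounded_class infj.
(* Cohesiveness puts almost all of [C] on one side of this endpoint. It must be the side of the
   entries of colour [j], as there are unboundedly many of them. The upper endpoint is treated
   alike. *)
have [b1 B1] : exists b, forall m, C m -> ι b <= ι m -> ι j / ι K <= q m.
  case: (cohC (code (ι j / ι K))) => [[b B]|[b B]]; exists b => m Cm bm.
    have [n [bn cn]] := infj' b; have [ng Cg] := gP n; have [+ _] := cP n.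
    rewrite cn -ler_pdivrMr // => jq; suff: ι (g n) < ι b by lra.
    by apply: B; split=> //; rewrite codeK; apply/negP; rewrite -leNgt.
  rewrite leNgt; apply/negP => qm; suff: ι m < ι b by lra.
  by apply: B; split=> //; rewrite codeK; apply.
have [b2 B2] : exists b, forall m, C m -> ι b <= ι m -> q m < (ι j + 1) / ι K.
  case: (cohC (code ((ι j + 1) / ι K))) => [[b B]|[b B]]; exists b => m Cm bm.
    rewrite ltNge; apply/negP => qm; suff: ι m < ι b by lra.
    by apply: B; split=> //; rewrite codeK; apply/negP; rewrite -leNgt.
  have [n [bn cn]] := infj' b; have [ng Cg] := gP n; have [_ +] := cP n.
  rewrite cn -ltr_pdivlMr // => jq; suff: ι (g n) < ι b by lra.
  by apply: B; split=> //; rewrite codeK; apply.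
have b10 := inj_ge0 F b1; have b20 := inj_ge0 F b2.
exists (add b1 b2) => m n; rewrite !injD => bm bn.
have [mg Cm] := gP m; have [ng Cn] := gP n.
have l1 := B1 _ Cm ltac:(lra); have l2 := B2 _ Cm ltac:(lra).
have l3 := B1 _ Cn ltac:(lra); have l4 := B2 _ Cn ltac:(lra).
have E : (ι j + 1) / ι K = ι j / ι K + (ι K)^-1 by rewrite mulrDl mul1r.
by rewrite ltr_norml; lra.
Qed.

(** After scaling, different colours are at least [(ι b + 1)^-1] apart, so a Cauchy sequence of them
    is eventually constant; its colour occurs beyond every bound because [k <= g k]. *)
Lemma pigeonhole_of_bolzano : bolzano_weierstrass F -> pigeonhole F.
Proof.
move=> BW b c recc cb; have b0 := inj_ge0 F b.
have b1 : 0 < (ι b + 1)^-1 by rewrite invr_gt0; lra.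
have [||g [recg [gk cau]]] := BW (fun n => ι (c n) * (ι b + 1)^-1).
- by recs.
- move=> n; have := cb n; have := inj_ge0 F (c n) => c0 cn.
  rewrite mulr_ge0 ?(ltW b1) //= ler_pdivrMr; lra.
have [n0 H] := cau _ b1; exists (c (g n0)); split=> // -[m Hm].
have n00 := inj_ge0 F n0; have m0 := inj_ge0 F m.
suff /Hm : c (g (add n0 m)) = c (g n0) by have := gk (add n0 m); rewrite !injD; lra.
have := H (add n0 m) n0; rewrite injD => /(_ ltac:(lra) ltac:(lra)).
rewrite -mulrBl normrM (gtr0_norm b1) -{2}[(ι b + 1)^-1]mul1r ltr_pM2r //.
rewrite ltr_norml => h; apply: (@inj_inj M F); apply/eqP; rewrite eq_le !leNgt.
by apply/andP; split; apply/negP => /inj_succ_le; lra.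
Qed.

End Principles.

(** * Uniform continuity, extrema and boundedness from Bolzano-Weierstrass *)

Section Extrema.
Variables (M : rca0_model) (F : rat_field M).
Local Notation N := (num M).
Local Notation ι := (@inj M F).
Local Notation add := (m_add M).
Local Notation mul := (m_mul M).
Local Notation zero := (m_zero M).
Local Notation one := (m_one M).
Local Notation rec := (Arithmetic.rec M).
Local Notation recf := (Arithmetic.recf M).
Local Notation recfun1 := (Arithmetic.recfun1 M).
Local Notation env := (nat -> N).


Lemma invS_small (ε : F) : 0 < ε ->
  exists K, forall k, ι K <= ι k -> 0 < (ι k + 1)^-1 < ε.
Proof.
move=> e0; have [K Ke] := archimedean ε^-1; exists K => k Kk.
have [|k0 ke] := @inv_lt M F ε (ι k + 1) e0; first lra.
by rewrite invr_gt0 k0 ke.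
Qed.

Lemma invS_le a b : ι a <= ι b -> (ι b + 1)^-1 <= (ι a + 1)^-1.
Proof.
by have := inj_ge0 F a; move=> a0 ab; rewrite lef_pV2 ?posrE; lra.
Qed.

Lemma in_ball_cauchy x q (n n0 : N) (c : F) :
  0 < ι n -> (forall i, ι n0 <= ι i -> `|x i - q| <= c * (ι n)^-1) -> c < 1 ->
  in_ball n x q.
Proof.
move=> n_gt0 H c1; apply: (in_ball_near H).
by rewrite -[ltRHS]mul1r ltr_pM2r // invr_gt0.
Qed.

(** If no modulus works for [ε], each tolerance has a counterexample made of two rationals and one
    index, which can be searched for. A Cauchy subsequence of the first rationals is a real. The
    second rationals approach it too, so continuity at this real brings the two values closer than
    [ε / 2]. *)
Lemma uniform_of_bolzano : bolzano_weierstrass F ->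
  forall f : F -> N -> F, continuous f -> uniform f.
Proof.
move=> BW f [recf_ dom] ε e0; apply: contrapT => nU.
pose fr_ w := decode F (m_fst M (m_fst M w)).
pose to_ w := decode F (m_snd M (m_fst M w)).
(* Entries of a real in the unit interval may lie slightly outside it, hence the tolerance in the
   range. *)
pose R n w := ι n <= ι (m_snd M w) /\
  (- (ι n + 1)^-1 <= fr_ w /\ fr_ w <= 1 + (ι n + 1)^-1) /\
  `|fr_ w - to_ w| < (ι n + 1)^-1 /\
  ε / 2 <= `|f (fr_ w) (m_snd M w) - f (to_ w) (m_snd M w)|.
have [||g [recg gP]] := @rec_choice M R.
- by rewrite /R /fr_ /to_; recs.
- move=> n; apply: contrapT => nw; apply: nU.
  have n0 := inj_ge0 F n; have d0 : 0 < (ι n + 1)^-1 by rewrite invr_gt0; lra.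
  (* Half the tolerance leaves room for passing from reals to entries; likewise [ε / 2] replaces
     [ε]. *)
  exists ((ι n + 1)^-1 / 2); split=> [|x y rx ry [x0 x1] [y0 y1] xy]; first lra.
  apply: contrapT => /not_lt_real_const /(_ (_ : ε / 2 < ε)) H.
  have [N1 H1] := x0 _ d0; have [N2 H2] := x1 _ d0.
  have [|N3 H3] := lt_real_le (d := (ι n + 1)^-1 * 3 / 4) xy; first lra.
  have [|i [Ni Hi]] := H _ (add (add N1 N2) (add N3 n)); first lra.
  move: Ni; rewrite !injD.
  have := inj_ge0 F N1; have := inj_ge0 F N2; have := inj_ge0 F N3 => a1 a2 a3 Ni.
  apply: nw; exists (m_pair M (m_pair M (code (x i)) (code (y i))) i).
  rewrite /R /fr_ /to_ !m_fst_pair !m_snd_pair !codeK; split; first lra.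
  have l1 := H1 i ltac:(lra); have l2 := H2 i ltac:(lra).
  by have l3 := H3 i ltac:(lra); split; lra.
have gq k : - 1 <= fr_ (g k) <= 2.
  have [_ [H _]] := gP k; have : (ι k + 1)^-1 <= 1.
    by rewrite invf_le1; have := inj_ge0 F k; lra.
  by move: H; lra.
(* The affine map takes the interval from -1 to 2, in which the counterexamples lie, to the unit
   interval. *)
have [||h [rech [hk cau]]] := BW (fun n => (fr_ (g n) + 1) * 3^-1).
- by rewrite /fr_; recs.
- by move=> n; have := gq n; lra.
pose x k := fr_ (g (h k)).
have cx : cauchy_seq x.
  move=> η n0; have [|n1 H] := cau (η / 3); first lra.
  exists n1 => m n n1m n1n; have := H m n n1m n1n.
  by rewrite -/(x _) -/(x _) !ltr_norml; lra.
have [|||n [ngt0 H]] := dom x _ _ (ε / 2).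
- by split=> //; rewrite /x /fr_; recs.
- split=> η /invS_small [K HK]; exists K => k /HK;
    have [_ [+ _]] := gP (h k); have := invS_le (hk k); rewrite -/(x k); lra.
- lra.
have ninv : 0 < (ι n)^-1 by rewrite invr_gt0.
have [|n0 Hn0] := cx ((ι n)^-1 / 4); first lra.
have [|K HK] := @invS_small ((ι n)^-1 / 4); first lra.
pose k := add (add n0 K) n.
have n00 := inj_ge0 F n0; have K0 := inj_ge0 F K; have nn0 := inj_ge0 F n.
have kE : ι k = ι n0 + ι K + ι n by rewrite !injD.
have [h1 [h2 [h3 h4]]] := gP (h k).
have hkk := hk k; have /andP[_ kinv] := HK k ltac:(lra).
have hinv := invS_le hkk.
have near i : ι n0 <= ι i -> `|x i - x k| < (ι n)^-1 / 4.
  by move=> ni; apply: Hn0; lra.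
suff : `|f (x k) (m_snd M (g (h k))) - f (to_ (g (h k))) (m_snd M (g (h k)))| < ε / 2.
  by rewrite -/(x k) in h4; lra.
apply: H; try lra.
  apply: (@in_ball_cauchy x _ n n0 (1 / 4)) => // [i /near|]; last lra.
  by move/ltW; rewrite mulrC mul1r.
(* One quarter of the radius comes from [x] being Cauchy, another from the distance of the two
   rationals. *)
apply: (@in_ball_cauchy x _ n n0 (1 / 2)) => // [i /near|]; last lra.
rewrite -/(x k) in h3; move: h3; rewrite ler_norml !ltr_norml; lra.
Qed.

(** The claim has only bounded quantifiers over a recursive matrix, so induction on [m] applies.
    Together with [rec_choice] this replaces the recursive computation of maxima over ranges that
    may be nonstandard. *)
Lemma argmax (h : N -> F) m : recseq h ->
  exists j, m_le M j m /\ forall j', m_le M j' m -> h j' <= h j.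
Proof.
move=> rech; move: m; apply: sig1_ind.
- by apply: sig1_rec; recs.
- exists zero; split=> [|j' /(m_leP F)]; first exact: m_le_refl.
  rewrite inj0 => j0; suff -> : j' = zero by [].
  by apply: (@inj_inj M F); rewrite inj0; have := inj_ge0 F j'; lra.
move=> m [j [jm jmax]].
have succE j' : m_le M j' (add m one) -> m_le M j' m \/ j' = add m one.
  by case=> [/num_ltS H|->]; [left|right].
have [hj|hj] := leP (h (add m one)) (h j).
  exists j; split=> [|j' /succE[/jmax//|->//]].
  by apply/(m_leP F); rewrite injD inj1; move/(m_leP F): jm; lra.
exists (add m one); split=> [|j' /succE[/jmax|->//]]; first exact: m_le_refl.
by move/le_trans; apply; apply: ltW.
Qed.

(** Continuity at [y] compares its value with that of a nearby point of the grid of index [g k]. The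
    latter is at most the value at the grid maximum [x k], which continuity at [x] compares with the
    value at [x]. *)
Lemma has_max_of_bolzano : bolzano_weierstrass F ->
  forall f : F -> N -> F, continuous f -> has_max f.
Proof.
move=> BW f [recf_ dom].
pose grid n j := ι j * (ι n + 1)^-1.
pose R n j := m_le M j (add n one) /\
  forall j', m_le M j' (add n one) -> f (grid n j') n <= f (grid n j) n.
have [||a [reca aP]] := @rec_choice M R.
- by rewrite /R /grid; recs.
- by move=> n; apply: (@argmax (fun j => f (grid n j) n)); rewrite /grid; recs.
have inv0 n : 0 < (ι n + 1)^-1 by rewrite invr_gt0; have := inj_ge0 F n; lra.
have inv1 n : (ι n + 1) * (ι n + 1)^-1 = 1.
  by rewrite divff // gt_eqF //; have := inj_ge0 F n; lra.
have [||g [recg [gk cau]]] := BW (fun n => grid n (a n)).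
- by rewrite /grid; recs.
- move=> n; have [/(m_leP F) + _] := aP n; rewrite injD inj1 /grid => an.
  by rewrite mulr_ge0 ?inj_ge0 ?(ltW (inv0 _)) //= ler_pdivrMr ?mul1r // -invr_gt0.
pose x k := grid (g k) (a (g k)).
have ux : in_unit x.
  have x01 k : 0 <= x k <= 1.
    have [/(m_leP F) + _] := aP (g k); rewrite injD inj1 /x /grid => an.
    by rewrite mulr_ge0 ?inj_ge0 ?(ltW (inv0 _)) //= ler_pdivrMr ?mul1r // -invr_gt0.
  by split=> η η0; exists zero => k _; have := x01 k; lra.
have rx : real x by split=> //; rewrite /x /grid; recs.
exists x; split=> //; split=> // y [recy cy] [y0 y1] ε e0.
have [|||n1 [n1gt0 H1]] := dom y _ _ (ε / 4); [by [] | by [] | lra |].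
have [|||n2 [n2gt0 H2]] := dom x _ _ (ε / 4); [by [] | by [] | lra |].
have i1 : 0 < (ι n1)^-1 by rewrite invr_gt0.
have i2 : 0 < (ι n2)^-1 by rewrite invr_gt0.
have [|m1 Hm1] := cy ((ι n1)^-1 / 4); first lra.
have [|m2 Hm2] := rx.2 ((ι n2)^-1 / 4); first lra.
have [|m3 Hm3] := y0 ((ι n1)^-1 / 8); first lra.
have [|m4 Hm4] := y1 ((ι n1)^-1 / 8); first lra.
have [|K HK] := @invS_small ((ι n1)^-1 / 4); first lra.
have [[p1 p2] [p3 p4]] := ((inj_ge0 F m1, inj_ge0 F m2), (inj_ge0 F m3, inj_ge0 F m4)).
have [[p5 p6] p7] := ((inj_ge0 F n1, inj_ge0 F n2), inj_ge0 F K).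
pose k := add (add n1 n2) (add (add m1 m2) (add (add m3 m4) K)).
have kE : ι k = ι n1 + ι n2 + (ι m1 + ι m2 + (ι m3 + ι m4 + ι K)) by rewrite !injD.
have yk0 := Hm3 k ltac:(lra); have yk1 := Hm4 k ltac:(lra).
(* The entry [y k] may lie outside the unit interval; [t] is the nearest point inside. *)
have [t [t01 ty]] : exists t : F, 0 <= t <= 1 /\ `|t - y k| <= (ι n1)^-1 / 8.
  have [h|h] := ltrP (y k) 0; first by exists 0; rewrite ler_norml; lra.
  have [h'|h'] := ltrP 1 (y k); first by exists 1; rewrite ler_norml; lra.
  by exists (y k); rewrite ler_norml; lra.
have gk1 : 0 < ι (g k) + 1 by have := inj_ge0 F (g k); lra.
have [|j /andP[jt tj]] := floor_exists (t := t * (ι (g k) + 1)).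
  by apply: mulr_ge0; lra.
have /andP[_ kinv] := HK k ltac:(lra); have ginv := invS_le (gk k).
have [jle st] : ι j <= ι (g k) + 1 /\ `|grid (g k) j - t| <= (ι (g k) + 1)^-1.
  split; first nra.
  have tE : t = t * (ι (g k) + 1) * (ι (g k) + 1)^-1 by rewrite -mulrA inv1 mulr1.
  rewrite /grid {1}tE -mulrBl normrM (gtr0_norm (inv0 _)).
  by rewrite ler_piMl ?(ltW (inv0 _)) // ler_norml; lra.
have near_y i : ι m1 <= ι i -> `|y i - y k| < (ι n1)^-1 / 4.
  by move=> ni; apply: Hm1; lra.
have near_x i : ι m2 <= ι i -> `|x i - x k| < (ι n2)^-1 / 4.
  by move=> ni; apply: Hm2; lra.
exists k => n kn; rewrite /app.
have By i : ι m1 <= ι i -> in_ball n1 y (y i).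
  move=> mi; apply: (@in_ball_cauchy y _ n1 m1 (1 / 2)) => // [i' /near_y|]; last lra.
  by have := near_y i mi; rewrite ler_norml !ltr_norml; lra.
have Bx i : ι m2 <= ι i -> in_ball n2 x (x i).
  move=> mi; apply: (@in_ball_cauchy x _ n2 m2 (1 / 2)) => // [i' /near_x|]; last lra.
  by have := near_x i mi; rewrite ler_norml !ltr_norml; lra.
have Bs : in_ball n1 y (grid (g k) j).
  apply: (@in_ball_cauchy y _ n1 m1 (3 / 4)) => // [i' /near_y|]; last lra.
  by move: ty st; rewrite !ler_norml !ltr_norml; lra.
have gkk := gk k.
(* Both comparisons meet at the index [g k], where [x k] maximises over the grid. Each costs less
   than [ε / 4]. *)
have d1 := H1 _ _ (By n ltac:(lra)) Bs n (g k) ltac:(lra) ltac:(lra).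
have d2 := H2 _ _ (Bx k ltac:(lra)) (Bx n ltac:(lra)) (g k) n ltac:(lra) ltac:(lra).
have d3 : f (grid (g k) j) (g k) <= f (x k) (g k).
  by have [_] := aP (g k); apply; apply/(m_leP F); rewrite injD inj1.
by move: d1 d2; rewrite !ltr_norml; lra.
Qed.

Lemma continuous_opp (f : F -> N -> F) : continuous f -> continuous (fun q i => - f q i).
Proof.
move=> [recf_ dom]; split=> [u t Hu Ht|x rx ux ε e0].
  by apply: recq_opp; apply: recf_.
have [n [n0 H]] := dom x rx ux ε e0; exists n; split=> // q r Bq Br i j ni nj.
by rewrite -opprD normrN; apply: H.
Qed.

Lemma has_min_of_bolzano : bolzano_weierstrass F ->
  forall f : F -> N -> F, continuous f -> has_min f.
Proof.
move=> BW f /continuous_opp/(has_max_of_bolzano BW)[x [rx [ux xmax]]].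
exists x; split=> //; split=> // y ry uy ε e0.
have [n0 H] := xmax y ry uy ε e0; exists n0 => n /H.
by rewrite /app; lra.
Qed.

Lemma app_bounded (f : F -> N -> F) x : cauchy_seq x -> in_dom f x ->
  exists b n0, forall n, ι n0 <= ι n -> `|app f x n| <= b.
Proof.
move=> cx /(_ 1 ltr01)[n [n_gt0 H]].
have ninv : 0 < (ι n)^-1 by rewrite invr_gt0.
have [|n0 Hn0] := cx ((ι n)^-1 / 2); first lra.
have n00 := inj_ge0 F n0; have nn0 := inj_ge0 F n.
pose k := add n n0; have kE : ι k = ι n + ι n0 by rewrite injD.
have B i : ι n0 <= ι i -> in_ball n x (x i).
  move=> ni; apply: (@in_ball_cauchy x _ n n0 (1 / 2)) => // [i' ni'|]; last lra.
  by have := Hn0 i' i ni' ni; lra.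
exists (`|app f x k| + 1), k => i ki; rewrite /app.
have := H _ _ (B i ltac:(lra)) (B k ltac:(lra)) i k ltac:(lra) ltac:(lra).
by have := lerB_normD (f (x i) i) (- f (x k) k); rewrite normrN; lra.
Qed.

(** Continuity at the two extremal points, with tolerance 1, bounds late entries of the extremal
    values by rationals. *)
Lemma bounded_of_extrema (f : F -> N -> F) :
  continuous f -> has_max f -> has_min f -> bounded_map f.
Proof.
move=> [_ dom] [x [rx [ux xmax]]] [y [ry [uy ymin]]].
have [b1 [n1 H1]] := app_bounded rx.2 (dom x rx ux).
have [b2 [n2 H2]] := app_bounded ry.2 (dom y ry uy).
exists (Num.max b1 b2) => z rz uz ε e0.
have [n3 H3] := xmax z rz uz ε e0; have [n4 H4] := ymin z rz uz ε e0.
exists (add (add n1 n2) (add n3 n4)) => n; rewrite !injD => nn.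
have [[p1 p2] [p3 p4]] := ((inj_ge0 F n1, inj_ge0 F n2), (inj_ge0 F n3, inj_ge0 F n4)).
have l1 := H1 n ltac:(lra); have l2 := H2 n ltac:(lra).
have l3 := H3 n ltac:(lra); have l4 := H4 n ltac:(lra).
have : b1 <= Num.max b1 b2 by rewrite le_max lexx.
have : b2 <= Num.max b1 b2 by rewrite le_max lexx orbT.
by move: l1 l2; rewrite !ler_norml; lra.
Qed.

End Extrema.

(** * A continuous function of spikes over a sequence without Cauchy subsequence *)

Section Spikes.
Variables (M : rca0_model) (F : rat_field M).
Local Notation N := (num M).
Local Notation ι := (@inj M F).
Local Notation add := (m_add M).
Local Notation mul := (m_mul M).
Local Notation zero := (m_zero M).
Local Notation one := (m_one M).
Local Notation rec := (Arithmetic.rec M).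
Local Notation recf := (Arithmetic.recf M).
Local Notation recfun1 := (Arithmetic.recfun1 M).
Local Notation env := (nat -> N).


Variable q : N -> F.
Hypothesis rec_q : recseq q.
Hypothesis q_unit : forall n, 0 <= q n <= 1.
Hypothesis no_subsequence :
  ~ exists g, recfun1 g /\ (forall k, ι k <= ι (g k)) /\ cauchy_seq (fun k => q (g k)).

(** Otherwise a search finds, for each [k], some [m] and [j] beyond [k] with [q m] close to [x j];
    these [m] select a subsequence that approaches [x] and so is Cauchy. *)
Lemma separated x : real x ->
  exists k, forall m j, ι k <= ι m -> ι k <= ι j -> (ι k + 1)^-1 <= `|q m - x j|.
Proof.
move=> [recx cx]; apply: contrapT => nsep; apply: no_subsequence.
pose R k w := (ι k <= ι (m_fst M w) /\ ι k <= ι (m_snd M w)) /\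
  `|q (m_fst M w) - x (m_snd M w)| < (ι k + 1)^-1.
have [||w [recw wP]] := @rec_choice M R.
- by rewrite /R; recs.
- move=> k; apply: contrapT => nw; apply: nsep; exists k => m j km kj.
  rewrite leNgt; apply/negP => mj; apply: nw; exists (m_pair M m j).
  by rewrite /R m_fst_pair m_snd_pair.
exists (fun k => m_fst M (w k)); split; first by rewrite /Arithmetic.recfun1; recs.
split=> [k|ε e0]; first by case: (wP k) => [[]].
have [|K HK] := @invS_small M F (ε / 4); first lra.
have [|n0 Hn0] := cx (ε / 4); first lra.
have K0 := inj_ge0 F K; have n00 := inj_ge0 F n0.
exists (add K n0) => m n; rewrite injD => Km Kn.
have [[_ m2] m3] := wP m; have [[_ n2] n3] := wP n.
have /andP[_ m4] := HK m ltac:(lra); have /andP[_ n4] := HK n ltac:(lra).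
have := Hn0 _ _ (_ : ι n0 <= ι (m_snd M (w m))) (_ : ι n0 <= ι (m_snd M (w n))).
move=> /(_ ltac:(lra) ltac:(lra)); move: m3 n3 m4 n4; clear; rewrite !ltr_norml; lra.
Qed.

Definition spike (n : N) (p : F) : F := Num.max 0 (ι n - ι n * ι n * `|p - q n|).

Lemma spike_ge0 n p : 0 <= spike n p.
Proof. by rewrite le_max lexx. Qed.

Lemma spike_top n : spike n (q n) = ι n.
Proof.
rewrite /spike subrr normr0 mulr0 subr0.
by apply/max_idPr; apply: inj_ge0.
Qed.

Lemma spike_lip n p p' : spike n p <= spike n p' + ι n * ι n * `|p - p'|.
Proof.
have h := spike_ge0 n p'; have n0 := inj_ge0 F n.
have c0 : 0 <= ι n * ι n by apply: mulr_ge0.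
have d0 := mulr_ge0 c0 (normr_ge0 (p - p')).
rewrite {1}/spike ge_max; apply/andP; split; first lra.
have : ι n - ι n * ι n * `|p' - q n| <= spike n p' by rewrite le_max lexx orbT.
have tri : `|p' - q n| <= `|p - p'| + `|p - q n|.
  have := ler_normD (p' - p) (p - q n); rewrite (distrC p' p).
  by rewrite (_ : p' - p + (p - q n) = p' - q n) //; ring.
by have := ler_wpM2l c0 tri; rewrite mulrDr; lra.
Qed.

Lemma spike_far n p : 1 <= ι n * `|p - q n| -> spike n p = 0.
Proof.
move=> h; apply/max_idPl; have n0 := inj_ge0 F n.
by rewrite -mulrA; have := ler_wpM2l n0 h; rewrite mulr1; lra.
Qed.

(** A recursive index of a highest spike turns the maximum over [n <= i] into the value of a single
    spike, and so makes it recursive. *)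
Lemma highest_spike_exists : exists a, recfun1 a /\ forall z,
  m_le M (a z) (m_snd M z) /\
  forall j, m_le M j (m_snd M z) ->
    spike j (decode F (m_fst M z)) <= spike (a z) (decode F (m_fst M z)).
Proof.
apply: (@rec_choice M (fun z i => m_le M i (m_snd M z) /\
  forall j, m_le M j (m_snd M z) ->
    spike j (decode F (m_fst M z)) <= spike i (decode F (m_fst M z)))).
  by rewrite /spike; recs.
by move=> z; apply: argmax; rewrite /spike; recs.
Qed.

Definition highest : N -> N := projT1 (cid highest_spike_exists).

Definition peak (p : F) (i : N) : F := spike (highest (m_pair M (code p) i)) p.

Lemma highestP p i : m_le M (highest (m_pair M (code p) i)) i /\
  forall j, m_le M j i -> spike j p <= peak p i.
Proof.
have [_ /(_ (m_pair M (code p) i))] := projT2 (cid highest_spike_exists).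
by rewrite -/highest m_fst_pair m_snd_pair codeK.
Qed.

Lemma peak_ge p i j : ι j <= ι i -> spike j p <= peak p i.
Proof. by move=> /(m_leP F); have [_] := highestP p i; apply. Qed.

Lemma peak_attained p i : exists j, ι j <= ι i /\ peak p i = spike j p.
Proof.
by exists (highest (m_pair M (code p) i)); split=> //; apply/m_leP; case: (highestP p i).
Qed.

Lemma peak_ge0 p i : 0 <= peak p i.
Proof. by apply: le_trans (peak_ge p (lexx (ι i))); apply: spike_ge0. Qed.

Lemma peak_mono p i i' : ι i <= ι i' -> peak p i <= peak p i'.
Proof. by move=> ii'; have [j [ji ->]] := peak_attained p i; apply: peak_ge; lra. Qed.

Lemma recmap_peak : recmap peak.
Proof.
move=> u t Hu Ht; have [Hh _] := projT2 (cid highest_spike_exists).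
have Hc : recf (fun e => code (u e)) by [].
rewrite /peak; have Hh' : recf (fun e => highest (m_pair M (code (u e)) (t e))).
  by apply: (recf_app1 M highest _ Hh); recs.
by rewrite /spike; recs.
Qed.

(** Let spike [m] attain the maximum at [p]. If [m] is at least [c], it vanishes there. Otherwise
    [m] is below [j], so it competes at [p'] as well, and its Lipschitz constant is at most c^2.
    This holds whatever [i] is. *)
Lemma peak_near c n p p' i j (ε : F) :
  (forall m, ι c <= ι m -> 1 <= ι m * `|p - q m|) ->
  ι c <= ι n -> ι n <= ι j -> ι c * ι c * `|p - p'| <= ε ->
  peak p i <= peak p' j + ε.
Proof.
move=> far cn nj near; have [m [mi ->]] := peak_attained p i.
have c0 := inj_ge0 F c; have m0 := inj_ge0 F m.
have e0 : 0 <= ε by apply: le_trans near; apply: mulr_ge0; rewrite ?mulr_ge0.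
have [cm|mc] := lerP (ι c) (ι m).
  by rewrite (spike_far (far m cm)) addr_ge0 ?peak_ge0.
apply: le_trans (spike_lip m p p') _; apply: lerD; first by apply: peak_ge; lra.
apply: le_trans near; rewrite ler_wpM2r //.
by apply: ler_pM => //; apply: ltW.
Qed.

Lemma continuous_peak : continuous peak.
Proof.
split=> [|x rx _ ε e0]; first exact: recmap_peak.
have [k sep] := separated rx; pose η := (ι k + 1)^-1.
have k0 := inj_ge0 F k; have η0 : 0 < η by rewrite invr_gt0; lra.
have [c0 Hc0] := archimedean (2 / η).
(* From [c] on, spikes have radius at most [η / 2], half the separation of [x]. *)
pose c := add k c0; have cE : ι c = ι k + ι c0 by rewrite injD.
have c00 := inj_ge0 F c0.
(* Points in the ball of radius 1/n are within 2/n of late entries of [x], hence within 4/n of each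
   other. The summands place [n] above [c], keep such points at distance [η / 2] from late [q m],
   and bound c^2 times their distance by [ε]; the 1 keeps the last summand positive. *)
have [n Hn] := archimedean (ι c + 4 / η + (4 * (ι c * ι c) + 1) / ε).
have cc0 : 0 <= ι c * ι c by rewrite mulr_ge0 ?inj_ge0.
have h1 : 0 < 4 / η by rewrite divr_gt0.
have h2 : 0 < (4 * (ι c * ι c) + 1) / ε by rewrite divr_gt0 //; lra.
have n_gt0 : 0 < ι n by lra.
have ninv : 0 < (ι n)^-1 by rewrite invr_gt0.
have n1 : 4 * (ι n)^-1 < η.
  by rewrite ltr_pdivrMr // mulrC -ltr_pdivrMr //; lra.
have n2 : 4 * (ι n)^-1 * (ι c * ι c) < ε.
  have h3 : 4 * (ι c * ι c) / ε <= (4 * (ι c * ι c) + 1) / ε.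
    by rewrite ler_pM2r ?invr_gt0 //; lra.
  by rewrite mulrAC ltr_pdivrMr // [ltRHS]mulrC -ltr_pdivrMr //; lra.
exists n; split=> // p p' Bp Bp' i j ni nj.
have nearp p0 : in_ball n x p0 -> exists n0, forall i, ι n0 <= ι i ->
    `|x i - p0| <= 2 * (ι n)^-1.
  by move/lt_real_le; apply; lra.
have [m1 H1] := nearp p Bp; have [m2 H2] := nearp p' Bp'.
have pp' : `|p - p'| <= 4 * (ι n)^-1.
  have := H1 (add m1 m2); have := H2 (add m1 m2); rewrite injD.
  have := inj_ge0 F m1; have := inj_ge0 F m2; move=> a b /(_ ltac:(lra)) + /(_ ltac:(lra)).
  by clear; rewrite !ler_norml; lra.
have far p0 m0 : (forall i, ι m0 <= ι i -> `|x i - p0| <= 2 * (ι n)^-1) ->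
    forall m, ι c <= ι m -> 1 <= ι m * `|p0 - q m|.
  move=> H m cm; have m00 := inj_ge0 F m0.
  have := sep m (add k m0); have := H (add k m0); rewrite injD.
  move=> /(_ ltac:(lra)) + /(_ ltac:(lra) ltac:(lra)); rewrite -/η => a b.
  have d : η / 2 <= `|p0 - q m|.
    have := ler_normD (q m - p0) (p0 - x (add k m0)).
    rewrite (_ : q m - p0 + (p0 - x (add k m0)) = q m - x (add k m0)); last by ring.
    by rewrite (distrC (q m) p0) (distrC p0 (x _)); lra.
  apply: le_trans (_ : _ <= ι m * (η / 2)) _; last by rewrite ler_wpM2l ?inj_ge0.
  have : 2 <= ι c0 * η by rewrite -ler_pdivrMr //; exact: ltW.
  have : ι c0 * η <= ι m * η by rewrite ler_pM2r //; lra.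
  by lra.
have b1 : ι c * ι c * `|p - p'| <= 4 * (ι n)^-1 * (ι c * ι c).
  by rewrite mulrC ler_wpM2r.
have [cn njj nii] : [/\ ι c <= ι n, ι n <= ι j & ι n <= ι i] by split; lra.
have l1 := @peak_near c n p p' i j _ (far p m1 H1) cn njj b1.
rewrite distrC in b1.
have l2 := @peak_near c n p' p j i _ (far p' m2 H2) cn nii b1.
by rewrite ltr_norml; move: l1 l2 n2; clear; lra.
Qed.

Lemma real_const (a : F) : real (fun _ => a).
Proof.
split=> [|ε e0]; first exact: recq_const.
by exists zero => m n _ _; rewrite subrr normr0.
Qed.

Lemma in_unit_const (a : F) : 0 <= a <= 1 -> in_unit (M := M) (fun _ => a).
Proof. by move=> a01; split=> ε e0; exists zero => n _; lra. Qed.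

Lemma peak_at n i : ι n <= ι i -> ι n <= peak (q n) i.
Proof. by move=> ni; rewrite -[leLHS]spike_top; apply: peak_ge. Qed.

Lemma peak_unbounded : ~ bounded_map peak.
Proof.
move=> [b H]; have [n bn] := archimedean (b + 1).
have [|k Hk] := H _ (real_const (q n)) (in_unit_const (q_unit n)) (1 / 2); first lra.
have n0 := inj_ge0 F n; have k0 := inj_ge0 F k.
have := Hk (add k n); rewrite injD => /(_ ltac:(lra)).
have := peak_at (n := n) (i := add k n); rewrite injD => /(_ ltac:(lra)).
by rewrite /app ger0_norm ?peak_ge0 //; lra.
Qed.

Lemma peak_not_uniform : ~ uniform peak.
Proof.
move=> /(_ 1 ltr01)[δ [d0 H]].
have [K Kd] := archimedean δ^-1; have [K0 Kinv] := inv_lt d0 Kd.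
have Kinv0 : 0 < (ι K)^-1 by rewrite invr_gt0.
(* Uniform continuity for 1 bounds late differences by any larger constant, here 2. A later index
   [i'] is harmless because [peak] does not decrease. *)
have step a b i : 0 <= a <= 1 -> 0 <= b <= 1 -> `|a - b| <= (ι K)^-1 ->
    exists i', ι i <= ι i' /\ peak b i <= peak a i' + 2.
  move=> a01 b01 ab.
  have lt1 := H _ _ (real_const a) (real_const b) (in_unit_const a01) (in_unit_const b01).
  have [||n0 Hn0] := lt_real_le (d := 2) (lt1 _).
  - by apply: (@lt_real_const M F _ _ _ zero (fun _ _ => ab)).
  - lra.
  have n00 := inj_ge0 F n0; have i0 := inj_ge0 F i.
  exists (add i n0); rewrite injD; split; first lra.
  have := Hn0 (add i n0); rewrite injD => /(_ ltac:(lra)).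
  have := @peak_mono b i (add i n0); rewrite injD => /(_ ltac:(lra)).
  by rewrite /app ler_norml; lra.
(* Continuity at 0 bounds late entries, and monotonicity then bounds all of them. *)
have [C HC] : exists C : F, forall i, peak 0 i <= C.
  have u0 : 0 <= (0 : F) <= 1 by rewrite lexx ler01.
  have [b [n0 Hb]] := app_bounded (real_const 0).2
    (continuous_peak.2 _ (real_const 0) (in_unit_const u0)).
  exists b => i; have n00 := inj_ge0 F n0; have i0 := inj_ge0 F i.
  have := Hb (add i n0); rewrite injD => /(_ ltac:(lra)).
  have := @peak_mono 0 i (add i n0); rewrite injD => /(_ ltac:(lra)).
  by rewrite /app ler_norml; lra.
have grid01 j : ι j <= ι K -> 0 <= ι j * (ι K)^-1 <= 1.
  by move=> jK; rewrite mulr_ge0 ?inj_ge0 ?(ltW Kinv0) //= ler_pdivrMr // mul1r.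
have grid j i : ι j <= ι K -> peak (ι j * (ι K)^-1) i <= C + 2 * ι j.
  (* Failure of the bound at [j] is Sigma01, so the induction takes the form of a least
     counterexample. *)
  pose P j := ι j <= ι K /\ exists i, C + 2 * ι j < peak (ι j * (ι K)^-1) i.
  move=> jK; rewrite leNgt; apply/negP => ji.
  have [||j0 [[j0K [i0 Hi0]] jmin]] := @sig1_least M P j.
  - rewrite /P; apply: sig1_and; first by apply: sig1_rec; recs.
    apply: (@sig1_exists M (fun i e => C + 2 * ι (e 0%N) < peak (ι (e 0%N) * (ι K)^-1) i)).
    by apply: sig1_rec; have Hp := recmap_peak; recs.
  - by split=> //; exists i.
  case: (num_zero_or_succ M j0) => [jZ|[j1 jE]].
    by move: Hi0; rewrite jZ inj0 mul0r; have := HC i0; lra.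
  have jE' : ι j0 = ι j1 + 1 by rewrite jE injD inj1.
  have [j10 j1K] : ι j1 < ι j0 /\ ι j1 <= ι K by split; lra.
  have [|i1 [_ Hi1]] := step _ _ i0 (grid01 j1 j1K) (grid01 j0 j0K).
    by rewrite -mulrBl jE' opprD addrA subrr sub0r mulN1r normrN gtr0_norm.
  apply: (jmin j1); first exact/(m_ltP F).
  by split=> //; exists i1; lra.
(* The bound at the grid is at most [C + 2 * ι K], and one more step of 2 leads from the grid to
   [q n], where the value is at least [n]. *)
have [n Hn] := archimedean (C + 2 * ι K + 2).
have /andP[q0 q1] := q_unit n.
have [|j /andP[jq qj]] := floor_exists (t := q n * ι K); first by rewrite mulr_ge0 // ltW.
have jK : ι j <= ι K by apply: le_trans jq _; rewrite ler_piMl // ltW.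
have [|i [_ Hi]] := step _ _ n (grid01 j jK) (q_unit n).
  rewrite -[q n](mulfK (lt0r_neq0 K0)) -mulrBl normrM (gtr0_norm Kinv0).
  by rewrite ler_piMl ?(ltW Kinv0) // ler_norml; lra.
have := grid j i jK; have := peak_at (lexx (ι n)); lra.
Qed.

End Spikes.

Lemma bolzano_of_bounded (M : rca0_model) (F : rat_field M) :
  (forall f : F -> num M -> F, continuous f -> bounded_map f) -> bolzano_weierstrass F.
Proof.
move=> H q rec_q q01; apply: contrapT => nog.
by apply: (peak_unbounded (rec_q := rec_q)) => //; apply/H/continuous_peak.
Qed.

Lemma bolzano_of_uniform (M : rca0_model) (F : rat_field M) :
  (forall f : F -> num M -> F, continuous f -> uniform f) -> bolzano_weierstrass F.
Proof.
move=> H q rec_q q01; apply: contrapT => nog.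
by apply: (peak_not_uniform (rec_q := rec_q)) => //; apply/H/continuous_peak.
Qed.

(** * Coding of finite sets, primitive recursion and ternary expansions *)

Section Recursion.
Variables (M : rca0_model) (F : rat_field M).
Local Notation N := (num M).
Local Notation ι := (@inj M F).
Local Notation add := (m_add M).
Local Notation mul := (m_mul M).
Local Notation zero := (m_zero M).
Local Notation one := (m_one M).
Local Notation rec := (Arithmetic.rec M).
Local Notation recf := (Arithmetic.recf M).
Local Notation recfun1 := (Arithmetic.recfun1 M).
Local Notation env := (nat -> N).



Implicit Types a b c i j k m n p s t u v w z : N.

(** * Codes of finite sets *)

Definition modulus (b i : N) : N := add one (mul (add i one) b).

(* As in Goedel's beta function, the code [(a, b)] stands for the set of all [i]
   with [1 + (i + 1) b | a]. *)
Definition coded (i c : N) : Prop :=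
  exists d, m_le M d (m_fst M c) /\ m_fst M c = mul d (modulus (m_snd M c) i).

Lemma modulusE b i : ι (modulus b i) = 1 + (ι i + 1) * ι b.
Proof. by rewrite /modulus !(injD, injM, inj1). Qed.

Lemma modulus_ge1 b i : 1 <= ι (modulus b i).
Proof. by rewrite modulusE lerDl mulr_ge0 ?inj_ge0 // addr_ge0 ?inj_ge0. Qed.

Lemma codedP i a b :
  coded i (m_pair M a b) <-> exists d, ι a = ι d * ι (modulus b i).
Proof.
rewrite /coded m_fst_pair m_snd_pair; split=> [[d [_ ->]]|[d ad]].
  by exists d; rewrite injM.
exists d; split; last by apply: (@inj_inj M F); rewrite injM.
by apply/(m_leP F); rewrite ad ler_peMr ?inj_ge0 ?modulus_ge1.
Qed.

(** Serves as n factorial, whose definition would presuppose primitive recursion. The bound on the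
    cofactor keeps the induction statement Sigma01. *)
Lemma common_multiple n :
  exists b, b <> zero /\ forall j, m_lt M j n -> exists e, m_le M e b /\ b = mul e (add j one).
Proof.
move: n; apply: sig1_ind.
- apply: (@sig1_exists M (fun b e => b <> zero /\
    forall j, m_lt M j (e 0%N) -> exists e, m_le M e b /\ b = mul e (add j one))).
  by apply: sig1_rec; recs.
- exists one; split=> [|j /num_lt0//]; by apply/(inj_gt0 F); rewrite inj1.
move=> n [b [b0 H]]; have bgt0 := (inj_gt0 F b).1 b0; have n0 := inj_ge0 F n.
exists (mul b (add n one)); split.
  by apply/(inj_gt0 F); rewrite injM injD inj1 mulr_gt0 //; lra.
move=> j /num_ltS[/H[e [_ be]]|->].
  have E : mul b (add n one) = mul (mul e (add n one)) (add j one).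
    by apply: (@inj_inj M F); rewrite {1}be !(injM, injD); ring.
  exists (mul e (add n one)); split=> //; apply/(m_leP F); rewrite E [leRHS]injM.
  by rewrite ler_peMr ?inj_ge0 // injD inj1; have := inj_ge0 F j; lra.
exists b; split=> //; apply/(m_leP F).
by rewrite injM injD inj1 ler_peMr ?inj_ge0 //; lra.
Qed.

(** The integers of the model: quotients in divisibility arguments may be negative before they are
    seen to be numbers. *)
Definition integral (x : F) : Prop := exists u v, x = ι u - ι v.

Lemma integral_inj a : integral (ι a).
Proof. by exists a, zero; rewrite inj0 subr0. Qed.

Lemma integralB x y : integral x -> integral y -> integral (x - y).
Proof. by move=> [u [v ->]] [u' [v' ->]]; exists (add u v'), (add v u'); rewrite !injD; ring. Qed.

Lemma integralM x y : integral x -> integral y -> integral (x * y).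
Proof.
move=> [u [v ->]] [u' [v' ->]].
by exists (add (mul u u') (mul v v')), (add (mul u v') (mul v u')); rewrite !(injD, injM); ring.
Qed.

Lemma integral_ge0 x : integral x -> 0 <= x -> exists a, x = ι a.
Proof.
move=> [u [v ->]] uv.
case: (num_lt_trichotomy M v u) => [/num_lt_exists[z ->]|[->|/(m_ltP F)]]; last lra.
  by exists (add z one); rewrite !injD; ring.
by exists zero; rewrite subrr inj0.
Qed.

(* Distinct moduli [1 + (i + 1) b] are coprime when [b] is divisible by the
   difference of their indices. *)
Lemma modulus_coprime a b i k d e x :
  ι i - ι k = x * ι d -> x * x = 1 -> integral x -> ι b = ι e * ι d ->
  (exists c, ι a * ι (modulus b k) = ι c * ι (modulus b i)) ->
  exists c, ι a = ι c * ι (modulus b i).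
Proof.
move=> ikd xx ix bed [c E].
have Ii := integral_inj.
(* Let m be the modulus of [i]. The hypothesis makes a (i - k) b a multiple of m, hence also a b^2,
   with quotient [w]. Modulo m, (i + 1) b is -1, so [w2] and [z] each remove one factor b. *)
pose w := x * (ι a - ι c) * ι e.
pose w2 := ι a * ι b - (ι i + 1) * w.
pose z := ι a - (ι i + 1) * w2.
have iI : integral (ι i + 1).
  by exists (add i one), zero; rewrite injD inj1 inj0 subr0.
have iw : integral w by repeat first [apply: integralM | apply: integralB | exact: Ii].
have iw2 : integral w2 by apply: integralB; apply: integralM => //; exact: Ii.
have iz : integral z by apply: integralB => //; apply: integralM.
have wE : ι a * ι b * ι b = w * ι (modulus b i).
  have dE : ι d = x * (ι i - ι k) by rewrite ikd mulrA xx mul1r.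
  have E2 : ι a * (ι i - ι k) * ι b = (ι a - ι c) * ι (modulus b i).
    by move: E; rewrite !modulusE => E; rewrite mulrBl -E; ring.
  rewrite {2}bed dE /w.
  transitivity (x * ι e * (ι a * (ι i - ι k) * ι b)); first by ring.
  by rewrite E2; ring.
have w2E : ι a * ι b = w2 * ι (modulus b i).
  rewrite /w2 mulrBl -[(ι i + 1) * w * _]mulrA -wE modulusE; ring.
have zE : ι a = z * ι (modulus b i).
  by rewrite /z mulrBl -[(ι i + 1) * w2 * _]mulrA -w2E modulusE; ring.
have mgt0 := modulus_ge1 b i.
have [|c' c'E] := integral_ge0 iz; last by exists c'; rewrite -c'E.
have : 0 <= z * ι (modulus b i) by rewrite -zE inj_ge0.
by rewrite pmulr_lge0 //; lra.
Qed.

(** The code of the part of [P] below [k] is a product of moduli, built by induction on [k]. A new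
    modulus is coprime to the others, so it affects the membership of [k] only. Being coded is a
    bounded condition, hence the statement is Sigma01. *)
Lemma finite_set_coded (P : N -> Prop) n : rec (fun e => P (e 0%N)) ->
  exists c, forall i, m_lt M i n -> coded i c <-> P i.
Proof.
move=> recP; have [b [b0 bmul]] := common_multiple n.
have bgt0 := (inj_gt0 F b).1 b0.
have dvd i k a : m_lt M i n -> m_lt M k n -> i <> k ->
    (exists c, ι a * ι (modulus b k) = ι c * ι (modulus b i)) ->
    exists c, ι a = ι c * ι (modulus b i).
  move=> /(m_ltP F) iN /(m_ltP F) kN ik.
  have [i0 k0] := (inj_ge0 F i, inj_ge0 F k).
  case: (num_lt_trichotomy M i k) => [/num_lt_exists[d kE]|[//|/num_lt_exists[d iE]]].
    have [|e [_ bE]] := bmul d.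
      by apply/(m_ltP F); move: kN; rewrite kE !injD inj1; lra.
    apply: (@modulus_coprime a b i k (add d one) e (-1)).
    - by rewrite kE !injD; ring.
    - by ring.
    - by exists zero, one; rewrite inj0 inj1 sub0r.
    - by rewrite {1}bE injM.
  have [|e [_ bE]] := bmul d.
    by apply/(m_ltP F); move: iN; rewrite iE !injD inj1; lra.
  apply: (@modulus_coprime a b i k (add d one) e 1).
  - by rewrite iE !injD; ring.
  - by ring.
  - by exists one, zero; rewrite inj0 inj1 subr0.
  - by rewrite {1}bE injM.
have [a aP] : exists a, forall i, m_lt M i n ->
    (coded i (m_pair M a b) <-> m_lt M i n /\ P i).
  suff : forall k, exists a, forall i, m_lt M i n ->
    (coded i (m_pair M a b) <-> m_lt M i k /\ P i) by apply.
  apply: sig1_ind.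
  - apply: (@sig1_exists M (fun a e => forall i, m_lt M i n ->
      (coded i (m_pair M a b) <-> m_lt M i (e 0%N) /\ P i))).
    by apply: sig1_rec; rewrite /coded /modulus; recs.
  (* The empty product codes the empty set, because every modulus exceeds 1. *)
  - exists one => i iN; split=> [/codedP[d]|[/num_lt0//]].
    rewrite inj1 modulusE => E; exfalso.
    have i0 := inj_ge0 F i; have d0 := inj_ge0 F d.
    have h : 0 < (ι i + 1) * ι b by apply: mulr_gt0 => //; lra.
    move: E h; move: ((ι i + 1) * ι b) => X E h.
    case: (num_zero_or_succ M d) => [dZ|[d' dS]]; move: E.
      by rewrite dZ inj0; lra.
    by rewrite dS injD inj1; have := mulr_ge0 (inj_ge0 F d') (ltW h); have := inj_ge0 F d'; lra.
  move=> k [a aP].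
  have [[kN Pk]|nPk] := EM (m_lt M k n /\ P k); last first.
    exists a => i iN; rewrite (aP i iN); split=> [[ik Pi]|[/num_ltS[ik|ik] Pi]].
    - by split=> //; apply/num_ltS; left.
    - by [].
    - by exfalso; apply: nPk; rewrite -ik.
  exists (mul a (modulus b k)) => i iN; rewrite codedP injM.
  have [->|ik] := EM (i = k).
    split=> _; last by exists a.
    by split=> //; apply/num_ltS; right.
  have -> : (exists d, ι a * ι (modulus b k) = ι d * ι (modulus b i)) <->
            coded i (m_pair M a b).
    rewrite codedP; split; first exact: dvd.
    by move=> [d ->]; exists (mul d (modulus b k)); rewrite injM; ring.
  rewrite (aP i iN); split=> [[lik Pi]|[/num_ltS[lik|//] Pi]]; split=> //.
  by apply/num_ltS; left.
by exists (m_pair M a b) => i iN; rewrite (aP i iN); split=> [[]|].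
Qed.

(** * Primitive recursion *)

Section PrimitiveRecursion.
Variables (x0 : N -> N) (G : N -> N -> N).
Hypotheses (recx0 : recfun1 x0) (recG : Arithmetic.recfun2 M G).

(* [c] codes the graph, with values below [s], of the recursion up to [n]. *)
Definition history (p n c s : N) : Prop :=
  (forall i, m_le M i n -> exists v, m_lt M v s /\ coded (m_pair M i v) c) /\
  (forall v, m_lt M v s -> coded (m_pair M zero v) c -> v = x0 p) /\
  (forall i, m_lt M i n -> forall v, m_lt M v s -> coded (m_pair M (add i one) v) c ->
     exists u, m_lt M u s /\ (coded (m_pair M i u) c /\ v = G (m_pair M p i) u)).

(** Both histories obey the same recursion, and the claim has only bounded quantifiers, so induction
    on [i] applies. *)
Lemma history_uniq p n c s n' c' s' : history p n c s -> history p n' c' s' ->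
  forall i, m_le M i n -> m_le M i n' -> forall v, m_lt M v s -> forall v', m_lt M v' s' ->
  coded (m_pair M i v) c -> coded (m_pair M i v') c' -> v = v'.
Proof.
move=> [_ [h0 hS]] [_ [h0' hS']]; apply: sig1_ind.
- by apply: sig1_rec; rewrite /coded /modulus; recs.
- by move=> _ _ v vs v' vs' /(h0 v vs) -> /(h0' v' vs') ->.
move=> i IH iN iN' v vs v' vs' cv cv'.
have lt_le m : m_le M (add i one) m -> m_lt M i m.
  by move=> /(m_leP F) im; apply/(m_ltP F); move: im; rewrite injD inj1; lra.
have [u [us [cu ->]]] := hS i (lt_le _ iN) v vs cv.
have [u' [us' [cu' ->]]] := hS' i (lt_le _ iN') v' vs' cv'.
by congr G; apply: IH us _ us' cu cu'; left; apply: lt_le.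
Qed.

Lemma pair_bound i v n s : ι i <= ι n -> ι v <= ι s ->
  m_lt M (m_pair M i v) (add (m_pair M n s) one).
Proof.
move=> hi hv; apply/(m_ltP F); rewrite /m_pair !(injD, injM) inj1.
have := inj_ge0 F i; have := inj_ge0 F v => v0 i0; nra.
Qed.

(** A code cannot simply be prolonged, since its common multiple depends on the range. Each step
    recodes the old history, which is a recursive class, together with the new pair. *)
Lemma history_exists p n : exists c s, history p n c s.
Proof.
move: n; apply: sig1_ind.
- apply: (@sig1_exists M (fun c e => exists s, history p (e 0%N) c s)).
  apply: (@sig1_exists M (fun s e => history p (e 1%N) (e 0%N) s)).
  by apply: sig1_rec; rewrite /history /coded /modulus; recs.
- have [|c cP] := @finite_set_coded (fun z => z = m_pair M zero (x0 p))
    (add (m_pair M zero (add (x0 p) one)) one); first by recs.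
  exists c, (add (x0 p) one).
  have C v : m_lt M v (add (x0 p) one) -> coded (m_pair M zero v) c <->
      m_pair M zero v = m_pair M zero (x0 p).
    by move=> /(m_ltP F) vx; apply/cP/pair_bound => //; exact: ltW.
  split; [|split].
  + move=> i /(m_leP F); rewrite inj0 => i0; exists (x0 p).
    have xx : m_lt M (x0 p) (add (x0 p) one) by apply/num_ltS; right.
    split=> //; have -> : i = zero; last exact/C.
    by apply: (@inj_inj M F); rewrite inj0; have := inj_ge0 F i; lra.
  + by move=> v vs /(C v vs)/m_pair_inj[].
  + by move=> i /num_lt0.
move=> n [c [s [h1 [h0 hS]]]].
have [un [uns cun]] := h1 n (m_le_refl M n).
pose v := G (m_pair M p n) un; pose s' := add (add s v) one.
pose P z := (m_le M (m_fst M z) n /\ m_lt M (m_snd M z) s /\ coded z c) \/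
            z = m_pair M (add n one) v.
have [|c' cP] := @finite_set_coded P (add (m_pair M (add n one) s') one).
  by rewrite /P /coded /modulus; recs.
have Cold i w : m_le M i n -> m_lt M w s -> coded (m_pair M i w) c' <-> coded (m_pair M i w) c.
  move=> iN ws; rewrite cP; last first.
    apply: pair_bound; first by rewrite injD inj1; move/(m_leP F): iN; lra.
    rewrite /s' !injD inj1; move/(m_ltP F): ws; have := inj_ge0 F v; lra.
  rewrite /P m_fst_pair m_snd_pair; split=> [[[_ []]//|/m_pair_inj[iE _]]|cw].
    by move/(m_leP F): iN; rewrite iE injD inj1; lra.
  by left.
have Cnew i w : m_le M i (add n one) -> m_lt M w s' -> coded (m_pair M i w) c' ->
    (m_le M i n /\ m_lt M w s /\ coded (m_pair M i w) c) \/ (i = add n one /\ w = v).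
  move=> /(m_leP F) iN /(m_ltP F)/ltW ws /cP -/(_ (pair_bound iN ws)).
  by rewrite /P m_fst_pair m_snd_pair => -[h|/m_pair_inj]; [left|right].
have ss' w : m_lt M w s -> m_lt M w s'.
  by move=> /(m_ltP F) ws; apply/(m_ltP F); rewrite /s' !injD inj1; have := inj_ge0 F v; lra.
have vs' : m_lt M v s'.
  by apply/(m_ltP F); rewrite /s' !injD inj1; have := inj_ge0 F s; lra.
exists c', s'; split; [|split].
- move=> i [/num_ltS iN|iE].
    have [w [ws cw]] := h1 i iN; exists w; split; first exact: ss'.
    exact/Cold.
  exists v; split=> //; apply/cP; last by right; rewrite iE.
  by apply: pair_bound; [rewrite iE | move/(m_ltP F): vs' => /ltW].
- move=> w ws' /Cnew; case=> //.
  + by apply/(m_leP F); rewrite inj0 inj_ge0.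
  + by move=> [_ [ws cw]]; apply: h0.
  + by move=> [/esym/succ_neq_zero].
move=> i iN w ws' /Cnew; case=> //.
- by apply/(m_leP F); rewrite !injD inj1; move/num_ltS/(m_leP F): iN; lra.
- move=> [iN' [ws cw]].
  have [|u [us [cu wE]]] := hS i _ w ws cw.
    by apply/(m_ltP F); move/(m_leP F): iN'; rewrite injD inj1; lra.
  exists u; split; first exact: ss'.
  by split=> //; apply/Cold => //; apply/num_ltS.
move=> [/(congr1 ι) iE ->]; have -> : i = n.
  by apply: (@inj_inj M F); move: iE; rewrite !injD; lra.
exists un; split; first exact: ss'.
by split=> //; apply/Cold => //; exact: m_le_refl.
Qed.

(** A value is found by searching for a history, and uniqueness makes it independent of the history
    found. The parameter [p] gives uniformity: the expansions of all [n] come from one function. *)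
Lemma primitive_recursion : exists H, Arithmetic.recfun2 M H /\
  forall p, H p zero = x0 p /\ forall i, H p (add i one) = G (m_pair M p i) (H p i).
Proof.
(* [z] pairs the parameter with the argument; [w] holds a code, its bound and the value. *)
pose R z w := history (m_fst M z) (m_snd M z) (m_fst M (m_fst M w)) (m_snd M (m_fst M w)) /\
  m_lt M (m_snd M w) (m_snd M (m_fst M w)) /\
  coded (m_pair M (m_snd M z) (m_snd M w)) (m_fst M (m_fst M w)).
have [||w [recw wP]] := @rec_choice M R.
- by rewrite /R /history /coded /modulus; recs.
- move=> z; have [c [s h]] := history_exists (m_fst M z) (m_snd M z).
  have [v [vs cv]] := h.1 _ (m_le_refl M _).
  exists (m_pair M (m_pair M c s) v).
  by rewrite /R !(m_fst_pair, m_snd_pair).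
pose H p i := m_snd M (w (m_pair M p i)).
have HP p i : exists c s, history p i c s /\ m_lt M (H p i) s /\
    coded (m_pair M i (H p i)) c.
  have := wP (m_pair M p i); rewrite /R m_fst_pair m_snd_pair => h.
  by exists (m_fst M (m_fst M (w (m_pair M p i)))), (m_snd M (m_fst M (w (m_pair M p i)))).
exists H; split; first by rewrite /Arithmetic.recfun2 /H; recs.
move=> p; split=> [|i].
  by have [c [s [[_ [h0 _]] [vs cv]]]] := HP p zero; apply: h0.
have [c [s [h [vs cv]]]] := HP p (add i one).
have [c' [s' [h' [vs' cv']]]] := HP p i.
have ii : m_lt M i (add i one) by apply/num_ltS; right.
have [u [us [cu ->]]] := h.2.2 i ii _ vs cv; congr G.
exact: (history_uniq h h' (or_introl ii) (m_le_refl M i) us vs' cu cv').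
Qed.

End PrimitiveRecursion.

(** * Cohesive sets from Cauchy subsequences *)

Lemma cohesive_of_bolzano : bolzano_weierstrass F -> cohesive F.
Proof.
move=> BW R recR.
have rec1 c : recfun1 (fun _ => c) by rewrite /Arithmetic.recfun1; recs.
have rec3 : Arithmetic.recfun2 M (fun _ v => add v (add v v)) by rewrite /Arithmetic.recfun2; recs.
(* [E i] will be the power 3^i. *)
have [E' [recE' E'P]] := primitive_recursion (rec1 one) rec3.
pose E i := E' zero i.
have recE : recfun1 E by rewrite /Arithmetic.recfun1 /E; recs.
have E0 : ι (E zero) = 1 by rewrite /E (E'P zero).1 inj1.
have ES i : ι (E (add i one)) = 3 * ι (E i) by rewrite /E (E'P zero).2 !injD; ring.
pose bit z := if `[< R (m_snd M z) (m_fst M z) >] then one else zero.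
have recbit : recfun1 bit.
  rewrite /Arithmetic.recfun1; apply: recf_if; [|by recs|by recs].
  apply: (rec_ext _ (fun e => R (m_snd M (e 0%N)) (m_fst M (e 0%N)))) => [e|].
    exact: (rwP (asboolP _)).
  by apply: (rec_app2 M R) => //; recs.
have recd : Arithmetic.recfun2 M (fun z v => add (add v (add v v)) (bit z)).
  by rewrite /Arithmetic.recfun2; recs.
(* [A n i] is the integer formed by the first [i] ternary digits belonging to [n]; the digit of
   index [i] tells whether [R i n] holds. *)
have [A [recA AP]] := primitive_recursion (rec1 zero) recd.
have A0 n : ι (A n zero) = 0 by rewrite (AP n).1 inj0.
have AS n i : ι (A n (add i one)) = 3 * ι (A n i) + ι (bit (m_pair M n i)).
  by rewrite (AP n).2 !injD; ring.
have bitE n i : ι (bit (m_pair M n i)) = (`[< R i n >])%:R.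
  by rewrite /bit m_fst_pair m_snd_pair; case: asboolP; rewrite ?inj1 ?inj0.
have Epos i : 0 < ι (E i).
  move: i; apply: sig1_ind; [by apply: sig1_rec; recs|by rewrite E0|].
  by move=> i; rewrite ES; lra.
(* Cleared of denominators: the prefix of length [i] approximates from below, and its error is at
   most half of 3^-i minus half of 3^-(i+d), since digits are at most 1. *)
have digits n i d : ι (E (add i d)) * ι (A n i) <= ι (E i) * ι (A n (add i d)) /\
    2 * (ι (E i) * ι (A n (add i d))) + ι (E i) <=
    2 * (ι (E (add i d)) * ι (A n i)) + ι (E (add i d)).
  move: d; apply: sig1_ind; [by apply: sig1_rec; recs|by rewrite num_addr0; lra|].
  move=> d [h1 h2]; rewrite num_addA ES AS.
  have [b0 b1] : 0 <= ι (bit (m_pair M n (add i d))) /\ ι (bit (m_pair M n (add i d))) <= 1.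
    by rewrite bitE; case: asboolP; split; rewrite ?lexx ?ler01.
  have Ei := ltW (Epos i).
  have := mulr_ge0 Ei b0; have := ler_wpM2l Ei b1; rewrite mulr1 mulrDr.
  by move: h1 h2; clear; lra.
(* Cutting off after [n] digits makes [q n] rational; a given digit is missing for finitely many [n]
   only. *)
pose q n := ι (A n n) / ι (E n).
have recq_q : recseq q.
  apply: (recq_ratio (n := fun e => A (e 0%N) (e 0%N)) (g := fun _ => zero)
    (d := fun e => E (e 0%N))); [by recs|by recs|by recs| |].
    by move=> e; apply/(inj_gt0 F).
  by move=> e; rewrite /ratio_of inj0 subr0.
have approx n i : ι i <= ι n -> ι (A n i) / ι (E i) <= q n /\
    q n < ι (A n i) / ι (E i) + (2 * ι (E i))^-1.
  move=> iN; have [d nE] : exists d, n = add i d.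
    move/(m_leP F): iN => [/num_lt_exists[d ->]|->].
      by exists (add d one); rewrite num_addA.
    by exists zero; rewrite num_addr0.
  have [h1 h2] := digits n i d; rewrite -nE in h1 h2.
  have [Ei En] := (Epos i, Epos n); rewrite /q; split.
    by rewrite ler_pdivrMr // mulrAC ler_pdivlMr //; lra.
  have -> : ι (A n i) / ι (E i) + (2 * ι (E i))^-1 = (2 * ι (A n i) + 1) / (2 * ι (E i)).
    by field; rewrite gt_eqF.
  rewrite ltr_pdivrMr // mulrAC ltr_pdivlMr; last lra.
  by move: h2; lra.
have [|g [recg [gk cau]]] := BW q recq_q.
  move=> n; have := approx n zero; rewrite E0 A0 inj0 => /(_ (inj_ge0 F n)).
  by rewrite !mulr1 mul0r => -[h1 h2]; lra.
(* The range of [g]. As [k <= g k], the search for [k] is bounded, so the range is recursive. *)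
exists (fun m => exists k, m_le M k m /\ g k = m); split; first by recs.
split=> [[b B]|i].
  have := gk b; have : ι (g b) < ι b by apply: B; exists b; split=> //; apply/m_leP; exact: gk.
  by lra.
have Ei := Epos (add i one).
have Einv : 0 < (2 * ι (E (add i one)))^-1 by rewrite invr_gt0; lra.
(* Different prefixes of length [i + 1] force a distance above half of 3^-(i+1); at this tolerance
   the prefix is eventually constant. *)
have [n0 Hn0] := cau _ Einv.
pose K := add n0 (add i one).
have KE : ι K = ι n0 + (ι i + 1) by rewrite !injD inj1.
have [n00 i0] := (inj_ge0 F n0, inj_ge0 F i).
have same k : ι K <= ι k -> ι (A (g k) (add i one)) = ι (A (g K) (add i one)).
  move=> Kk; have := Hn0 k K ltac:(lra) ltac:(lra).
  have iE : ι (add i one) = ι i + 1 by rewrite injD inj1.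
  have gkk := gk k; have gKK := gk K.
  have [a1 a2] := approx (g k) (add i one) ltac:(lra).
  have [a3 a4] := approx (g K) (add i one) ltac:(lra).
  have step (x y : N) : ι x < ι y ->
      ι x / ι (E (add i one)) + 2 * (2 * ι (E (add i one)))^-1 <= ι y / ι (E (add i one)).
    move=> /inj_succ_le xy.
    have -> : ι x / ι (E (add i one)) + 2 * (2 * ι (E (add i one)))^-1 =
              (ι x + 1) / ι (E (add i one)) by field; rewrite gt_eqF.
    by rewrite ler_pM2r ?invr_gt0.
  rewrite ltr_norml => qq; apply/eqP; rewrite eq_le !leNgt; apply/andP; split;
    apply/negP => /step; move: a1 a2 a3 a4 qq; clear; lra.
(* [g] need not be increasing; its values at arguments up to [K] are bounded by their maximum. *)
have [j [_ jmax]] := @argmax M F (fun k => ι (g k)) K ltac:(by recs).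
have stable k : ι K <= ι k -> (R i (g k) <-> R i (g K)).
  move=> /same; rewrite !AS !bitE.
  (* The last digit is recovered from the prefix as its remainder modulo 3. *)
  have noteq (a b : N) : 3 * ι a + 1 <> 3 * ι b.
    move=> ab; have [ba|] := lerP (ι b) (ι a); first lra.
    by move/inj_succ_le; lra.
  case: asboolP => h; case: asboolP => h' //= E3; split=> //.
  - by move: E3; rewrite addr0 => /noteq.
  - by move: E3; rewrite addr0 => /esym/noteq.
have bounded (P : N -> Prop) : (forall k, ι K <= ι k -> ~ P (g k)) ->
    bounded_class F (fun n => (exists k, m_le M k n /\ g k = n) /\ P n).
  move=> nP; exists (add (g j) one) => n [[k [_ <-]] Pk]; rewrite injD inj1.
  have [Kk|kK] := lerP (ι K) (ι k); first by case: (nP k Kk).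
  by have := jmax k; rewrite m_leP => /(_ (ltW kK)); lra.
have [RK|nRK] := EM (R i (g K)); [left|right]; apply: bounded => k /stable; tauto.
Qed.

End Recursion.

End Analysis.

(** * Denotations of the named syntax *)

Module Translation.
Import all_boot all_order all_algebra boolp ring lra.
Import -(notations) Completeness Arithmetic OrderedField Rationals Analysis.
Set Implicit Arguments.
Unset Strict Implicit.
Unset Printing Implicit Defensive.
Import Order.TTheory GRing.Theory Num.Theory.
Local Open Scope ring_scope.
Import -(notations) Defs.

Section Translation.
Variables (M : rca0_model) (F : rat_field M).
Local Notation N := (num M).
Local Notation ι := (@inj M F).
Local Notation qcode := (@Rationals.code M F).

(* A point inside a formula: the numbers of enclosing quantifiers, and the
   values of the variables that they bind. *)
Record world := World {
  depth : nat; sdepth : nat; nums : nat -> N; setvals : nat -> sets M }.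

Definition pushN (w : world) (x : N) : world :=
  World (depth w).+1 (sdepth w) (scons x (nums w)) (setvals w).
Definition pushS (w : world) (X : sets M) : world :=
  World (depth w) (sdepth w).+1 (nums w) (scons X (setvals w)).

Inductive extends (w : world) : world -> Prop :=
| ExtRefl : extends w w
| ExtN w' x : extends w w' -> extends w (pushN w' x)
| ExtS w' X : extends w w' -> extends w (pushS w' X).

Lemma extends_trans w1 w2 w3 : extends w1 w2 -> extends w2 w3 -> extends w1 w3.
Proof. by move=> H; elim => [//|w' x _ IH|w' X _ IH]; [apply: ExtN|apply: ExtS]. Qed.

(* A denotation must persist under further quantifiers, since the named syntax
   reads the depth at which an expression is used. *)
Definition tmden w (t : tm) (a : N) : Prop :=
  forall w', extends w w' -> eval M (nums w') (t (depth w')) = a.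
Definition stden w (X : st) (A : sets M) : Prop :=
  forall w', extends w w' -> setvals w' (X (sdepth w')) = A.
Definition fmden w (p : fm) (P : Prop) : Prop :=
  forall w', extends w w' ->
    (sat M (nums w') (setvals w') (p (depth w') (sdepth w')) <-> P).
Definition clsden w (A : class) (P : N -> Prop) : Prop :=
  forall w' t a, extends w w' -> tmden w' t a -> fmden w' (A t) (P a).

Lemma tmden_ext w w' t a : extends w w' -> tmden w t a -> tmden w' t a.
Proof. by move=> ww' H w'' w'w''; apply: H; apply: extends_trans w'w''. Qed.
Lemma stden_ext w w' X A : extends w w' -> stden w X A -> stden w' X A.
Proof. by move=> ww' H w'' w'w''; apply: H; apply: extends_trans w'w''. Qed.
Lemma clsden_ext w w' A P : extends w w' -> clsden w A P -> clsden w' A P.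
Proof. by move=> ww' H w'' t a w'w''; apply: H; apply: extends_trans w'w''. Qed.

(** Every further number pushed raises both the depth and the index of the variable by one, so a
    fixed level keeps its value. *)
Lemma tmden_var w x : tmden (pushN w x) (fun n => tvar (n - (depth w).+1)%coq_nat) x.
Proof.
move=> w' H; suff [_] : ((depth w).+1 <= depth w')%N /\
  nums w' (depth w' - (depth w).+1)%coq_nat = x by [].
elim: H => [|w'' y _ [dd IH]|w'' X _ //]; cbn [pushN depth nums].
  by rewrite leqnn -[(_ - _)%coq_nat]/(_ - _)%N subnn.
split; first exact: ltnW.
by move: IH; rewrite -![(_ - _)%coq_nat]/(_ - _)%N => IH; rewrite subSn.
Qed.

Lemma stden_var w X : stden (pushS w X) (fun n => (n - (sdepth w).+1)%coq_nat) X.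
Proof.
move=> w' H; suff [_] : ((sdepth w).+1 <= sdepth w')%N /\
  setvals w' (sdepth w' - (sdepth w).+1)%coq_nat = X by [].
elim: H => [|w'' y _ //|w'' Y _ [dd IH]]; cbn [pushS sdepth setvals].
  by rewrite leqnn -[(_ - _)%coq_nat]/(_ - _)%N subnn.
split; first exact: ltnW.
by move: IH; rewrite -![(_ - _)%coq_nat]/(_ - _)%N => IH; rewrite subSn.
Qed.

Lemma tmden_add w s t a b : tmden w s a -> tmden w t b -> tmden w (Add s t) (m_add M a b).
Proof. by move=> Hs Ht w' ww'; rewrite /= Hs ?Ht. Qed.
Lemma tmden_mul w s t a b : tmden w s a -> tmden w t b -> tmden w (Mul s t) (m_mul M a b).
Proof. by move=> Hs Ht w' ww'; rewrite /= Hs ?Ht. Qed.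
Lemma tmden_pair w s t a b : tmden w s a -> tmden w t b -> tmden w (pair s t) (m_pair M a b).
Proof.
by move=> Hs Ht; apply: tmden_add => //; apply: tmden_mul; apply: tmden_add.
Qed.

Lemma fmden_iff w p P Q : (P <-> Q) -> fmden w p P -> fmden w p Q.
Proof. by move=> PQ H w' ww'; rewrite -PQ; apply: H. Qed.

Lemma fmden_eq w s t a b : tmden w s a -> tmden w t b -> fmden w (Eq s t) (a = b).
Proof. by move=> Hs Ht w' ww'; rewrite /= Hs ?Ht. Qed.
Lemma fmden_lt w s t a b : tmden w s a -> tmden w t b -> fmden w (Lt s t) (m_lt M a b).
Proof. by move=> Hs Ht w' ww'; rewrite /= Hs ?Ht. Qed.
Lemma fmden_mem w s X a A : tmden w s a -> stden w X A -> fmden w (Mem s X) (m_mem M a A).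
Proof. by move=> Hs HX w' ww'; rewrite /= Hs ?HX. Qed.
Lemma fmden_bot w : fmden w Bot False. Proof. by []. Qed.

(* [q] need only denote [Q] when [P] holds: this is how an expression that makes
   sense only for functions or for canonical fractions gets a meaning. *)
Lemma fmden_imp w p q P Q : fmden w p P -> (P -> fmden w q Q) -> fmden w (Imp p q) (P -> Q).
Proof.
move=> Hp Hq w' ww'; rewrite /= (Hp w' ww').
by split=> H p'; have := H p'; rewrite (Hq p' w' ww').
Qed.

Lemma fmden_not w p P : fmden w p P -> fmden w (Not p) (~ P).
Proof. by move=> Hp; apply: (fmden_imp Hp) => _; apply: fmden_bot. Qed.

Lemma fmden_and w p q P Q : fmden w p P -> (P -> fmden w q Q) -> fmden w (And p q) (P /\ Q).
Proof.
move=> Hp Hq; apply: (fmden_iff (P := ~ (P -> ~ Q))).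
  by split=> [H|[HP HQ] H]; [apply: contrapT; tauto | exact: H].
by apply: fmden_not; apply: fmden_imp => // HP; apply/fmden_not/Hq.
Qed.

Lemma fmden_or w p q P Q : fmden w p P -> fmden w q Q -> fmden w (Or p q) (P \/ Q).
Proof.
move=> Hp Hq; apply: (fmden_iff (P := ~ P -> Q)).
  by split=> [H|]; [case: (EM P); tauto | tauto].
by apply: fmden_imp => [|_ //]; apply: fmden_not.
Qed.

Lemma fmden_iff_fm w p q P Q : fmden w p P -> fmden w q Q -> fmden w (Iff p q) (P <-> Q).
Proof. by move=> Hp Hq; apply: fmden_and => [|_]; apply: fmden_imp. Qed.

Lemma fmden_le w s t a b : tmden w s a -> tmden w t b ->
  fmden w (Or (Lt s t) (Eq s t)) (ι a <= ι b).
Proof.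
move=> Hs Ht; apply: fmden_iff (m_leP F a b) _.
by apply: fmden_or; [apply: fmden_lt | apply: fmden_eq].
Qed.

Lemma fmden_all w p P :
  (forall w' t x, extends w w' -> tmden w' t x -> fmden w' (p t) (P x)) ->
  fmden w (All p) (forall x, P x).
Proof.
move=> H w' ww'; rewrite /=.
have H' x := H (pushN w' x) _ x (ExtN x ww') (tmden_var (w := w') (x := x)) _ (ExtRefl _).
by split=> Hx x; apply/(H' x); exact: Hx.
Qed.

Lemma fmden_allS w p P :
  (forall w' X A, extends w w' -> stden w' X A -> fmden w' (p X) (P A)) ->
  fmden w (AllS p) (forall A, P A).
Proof.
move=> H w' ww'; rewrite /=.
have H' x := H (pushS w' x) _ x (ExtS x ww') (stden_var (w := w') (X := x)) _ (ExtRefl _).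
by split=> Hx x; apply/(H' x); exact: Hx.
Qed.

Lemma fmden_ex w p P :
  (forall w' t x, extends w w' -> tmden w' t x -> fmden w' (p t) (P x)) ->
  fmden w (Ex p) (exists x, P x).
Proof.
move=> H; apply: (fmden_iff (P := ~ forall x, ~ P x)).
  by split=> [/existsNP[x /contrapT]|[x Px] /(_ x)//]; exists x.
apply: fmden_not; apply: (fmden_all (p := fun t => Not (p t))) => w' t x ww' tx.
exact/fmden_not/H.
Qed.

Lemma fmden_exS w p P :
  (forall w' X A, extends w w' -> stden w' X A -> fmden w' (p X) (P A)) ->
  fmden w (ExS p) (exists A, P A).
Proof.
move=> H; apply: (fmden_iff (P := ~ forall x, ~ P x)).
  by split=> [/existsNP[x /contrapT]|[x Px] /(_ x)//]; exists x.
apply: fmden_not; apply: (fmden_allS (p := fun t => Not (p t))) => w' t x ww' tx.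
exact/fmden_not/H.
Qed.

(** For fractions formed by [qadd] and the like, which need not be reduced. Codes are taken of
    quantified rationals only, whose parts are fixed by [lowden]. *)
Definition ratden w (q : rat) (k : F) : Prop := exists a b c,
  [/\ tmden w (pos q) a, tmden w (neg q) b, tmden w (den q) c, c <> m_zero M &
      ratio_of F a b c = k].
Definition lowden w (q : rat) (k : F) : Prop :=
  [/\ tmden w (pos q) (qnum k), tmden w (neg q) (qneg k) & tmden w (den q) (qden k)].

Lemma ratden_ext w w' q k : extends w w' -> ratden w q k -> ratden w' q k.
Proof.
move=> ww' [a [b [c [H1 H2 H3 H4 H5]]]]; exists a, b, c.
by split=> //; apply: tmden_ext; eassumption.
Qed.

Lemma lowden_ext w w' q k : extends w w' -> lowden w q k -> lowden w' q k.
Proof. by move=> ww' [H1 H2 H3]; split; apply: tmden_ext; eassumption. Qed.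

Lemma lowden_ratden w q k : lowden w q k -> ratden w q k.
Proof.
move=> [H1 H2 H3]; exists (qnum k), (qneg k), (qden k); split=> //.
  exact: qden_neq0.
by rewrite -qratio.
Qed.

Lemma tmden_code w q k : lowden w q k -> tmden w (Defs.code q) (qcode k).
Proof. by move=> [H1 H2 H3]; apply: tmden_pair => //; apply: tmden_pair. Qed.

Lemma m_mul_neq0 (c c' : N) : c <> m_zero M -> c' <> m_zero M -> m_mul M c c' <> m_zero M.
Proof.
move=> /(inj_gt0 F) c0 /(inj_gt0 F) c'0; apply/(inj_gt0 F).
by rewrite injM; apply: mulr_gt0.
Qed.

Lemma ratden_add w q r k l : ratden w q k -> ratden w r l -> ratden w (qadd q r) (k + l).
Proof.
move=> [a [b [c [H1 H2 H3 c0 <-]]]] [a' [b' [c' [H1' H2' H3' c'0 <-]]]].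
exists (m_add M (m_mul M a c') (m_mul M a' c)), (m_add M (m_mul M b c') (m_mul M b' c)),
  (m_mul M c c').
split; try by repeat first [assumption | apply: tmden_add | apply: tmden_mul].
  exact: m_mul_neq0.
have := inj_neq0 F c0; have := inj_neq0 F c'0; rewrite /ratio_of !(injD, injM) => h h'.
by field; rewrite h h'.
Qed.

Lemma ratden_opp w q k : ratden w q k -> ratden w (qopp q) (- k).
Proof.
move=> [a [b [c [H1 H2 H3 c0 <-]]]]; exists b, a, c; split=> //.
by rewrite /ratio_of -mulNr opprB.
Qed.

Lemma ratden_sub w q r k l : ratden w q k -> ratden w r l -> ratden w (qsub q r) (k - l).
Proof. by move=> H1 H2; apply: ratden_add => //; apply: ratden_opp. Qed.

Lemma ratden_zero w : ratden w qzero 0.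
Proof.
exists (m_zero M), (m_zero M), (m_one M); split=> //.
  by apply/(inj_gt0 F); rewrite inj1.
by rewrite /ratio_of subrr mul0r.
Qed.

Lemma ratden_one w : ratden w qone 1.
Proof.
exists (m_one M), (m_zero M), (m_one M); split=> //.
  by apply/(inj_gt0 F); rewrite inj1.
by rewrite /ratio_of inj0 inj1 subr0 divr1.
Qed.

Lemma ratden_inv w t n : tmden w t n -> 0 < ι n -> ratden w (qinv_nat t) (ι n)^-1.
Proof.
move=> tn /(inj_gt0 F) n0; exists (m_one M), (m_zero M), n; split=> //.
by rewrite /ratio_of inj0 inj1 subr0 mul1r.
Qed.

Lemma fmden_qeq w q r k l : ratden w q k -> ratden w r l -> fmden w (qeq q r) (k = l).
Proof.
move=> [a [b [c [H1 H2 H3 c0 <-]]]] [a' [b' [c' [H1' H2' H3' c'0 <-]]]].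
apply: fmden_iff (ratio_of_eq F a b a' b' c0 c'0) _.
by apply: fmden_eq; apply: tmden_add; apply: tmden_mul.
Qed.

Lemma fmden_qlt w q r k l : ratden w q k -> ratden w r l -> fmden w (qlt q r) (k < l).
Proof.
move=> [a [b [c [H1 H2 H3 c0 <-]]]] [a' [b' [c' [H1' H2' H3' c'0 <-]]]].
apply: fmden_iff (ratio_of_lt F a b a' b' c0 c'0) _.
by apply: fmden_lt; apply: tmden_add; apply: tmden_mul.
Qed.

Lemma fmden_qle w q r k l : ratden w q k -> ratden w r l -> fmden w (qle q r) (k <= l).
Proof.
move=> Hq Hr; apply: (fmden_iff (P := k < l \/ k = l)).
  by rewrite le_eqVlt; split=> [[->|->]|/orP[/eqP|]]; rewrite ?eqxx ?orbT; auto.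
by apply: fmden_or; [apply: fmden_qlt | apply: fmden_qeq].
Qed.

Lemma fmden_qis_abs w q r k l : ratden w q k -> ratden w r l ->
  fmden w (qis_abs q r) (k = `|l|).
Proof.
move=> Hq Hr; have H0 := ratden_zero w.
apply: (fmden_iff (P := (0 <= l /\ k = l) \/ (l <= 0 /\ k = - l))).
  have [l0|l0] := lerP 0 l; first by rewrite ger0_norm //; split; [case=> -[]; lra|auto].
  by rewrite ltr0_norm //; split; [case=> -[]; lra|right; split=> //; exact: ltW].
apply: fmden_or; apply: fmden_and => [|_]; try exact: fmden_qle; apply: fmden_qeq => //.
exact: ratden_opp.
Qed.

Lemma fmden_qabs_lt w q r k l : ratden w q k -> ratden w r l ->
  fmden w (qabs_lt q r) (`|k| < l).
Proof.
move=> Hq Hr; apply: (fmden_iff (P := k < l /\ - k < l)).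
  by rewrite ltr_norml; split=> [[]|/andP[]]; lra.
by apply: fmden_and => [|_]; apply: fmden_qlt => //; apply: ratden_opp.
Qed.

Lemma fmden_canonical w q a b c :
  tmden w (pos q) a -> tmden w (neg q) b -> tmden w (den q) c ->
  fmden w (canonical q) (lowest_terms a b c).
Proof.
move=> H1 H2 H3; apply: fmden_and => [|_].
  exact/fmden_not/fmden_eq.
apply: fmden_and => [|_]; first by apply: fmden_or; apply: fmden_eq.
apply: fmden_all => w1 t1 a' e1 h1; apply: fmden_all => w2 t2 b' e2 h2.
apply: fmden_all => w3 t3 c' e3 h3.
have e13 := extends_trans (extends_trans e1 e2) e3.
move: H1 H2 H3 => /(tmden_ext e13) H1 /(tmden_ext e13) H2 /(tmden_ext e13) H3.
move: h1 h2 => /(tmden_ext (extends_trans e2 e3)) h1 /(tmden_ext e3) h2.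
apply: fmden_imp => [|_]; first exact/fmden_not/fmden_eq.
apply: fmden_imp => [|_].
  by apply: fmden_eq; apply: tmden_add; apply: tmden_mul.
by apply: fmden_or; [apply: fmden_lt|apply: fmden_eq].
Qed.

Lemma lowden_terms w q a b c : lowest_terms a b c ->
  tmden w (pos q) a -> tmden w (neg q) b -> tmden w (den q) c ->
  lowden w q (ratio_of F a b c).
Proof. by move=> /(terms_ratio_of F)[h1 h2 h3]; split; rewrite ?h1 ?h2 ?h3. Qed.

Lemma fmden_allQ w p (P : F -> Prop) :
  (forall w' q k, extends w w' -> lowden w' q k -> fmden w' (p q) (P k)) ->
  fmden w (AllQ p) (forall k, P k).
Proof.
move=> H; apply: (fmden_iff (P := forall a b c, lowest_terms a b c -> P (ratio_of F a b c))).
  split=> [Hk k|Hk a b c _]; last exact: Hk.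
  by have [L E] := terms_spec k; rewrite -E; exact: Hk.
apply: fmden_all => w1 t1 a e1 h1; apply: fmden_all => w2 t2 b e2 h2.
apply: fmden_all => w3 t3 c e3 h3.
move: h1 h2 => /(tmden_ext (extends_trans e2 e3)) h1 /(tmden_ext e3) h2.
apply: fmden_imp => [|L]; first exact: fmden_canonical.
by apply: H; [exact: extends_trans (extends_trans e1 e2) e3 | exact: lowden_terms].
Qed.

Lemma fmden_exQ w p (P : F -> Prop) :
  (forall w' q k, extends w w' -> lowden w' q k -> fmden w' (p q) (P k)) ->
  fmden w (ExQ p) (exists k, P k).
Proof.
move=> H; apply: (fmden_iff (P := exists a b c, lowest_terms a b c /\ P (ratio_of F a b c))).
  split=> [[a [b [c [_ Pk]]]]|[k Pk]]; first by exists (ratio_of F a b c).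
  have [L E] := terms_spec k; exists (qnum k), (qneg k), (qden k).
  by split; rewrite ?E.
apply: fmden_ex => w1 t1 a e1 h1; apply: fmden_ex => w2 t2 b e2 h2.
apply: fmden_ex => w3 t3 c e3 h3.
move: h1 h2 => /(tmden_ext (extends_trans e2 e3)) h1 /(tmden_ext e3) h2.
apply: fmden_and => [|L]; first exact: fmden_canonical.
by apply: H; [exact: extends_trans (extends_trans e1 e2) e3 | exact: lowden_terms].
Qed.

End Translation.

Ltac lift e := repeat match goal with
  | H : tmden _ _ _ |- _ => apply (tmden_ext e) in H
  | H : stden _ _ _ |- _ => apply (stden_ext e) in H
  | H : clsden _ _ _ |- _ => apply (clsden_ext e) in H
  | H : lowden _ _ _ |- _ => apply (lowden_ext e) in H
  | H : ratden _ _ _ |- _ => apply (ratden_ext e) in H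
  end.

(** * Denotations of reals, continuous functions and the principles *)

Section Statements.
Variables (M : rca0_model) (F : rat_field M).
Local Notation N := (num M).
Local Notation ι := (@inj M F).
Local Notation qcode := (@Rationals.code M F).


Local Notation world := (world M).
Implicit Types w : world.

Definition seqden w (x : rseq) (X : N -> F) : Prop :=
  forall w' t a q k, extends w w' -> tmden w' t a -> lowden w' q k ->
    fmden w' (x t q) (k = X a).
Definition fnden w (f : st) (G : F -> N -> F) : Prop :=
  forall w' q k t i r v, extends w w' ->
    lowden w' q k -> tmden w' t i -> lowden w' r v ->
    fmden w' (entry f q t r) (v = G k i).

Lemma seqden_ext w w' x X : extends w w' -> seqden w x X -> seqden w' x X.
Proof. by move=> ww' H w'' t a q k e; apply: H; apply: extends_trans e. Qed.
Lemma fnden_ext w w' f G : extends w w' -> fnden w f G -> fnden w' f G.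
Proof. by move=> ww' H w'' q k t i r v e; apply: H; apply: extends_trans e. Qed.

Ltac lifts e := lift e; repeat match goal with
  | H : seqden _ _ _ |- _ => apply (seqden_ext e) in H
  | H : fnden _ _ _ |- _ => apply (fnden_ext e) in H
  end; clear e.

Lemma seqden_app w x X t a q k : seqden w x X -> tmden w t a -> lowden w q k ->
  fmden w (x t q) (k = X a).
Proof. by move=> H; apply: H; apply: ExtRefl. Qed.

Lemma fnden_app w f G q k t i r v : fnden w f G ->
  lowden w q k -> tmden w t i -> lowden w r v -> fmden w (entry f q t r) (v = G k i).
Proof. by move=> H; apply: H; apply: ExtRefl. Qed.

Lemma clsden_app w A P t a : clsden w A P -> tmden w t a -> fmden w (A t) (P a).
Proof. by move=> H; apply: H; apply: ExtRefl. Qed.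

Ltac rats := repeat first
  [ assumption | apply: lowden_ratden; assumption
  | apply: ratden_add | apply: ratden_sub | apply: ratden_opp
  | apply: ratden_zero | apply: ratden_one ].

Lemma seqden_const w q (k : F) : ratden w q k -> seqden w (const q) (fun _ => k).
Proof. by move=> H w' t a r l e ta rl; lifts e; apply: fmden_qeq; rats. Qed.

Lemma seqden_sub w x y X Y : seqden w x X -> seqden w y Y ->
  seqden w (sub x y) (fun n => X n - Y n).
Proof.
move=> Hx Hy w' t a r l e ta rl; lifts e.
apply: (fmden_iff (P := exists k k', k = X a /\ k' = Y a /\ l = k - k')).
  by split=> [[k [k' [-> [-> ->]]]]|->] //; exists (X a), (Y a).
apply: fmden_exQ => w1 q k e hq; lifts e; apply: fmden_exQ => w2 q' k' e hq'; lifts e.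
apply: fmden_and => [|_]; first exact: seqden_app.
by apply: fmden_and => [|_]; [exact: seqden_app | apply: fmden_qeq; rats].
Qed.

Lemma seqden_abs w x X : seqden w x X -> seqden w (abs x) (fun n => `|X n|).
Proof.
move=> Hx w' t a r l e ta rl; lifts e.
apply: (fmden_iff (P := exists k, k = X a /\ l = `|k|)).
  by split=> [[k [-> ->]]|->] //; exists (X a).
apply: fmden_exQ => w1 q k e hq; lifts e.
apply: fmden_and => [|_]; first exact: seqden_app.
by apply: fmden_qis_abs; rats.
Qed.

Lemma seqden_value w f x G X : fnden w f G -> seqden w x X ->
  seqden w (value f x) (app G X).
Proof.
move=> Hf Hx w' t a r l e ta rl; lifts e.
apply: (fmden_iff (P := exists k, k = X a /\ l = G k a)).
  by rewrite /app; split=> [[k [-> ->]]|->] //; exists (X a).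
apply: fmden_exQ => w1 q k e hq; lifts e.
by apply: fmden_and => [|_]; [exact: seqden_app | exact: fnden_app].
Qed.

Lemma fmden_pos w q (k : F) : ratden w q k -> fmden w (qlt qzero q) (0 < k).
Proof. by move=> H; apply: fmden_qlt; rats. Qed.

Lemma fmden_cauchy w x X : seqden w x X -> fmden w (cauchy x) (cauchy_seq X).
Proof.
(* The formula reaches entries only through their graph; its literal reading, with variables equated
   to entries, is simplified here. *)
move=> Hx; apply: (fmden_iff (P := forall ε : F, 0 < ε -> exists n0, forall m n,
  ι n0 <= ι m -> ι n0 <= ι n -> forall a b, a = X m -> b = X n -> `|a - b| < ε)).
  split=> H ε e0; have [n0 Hn] := H ε e0; exists n0 => m n nm nn.
    exact: (Hn m n nm nn _ _ erefl erefl).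
  by move=> a b -> ->; exact: Hn.
apply: fmden_allQ => w1 q ε e hq; lifts e.
apply: fmden_imp => [|_]; first by apply: fmden_pos; rats.
apply: fmden_ex => w2 t n0 e ht; lifts e.
apply: fmden_all => w3 tm m e hm; lifts e; apply: fmden_all => w4 tn n e hn; lifts e.
do 2!(apply: fmden_imp => [|_]; first exact: fmden_le).
apply: fmden_allQ => w5 qa a e ha; lifts e; apply: fmden_allQ => w6 qb b e hb; lifts e.
do 2!(apply: fmden_imp => [|_]; first exact: seqden_app).
by apply: fmden_qabs_lt; rats.
Qed.

Lemma fmden_rle w x y X Y : seqden w x X -> seqden w y Y ->
  fmden w (rle x y) (le_real X Y).
Proof.
move=> Hx Hy; apply: (fmden_iff (P := forall ε : F, 0 < ε -> exists n0, forall n,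
  ι n0 <= ι n -> forall a b, a = X n -> b = Y n -> a <= b + ε)).
  split=> H ε e0; have [n0 Hn] := H ε e0; exists n0 => n nn.
    exact: (Hn n nn _ _ erefl erefl).
  by move=> a b -> ->; exact: Hn.
apply: fmden_allQ => w1 q ε e hq; lifts e.
apply: fmden_imp => [|_]; first by apply: fmden_pos; rats.
apply: fmden_ex => w2 t n0 e ht; lifts e.
apply: fmden_all => w4 tn n e hn; lifts e.
apply: fmden_imp => [|_]; first exact: fmden_le.
apply: fmden_allQ => w5 qa a e ha; lifts e; apply: fmden_allQ => w6 qb b e hb; lifts e.
do 2!(apply: fmden_imp => [|_]; first exact: seqden_app).
by apply: fmden_qle; rats.
Qed.

Lemma fmden_rlt w x y X Y : seqden w x X -> seqden w y Y ->
  fmden w (rlt x y) (lt_real X Y).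
Proof.
move=> Hx Hy; apply: fmden_and => [|_]; first exact: fmden_rle.
by apply: fmden_not; apply: fmden_and => [|_]; apply: fmden_rle.
Qed.

Lemma fmden_unit_interval w x X : seqden w x X -> fmden w (unit_interval x) (in_unit X).
Proof.
by move=> Hx; apply: fmden_and => [|_]; apply: fmden_rle => //; apply: seqden_const; rats.
Qed.

Lemma fmden_ball w x X t n q (k : F) : seqden w x X -> tmden w t n -> 0 < ι n -> lowden w q k ->
  fmden w (ball (qinv_nat t) x (const q)) (in_ball n X k).
Proof.
move=> Hx tn n0 hq; apply: fmden_rlt; last exact/seqden_const/ratden_inv.
apply: seqden_abs; apply: seqden_sub => //.
by apply: seqden_const; rats.
Qed.

Lemma fmden_dom w f x G X : fnden w f G -> seqden w x X ->
  fmden w (dom f x) (in_dom G X).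
Proof.
move=> Hf Hx; apply: (fmden_iff (P := forall ε : F, 0 < ε -> exists n, 0 < ι n /\
    forall q r, in_ball n X q -> in_ball n X r ->
    forall i j, ι n <= ι i -> ι n <= ι j -> forall u v, u = G q i -> v = G r j ->
    `|u - v| < ε)).
  split=> H ε e0; have [n [n0 Hn]] := H ε e0; exists n; split=> // q r qx rx i j ni nj.
    exact: (Hn q r qx rx i j ni nj _ _ erefl erefl).
  by move=> u v -> ->; exact: Hn.
apply: fmden_allQ => w1 q ε e hq; lifts e.
apply: fmden_imp => [|_]; first by apply: fmden_pos; rats.
apply: fmden_ex => w2 t n e ht; lifts e.
(* Positivity of [n] is kept, as [qinv_nat] denotes a rational only for a nonzero argument. *)
apply: fmden_and => [|n0].
  apply: (fmden_iff (P := m_lt M (m_zero M) n)); first by rewrite (m_ltP F) inj0.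
  exact: fmden_lt.
apply: fmden_allQ => w3 qq k e hk; lifts e; apply: fmden_allQ => w4 rr l e hl; lifts e.
do 2!(apply: fmden_imp => [|_]; first exact: fmden_ball).
apply: fmden_all => w5 ti i e hi; lifts e; apply: fmden_all => w6 tj j e hj; lifts e.
do 2!(apply: fmden_imp => [|_]; first exact: fmden_le).
apply: fmden_allQ => w7 uu u e hu; lifts e; apply: fmden_allQ => w8 vv v e hv; lifts e.
do 2!(apply: fmden_imp => [|_]; first exact: fnden_app).
by apply: fmden_qabs_lt; rats.
Qed.

(** * Functions and sets *)

Definition function_graph (P Q : N -> Prop) (X : sets M) : Prop :=
  (forall k, m_mem M k X -> exists a b, P a /\ Q b /\ k = m_pair M a b) /\
  (forall a, P a -> exists b, Q b /\ m_mem M (m_pair M a b) X /\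
     forall b', Q b' -> m_mem M (m_pair M a b') X -> b' = b).

Lemma fmden_is_function w A B f P Q X : clsden w A P -> clsden w B Q -> stden w f X ->
  fmden w (is_function A B f) (function_graph P Q X).
Proof.
move=> HA HB Hf; apply: fmden_and => [|_].
  apply: fmden_all => w1 tk k e hk; lifts e.
  apply: fmden_imp => [|_]; first exact: fmden_mem.
  apply: fmden_ex => w2 ta a e ha; lifts e; apply: fmden_ex => w3 tb b e hb; lifts e.
  apply: fmden_and => [|_]; first exact: clsden_app.
  apply: fmden_and => [|_]; first exact: clsden_app.
  by apply: fmden_eq => //; apply: tmden_pair.
apply: fmden_all => w1 ta a e ha; lifts e.
apply: fmden_imp => [|_]; first exact: clsden_app.
apply: fmden_ex => w2 tb b e hb; lifts e.
apply: fmden_and => [|_]; first exact: clsden_app.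
apply: fmden_and => [|_]; first by apply: fmden_mem => //; apply: tmden_pair.
apply: fmden_all => w3 tb' b' e hb'; lifts e.
apply: fmden_imp => [|_]; first exact: clsden_app.
apply: fmden_imp => [|_]; first by apply: fmden_mem => //; apply: tmden_pair.
exact: fmden_eq.
Qed.

Definition nat_cls (a : N) : Prop := ~ False.
Definition rat_cls (a : N) : Prop := exists k, a = qcode k.
Definition ratnat_cls (a : N) : Prop := exists k i, a = m_pair M (qcode k) i.

Lemma clsden_Nat w : clsden w Nat nat_cls.
Proof. by move=> w' t a e ta; apply: fmden_not; apply: fmden_bot. Qed.

Lemma clsden_Rat w : clsden w Rat rat_cls.
Proof.
move=> w' t a e ta; clear e; apply: fmden_exQ => w1 q k e hq; lifts e.
by apply: fmden_eq => //; apply: tmden_code.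
Qed.

Lemma clsden_RatNat w : clsden w RatNat ratnat_cls.
Proof.
move=> w' t a e ta; clear e; apply: fmden_exQ => w1 q k e hq; lifts e.
apply: fmden_ex => w2 ti i e hi; lifts e.
by apply: fmden_eq => //; apply: tmden_pair => //; apply: tmden_code.
Qed.

Definition represents (X : sets M) (x : N -> F) : Prop :=
  forall n k, m_mem M (m_pair M n (qcode k)) X <-> k = x n.

Lemma represents_uniq X x y : represents X x -> represents X y -> x = y.
Proof. by move=> Hx Hy; apply: funext => n; apply/Hy/Hx. Qed.

Lemma seqden_entries w X A x : stden w X A -> represents A x -> seqden w (entries X) x.
Proof.
move=> HX HA w' t a q k e ta hq; lifts e.
apply: fmden_iff (HA a k) _; apply: fmden_mem => //.
by apply: tmden_pair => //; apply: tmden_code.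
Qed.

Lemma function_graph_seq X : function_graph nat_cls rat_cls X ->
  exists x, recseq x /\ represents X x.
Proof.
move=> [H1 H2].
have H a : exists k, m_mem M (m_pair M a (qcode k)) X /\
    forall k', m_mem M (m_pair M a (qcode k')) X -> k' = k.
  have [//|b [[k ->] [ak ku]]] := H2 a; exists k; split=> // k' ak'.
  by apply: (@code_inj M F); apply: ku => //; exists k'.
have [x Hx] := choice H; exists x.
have R : represents X x.
  by move=> n k; split=> [|->]; [exact: (Hx n).2 | exact: (Hx n).1].
split=> //; apply: (rec_ext M (fun e => m_mem M (m_pair M (e 1%N) (e 0%N)) X)) => [e|].
  rewrite /Arithmetic.tail; split=> [|->]; last exact/R.
  move=> m; have [a [b [_ [[k bE] /m_pair_inj[_ E]]]]] := H1 _ m.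
  by move: m; rewrite E bE => /R ->.
by rec_tac.
Qed.

Lemma seq_function_graph x : recseq x ->
  exists X, function_graph nat_cls rat_cls X /\ represents X x.
Proof.
move=> recx; have [|X HX] := @rec_set M (fun z =>
    z = m_pair M (m_fst M z) (qcode (x (m_fst M z)))).
  apply: rec_eq; first exact: recf_var.
  apply: recf_pair; first by rec_tac.
  by apply: (recq_app (t := fun e => m_fst M (e 0%N)) recx); rec_tac.
have R : represents X x.
  move=> n k; rewrite HX m_fst_pair.
  by split=> [/m_pair_inj[_ /code_inj]|->].
exists X; split=> //; split=> [k /HX ->|a _].
  exists (m_fst M k), (qcode (x (m_fst M k))); split=> //; split=> //.
  by exists (x (m_fst M k)).
exists (qcode (x a)); split; first by exists (x a).
by split=> [|b [k ->] /R ->]; first exact/R.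
Qed.

Definition represents_map (X : sets M) (f : F -> N -> F) : Prop :=
  forall q i v, m_mem M (m_pair M (m_pair M (qcode q) i) (qcode v)) X <-> v = f q i.

Lemma fnden_set w f X G : stden w f X -> represents_map X G -> fnden w f G.
Proof.
move=> Hf HX w' q k t i r v e hq hi hr; lifts e.
apply: fmden_iff (HX k i v) _; apply: fmden_mem => //.
apply: tmden_pair; last exact: tmden_code.
by apply: tmden_pair => //; apply: tmden_code.
Qed.

Lemma function_graph_map X : function_graph ratnat_cls rat_cls X ->
  exists f, recmap f /\ represents_map X f.
Proof.
move=> [H1 H2].
have H z : exists k, m_mem M (m_pair M (m_pair M (qcode z.1) z.2) (qcode k)) X /\
    forall k', m_mem M (m_pair M (m_pair M (qcode z.1) z.2) (qcode k')) X -> k' = k.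
  have [|b [[k ->] [ak ku]]] := H2 (m_pair M (qcode z.1) z.2); first by exists z.1, z.2.
  by exists k; split=> // k' ak'; apply: (@code_inj M F); apply: ku => //; exists k'.
have [f Hf] := choice H; exists (fun q i => f (q, i)).
have R : represents_map X (fun q i => f (q, i)).
  move=> q i v; split=> [|->]; [exact: (Hf (q, i)).2 | exact: (Hf (q, i)).1].
split=> // u t Hu Ht.
apply: (rec_ext M (fun e => m_mem M (m_pair M (m_pair M (qcode (u (Arithmetic.tail M e)))
   (t (Arithmetic.tail M e))) (e 0%N)) X)) => [e|].
  split=> [|->]; last exact/R.
  move=> m; have [a [b [_ [[k bE] /m_pair_inj[_ E]]]]] := H1 _ m.
  by move: m; rewrite E bE => /R ->.
apply: rec_mem; apply: recf_pair; last exact: recf_var.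
by apply: recf_pair; [exact: (recf_weaken _ _ Hu) | exact: (recf_weaken _ _ Ht)].
Qed.

Lemma map_function_graph f : recmap f ->
  exists X, function_graph ratnat_cls rat_cls X /\ represents_map X f.
Proof.
move=> rec_f; pose q z := decode F (m_fst M (m_fst M z)).
have recq_q : recq (fun e => q (e 0%N)) by apply: recq_decode; rec_tac.
have [|X HX] := @rec_set M (fun z => z = m_pair M
    (m_pair M (qcode (q z)) (m_snd M (m_fst M z)))
    (qcode (f (q z) (m_snd M (m_fst M z))))).
  apply: rec_eq; first exact: recf_var.
  apply: recf_pair; last by apply: (rec_f (fun e => q (e 0%N)) (fun e => m_snd M (m_fst M (e 0%N)))) => //; rec_tac.
  by apply: recf_pair; [exact: recq_q | rec_tac].
have R : represents_map X f.
  move=> p i v; rewrite HX /q !(m_fst_pair, m_snd_pair) codeK.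
  by split=> [/m_pair_inj[_ /code_inj]|->].
exists X; split=> //; split=> [k /HX ->|a [p [i ->]]].
  exists (m_pair M (qcode (q k)) (m_snd M (m_fst M k))),
    (qcode (f (q k) (m_snd M (m_fst M k)))).
  split; first by exists (q k), (m_snd M (m_fst M k)).
  by split=> //; exists (f (q k) (m_snd M (m_fst M k))).
exists (qcode (f p i)); split; first by exists (f p i).
by split=> [|b [k ->] /R ->]; first exact/R.
Qed.

Lemma fmden_is_real w X A : stden w X A -> fmden w (is_real X)
  (function_graph nat_cls rat_cls A /\ exists x, represents A x /\ cauchy_seq x).
Proof.
move=> HX; apply: fmden_and => [|/function_graph_seq[x [_ Rx]]].
  exact: (fmden_is_function (@clsden_Nat w) (@clsden_Rat w) HX).
apply: (fmden_iff (P := cauchy_seq x)).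
  by split=> [cx|[y [/represents_uniq/(_ Rx) ->]]]; first by exists x.
by apply: fmden_cauchy; apply: seqden_entries Rx.
Qed.

Lemma fmden_allR w p (P : (N -> F) -> Prop) :
  (forall w' xs x, extends w w' -> seqden w' xs x -> real x -> fmden w' (p xs) (P x)) ->
  fmden w (AllR p) (forall x, real x -> P x).
Proof.
(* [entries] of a set denotes a sequence only if the set is a graph. So the body is read for all [x]
   represented by [A], of which there is exactly one under the premise. *)
move=> H; apply: (fmden_iff (P := forall A, (function_graph nat_cls rat_cls A /\
  exists x, represents A x /\ cauchy_seq x) -> forall x, represents A x -> P x)).
  split=> [HP x [recx cx]|HP A [fA [y [Ry cy]]] x Rx].
    have [X [fX RX]] := seq_function_graph recx; apply: (HP X) => //; split=> //.
    by exists x.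
  have [z [recz Rz]] := function_graph_seq fA; apply: HP.
  by rewrite (represents_uniq Rx Rz); split=> //; rewrite (represents_uniq Rz Ry).
apply: fmden_allS => w1 X A e HX; apply: fmden_imp => [|[fA [y [Ry cy]]]].
  exact: fmden_is_real.
apply: (fmden_iff (P := P y)).
  by split=> [Py x /represents_uniq/(_ Ry) -> //|]; apply.
apply: H => //; first exact: seqden_entries Ry.
by split=> //; have [z [recz /represents_uniq/(_ Ry) <-]] := function_graph_seq fA.
Qed.

Lemma fmden_exR w p (P : (N -> F) -> Prop) :
  (forall w' xs x, extends w w' -> seqden w' xs x -> real x -> fmden w' (p xs) (P x)) ->
  fmden w (ExR p) (exists x, real x /\ P x).
Proof.
move=> H; apply: (fmden_iff (P := exists A, (function_graph nat_cls rat_cls A /\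
  exists x, represents A x /\ cauchy_seq x) /\ forall x, represents A x -> P x)).
  split=> [[A [[fA [y [Ry cy]]] HP]]|[x [[recx cx] Px]]].
    exists y; split; last exact: HP.
    by split=> //; have [z [recz /represents_uniq/(_ Ry) <-]] := function_graph_seq fA.
  have [X [fX RX]] := seq_function_graph recx; exists X; split.
    by split=> //; exists x.
  by move=> y /represents_uniq/(_ RX) ->.
apply: fmden_exS => w1 X A e HX; apply: fmden_and => [|[fA [y [Ry cy]]]].
  exact: fmden_is_real.
apply: (fmden_iff (P := P y)).
  by split=> [Py x /represents_uniq/(_ Ry) -> //|]; apply.
apply: H => //; first exact: seqden_entries Ry.
by split=> //; have [z [recz /represents_uniq/(_ Ry) <-]] := function_graph_seq fA.
Qed.

Lemma fmden_all_continuous w p (P : (F -> N -> F) -> Prop) :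
  (forall w' f G, extends w w' -> fnden w' f G -> fmden w' (p f) (P G)) ->
  fmden w (AllS (fun f => Imp (continuous_on_unit f) (p f)))
    (forall G, continuous G -> P G).
Proof.
move=> H; apply: (fmden_iff (P := forall A, (function_graph ratnat_cls rat_cls A /\
  forall G, represents_map A G -> continuous G) ->
  forall G, represents_map A G -> P G)).
  have uniq A G G' : represents_map A G -> represents_map A G' -> G = G'.
    by move=> R R'; apply: funext => q; apply: funext => i; apply/R'/R.
  split=> [HP G cG|HP A [fA cA] G RG]; last exact/HP/cA.
  have [X [fX RX]] := map_function_graph cG.1; apply: (HP X) => //; split=> // G'.
  by move/uniq/(_ RX) ->.
apply: fmden_allS => w1 f A e Hf; apply: fmden_imp.
  apply: fmden_and => [|/function_graph_map[G [recG RG]]].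
    exact: (fmden_is_function (@clsden_RatNat w1) (@clsden_Rat w1) Hf).
  have Hf' := fnden_set Hf RG.
  have uniq G' : represents_map A G' -> G' = G.
    by move=> R'; apply: funext => q; apply: funext => i; apply/RG/R'.
  apply: (fmden_iff (P := forall x, real x -> in_unit x -> in_dom G x)).
    by split=> [dG G' /uniq -> //|/(_ G RG)[]].
  apply: fmden_allR => w2 xs x e2 Hx rx; lifts e2.
  apply: fmden_imp => [|_]; first exact: fmden_unit_interval.
  exact: fmden_dom.
move=> [fA cA]; have [G [recG RG]] := function_graph_map fA.
apply: (fmden_iff (P := P G)); last by apply: H => //; apply: fnden_set RG.
split=> [PG G' R'|]; last exact.
suff -> : G' = G by [].
by apply: funext => q; apply: funext => i; apply/RG/R'.
Qed.

Lemma fmden_uniform w : fmden w all_uniformly_continuous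
  (forall G : F -> N -> F, continuous G -> uniform G).
Proof.
apply: fmden_all_continuous => w1 f G e1 Hf; clear e1.
apply: fmden_allQ => w2 q ε e hq; lifts e.
apply: fmden_imp => [|_]; first by apply: fmden_pos; rats.
apply: fmden_exQ => w3 d δ e hd; lifts e.
apply: fmden_and => [|_]; first by apply: fmden_pos; rats.
apply: (fmden_iff (P := forall x, real x -> forall y, real y -> in_unit x -> in_unit y ->
    lt_real (fun i => `|x i - y i|) (fun _ => δ) ->
    lt_real (fun i => `|app G x i - app G y i|) (fun _ => ε))).
  by split=> H x => [y rx ry|rx y ry]; exact: H.
apply: fmden_allR => w4 xs x e Hx rx; lifts e.
apply: fmden_allR => w5 ys y e Hy ry; lifts e.
do 2!(apply: fmden_imp => [|_]; first exact: fmden_unit_interval).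
apply: fmden_imp => [|_].
  by apply: fmden_rlt; [exact/seqden_abs/seqden_sub | apply: seqden_const; rats].
apply: fmden_rlt; last by apply: seqden_const; rats.
by apply: seqden_abs; apply: seqden_sub; apply: seqden_value.
Qed.

Lemma fmden_extrema w : fmden w all_have_extrema
  (forall G : F -> N -> F, continuous G -> has_max G /\ has_min G).
Proof.
apply: fmden_all_continuous => w1 f G e1 Hf; clear e1.
apply: fmden_and => [|_]; apply: fmden_exR => w2 xs x e Hx rx; lifts e;
  (apply: fmden_and => [|_]; first exact: fmden_unit_interval);
  apply: fmden_allR => w3 ys y e Hy ry; lifts e;
  (apply: fmden_imp => [|_]; first exact: fmden_unit_interval);
  by apply: fmden_rle; apply: seqden_value.
Qed.

Lemma fmden_bounded w : fmden w all_bounded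
  (forall G : F -> N -> F, continuous G -> bounded_map G).
Proof.
apply: fmden_all_continuous => w1 f G e1 Hf; clear e1.
apply: fmden_exQ => w2 q b e hq; lifts e.
apply: fmden_allR => w3 xs x e Hx rx; lifts e.
apply: fmden_imp => [|_]; first exact: fmden_unit_interval.
apply: fmden_rle; last by apply: seqden_const; rats.
by apply: seqden_abs; apply: seqden_value.
Qed.

Lemma fmden_finite w A P : clsden w A P -> fmden w (finite A) (bounded_class F P).
Proof.
move=> HA; apply: fmden_ex => w1 tb b e hb; lifts e.
apply: fmden_all => w2 tn n e hn; lifts e.
apply: fmden_imp => [|_]; first exact: clsden_app.
by apply: fmden_iff (m_ltP F n b) _; apply: fmden_lt.
Qed.

Lemma fmden_COH w : fmden w COH (cohesive F).
Proof.
apply: (fmden_iff (P := forall R, exists C,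
    ~ bounded_class F (fun n => m_mem M n C) /\
    forall i, bounded_class F (fun n => m_mem M n C /\ ~ m_mem M (m_pair M i n) R) \/
      bounded_class F (fun n => m_mem M n C /\ ~ ~ m_mem M (m_pair M i n) R))).
  (* A recursive relation yields a set by comprehension; conversely, membership in a set is
     recursive. *)
  split=> [H R recR|H R].
    have [|X HX] := @rec_set M (fun z => R (m_fst M z) (m_snd M z)).
      by apply: (rec_app2 M R) => //; rec_tac.
    have [C [infC cohC]] := H X; exists (fun n => m_mem M n C); split; first by rec_tac.
    have RX i n : m_mem M (m_pair M i n) X = R i n.
      by apply: propext; rewrite HX m_fst_pair m_snd_pair.
    split=> // i; have := cohC i.
    by under eq_fun do rewrite RX; under [X in _ \/ bounded_class F X]eq_fun do rewrite RX.
  have [|C [recC [infC cohC]]] := H (fun i n => m_mem M (m_pair M i n) R); first by rec_tac.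
  have [X HX] := @rec_set M C recC; exists X.
  have -> : (fun n => m_mem M n X) = C by apply: funext => n; apply: propext.
  split=> // i; have := cohC i.
  have E (Q : N -> Prop) : (fun n => m_mem M n X /\ Q n) = (fun n => C n /\ Q n).
    by apply: funext => n; apply: propext; rewrite HX.
  by rewrite !E.
apply: fmden_allS => w1 R A e HR; lifts e; apply: fmden_exS => w2 C B e HC; lifts e.
have elem w3 (e : extends w2 w3) : clsden w3 (elements C) (fun n => m_mem M n B).
  by move=> w4 t n e' hn; apply: fmden_mem => //; apply: stden_ext HC; apply: extends_trans e'.
apply: fmden_and => [|_].
  by apply/fmden_not/fmden_finite/elem; exact: ExtRefl.
apply: fmden_all => w3 ti i e hi; have el := elem _ e; lifts e.
have sec : clsden w3 (section R ti) (fun n => m_mem M (m_pair M i n) A).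
  move=> w4 t n e hn; lifts e.
  by apply: fmden_mem => //; apply: tmden_pair.
apply: fmden_or; refine (fmden_finite _) => w4 t n e hn; lifts e;
  (apply: fmden_and => [|_]; first exact: (clsden_app el hn)); apply: fmden_not.
  exact: (clsden_app sec hn).
by apply: fmden_not; exact: (clsden_app sec hn).
Qed.

Lemma fmden_IPP w : fmden w IPP (pigeonhole F).
Proof.
apply: (fmden_iff (P := forall (b : N) A,
    function_graph nat_cls (fun a => ι a <= ι b) A ->
    exists n, ι n <= ι b /\ ~ bounded_class F (fun i => m_mem M (m_pair M i n) A))).
  split=> [H b c recc cb|H b A [fA1 fA2]].
    have [|X HX] := @rec_set M (fun z => z = m_pair M (m_fst M z) (c (m_fst M z))).
      by rec_tac.
    have RX i n : m_mem M (m_pair M i n) X <-> c i = n.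
      by rewrite HX m_fst_pair; split=> [/m_pair_inj[_ ->]|->].
    have [|n [nb infn]] := H b X.
      split=> [k /HX ->|a _].
        by exists (m_fst M k), (c (m_fst M k)); split=> //; split.
      by exists (c a); split; [exact: cb | split=> [|b' _ /RX ->] //; exact/RX].
    exists n; split=> // -[m Hm]; apply: infn; exists m => i /RX; exact: Hm.
  have Hex a : exists ca, (ι ca <= ι b /\ m_mem M (m_pair M a ca) A) /\
      forall b', ι b' <= ι b -> m_mem M (m_pair M a b') A -> b' = ca.
    by have [//|v [vb [av vu]]] := fA2 a; exists v.
  have [c Hc] := choice Hex.
  have RA i n : m_mem M (m_pair M i n) A <-> n = c i.
    split=> [m|->]; last exact: (Hc i).1.2.
    have [a [b' [_ [b'b /m_pair_inj[_ nE]]]]] := fA1 _ m.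
    by apply: (Hc i).2 => //; rewrite nE.
  have [||n [nb infn]] := H b c.
  - by apply: (recf_graph M c (fun x y => m_mem M (m_pair M x y) A)) => [|x y];
      [rec_tac | exact: iff_sym].
  - by move=> n; exact: (Hc n).1.1.
  exists n; split=> // -[m Hm]; apply: infn; exists m => i ci.
  by apply: Hm; apply/RA.
apply: fmden_all => w1 tb b e hb; clear e; apply: fmden_allS => w2 f A e hf; lifts e.
have up : clsden w2 (upto tb) (fun a => ι a <= ι b).
  by move=> w3 t a e ha; lifts e; exact: fmden_le.
apply: fmden_imp => [|_]; first exact: (fmden_is_function (@clsden_Nat w2) up hf).
apply: fmden_ex => w3 tn n e hn; lifts e.
apply: fmden_and => [|_]; first exact: fmden_le.
apply: fmden_not; refine (fmden_finite _) => w4 ti i e hi; lifts e.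
by apply: fmden_mem => //; apply: tmden_pair.
Qed.

Lemma fmden_StCOH w : fmden w StCOH (cohesive F /\ pigeonhole F).
Proof. by apply: fmden_and => [|_]; [exact: fmden_COH | exact: fmden_IPP]. Qed.

End Statements.

(** With one common denotation, no cycle of implications has to be composed. The principle on
    extrema leads to it by way of boundedness. *)
Lemma principle_interpreted (M : rca0_model) (F : rat_field M) (w : world M) p :
  Stdlib.Lists.List.In p [:: StCOH; all_uniformly_continuous; all_have_extrema; all_bounded] ->
  fmden w p (bolzano_weierstrass F).
Proof.
have BE : bolzano_weierstrass F -> forall f : F -> num M -> F, continuous f ->
    has_max f /\ has_min f.
  by move=> BW f cf; split; [exact: has_max_of_bolzano | exact: has_min_of_bolzano].
case=> [<-|[<-|[<-|[<-|[]]]]].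
- refine (fmden_iff _ (@fmden_StCOH M F w)); split; first by case; exact: bolzano_of_cohesive.
  by split; [exact: cohesive_of_bolzano | exact: pigeonhole_of_bolzano].
- refine (fmden_iff _ (@fmden_uniform M F w)); split; first exact: bolzano_of_uniform.
  exact: uniform_of_bolzano.
- refine (fmden_iff _ (@fmden_extrema M F w)); split=> [H|//].
  by apply: bolzano_of_bounded => f cf; have [] := H f cf; exact: bounded_of_extrema.
refine (fmden_iff _ (@fmden_bounded M F w)); split; first exact: bolzano_of_bounded.
by move=> BW f cf; have [] := BE BW f cf; exact: bounded_of_extrema.
Qed.

Lemma equivalence : equivalent_over_RCA0
  [:: StCOH; all_uniformly_continuous; all_have_extrema; all_bounded].
Proof.
move=> p q Hp Hq; apply: completeness => [r Hr σ ρ|m e E Hm].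
  exact: RCA0_fsubst.
(* The given environment supplies the required element of the second sort. *)
pose M := RCA0Model m Hm (E 0%N).
pose w := @World M 0%N 0%N e E.
have Ip := @principle_interpreted M (fieldM_rat_field M) w _ Hp.
have Iq := @principle_interpreted M (fieldM_rat_field M) w _ Hq.
by apply/(fmden_iff_fm Ip Iq (ExtRefl w)).
Qed.

End Translation.

Require Import Defs.
From Stdlib Require Import List.
Import ListNotations.

Theorem theorem6p1 :
  equivalent_over_RCA0
    [ StCOH; all_uniformly_continuous; all_have_extrema; all_bounded ].
Proof. exact Translation.equivalence. Qed.
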